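(* Let $G$ be a countable group. Let $X$ be a compact metrizable space endowed with a geometrically finite (minimal, non-elementary) convergence action of $G$. Then there exists a compact metrizable space $Y$ endowed with a minimal non-elementary convergence action of $G$ satisfying the following: (i) $\mathfrak{H}(G,X)=\mathfrak{H}(G,Y)$; (ii) the spaces $X$ and $Y$ have no common blow-ups, i.e. there is no compact metrizable space $Z$ endowed with a minimal non-elementary convergence action of $G$ that is both a blow-up of $X$ and a blow-up of $Y$. In particular, $Y$ is not a blow-down of $X$.
   Context: Countable groups carry the discrete topology. Convergence actions. Let a countable group $G$ act by homeomorphisms on a compact metrizable space $X$ (with at least three points). The action is a convergence action if for every sequence $(g_n)$ of pairwise distinct elements of $G$ there are a subsequence $(g_{n_k})$ and points $a,b\in X$ such that $g_{n_k}|_{X\setminus\{a\}}$ converges to the constant map $b$ uniformly on compact subsets of $X\setminus\{a\}$. The limit set $\Lambda(G,X)$ is the set of all points $b$ arising in this way. The action is non-elementary if $\Lambda(G,X)$ has more than two points, and a non-elementary action is minimal if $\Lambda(G,X)=X$. An element of $G$ is loxodromic if it has infinite order and exactly two fixed points in $X$. A subgroup $P\le G$ is parabolic if it is infinite, fixes a point of $X$, and contains no loxodromic element; its fixed point is then unique and is called a parabolic point. The maximal parabolic subgroups are exactly the stabilizers of parabolic points. A parabolic point $p$ is bounded if its stabilizer acts cocompactly on $X\setminus\{p\}$. A point $p\in X$ is a conical limit point if there are a sequence $(g_n)$ in $G$ and distinct points $a\ne b$ of $X$ with $g_np\to a$ and $g_nx\to b$ for all $x\in X\setminus\{p\}$.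 A minimal non-elementary convergence action of $G$ on a compact metrizable space $X$ is geometrically finite if every point of $X$ is a conical limit point or a bounded parabolic point. Peripheral structure. For a minimal non-elementary convergence action of $G$ on a compact metrizable space $X$, $\mathfrak{H}(G,X)$ denotes the set of all maximal parabolic subgroups of $G$ with respect to the action on $X$. Blow-ups and blow-downs. Let $X$ and $Y$ be compact metrizable spaces, each endowed with a minimal non-elementary convergence action of $G$. If there exists a $G$-equivariant continuous map from $X$ to $Y$, then $X$ is called a blow-up of $Y$ and $Y$ is called a blow-down of $X$. *)

(* Defs.v *)
From HB Require Import structures.
From mathcomp Require Import all_boot all_order all_algebra.
From mathcomp Require Import all_classical all_reals all_analysis.

Set Implicit Arguments.
Unset Strict Implicit.
Unset Printing Implicit Defensive.

Local Open Scope classical_set_scope.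
Local Open Scope group_scope.

(* Each map of the action is a homeomorphism: by [hact1] and [hactM] its inverse
   is the (continuous) map of the inverse element. *)
Record homeo_action (G : groupType) (X : topologicalType) := HomeoAction {
  hact :> G -> X -> X;
  hact1 : forall x, hact 1 x = x;
  hactM : forall g h x, hact (g * h) x = hact g (hact h x);
  hact_continuous : forall g, continuous (hact g) }.

Section Subgroups.
Context {G : groupType}.

Definition subgroup (P : set G) : Prop :=
  [/\ P 1, forall g h, P g -> P h -> P (g * h) & forall g, P g -> P g^-1].

Definition infinite_order (g : G) : Prop :=
  forall n : nat, (0 < n)%N -> g ^+ n <> 1.

End Subgroups.

(* A compact metrizable space is a compact space carrying a compatible metric.
   Every notion below depends on the metric only through the topology, as a
   compact Hausdorff space has a unique compatible uniformity. *)
Section ConvergenceActions.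
Context {G : groupType} {R : realType} {X : metricType R}.
Variable rho : homeo_action G X.

Definition collapses_to (g : nat -> G) (a b : X) : Prop :=
  forall K : set X, compact K -> K `<=` ~` [set a] ->
    {uniform K, (rho (g n) : X -> X) @[n --> \oo] --> (cst b : X -> X)}.

Definition subseq_collapses_to (g : nat -> G) (a b : X) : Prop :=
  exists2 k : nat -> nat, increasing_seq k & collapses_to (g \o k) a b.

Definition convergence_action : Prop :=
  (`I_3 #<= [set: X])%card /\
  forall g : nat -> G, injective g -> exists a b, subseq_collapses_to g a b.

Definition limit_set : set X :=
  [set b | exists g : nat -> G, injective g /\
           exists a, subseq_collapses_to g a b].

Definition non_elementary : Prop := (`I_3 #<= limit_set)%card.

Definition minimal_action : Prop := limit_set = [set: X].

Definition minimal_nonelementary_convergence_action : Prop :=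
  [/\ convergence_action, non_elementary & minimal_action].

Definition fixed_points (g : G) : set X := [set x | rho g x = x].

Definition loxodromic (g : G) : Prop :=
  infinite_order g /\ (fixed_points g #= `I_2)%card.

Definition fixes (P : set G) (p : X) : Prop := forall g, P g -> rho g p = p.

Definition parabolic_subgroup (P : set G) : Prop :=
  [/\ subgroup P, infinite_set P, exists p, fixes P p
    & forall g, P g -> ~ loxodromic g].

Definition parabolic_point (p : X) : Prop :=
  exists2 P : set G, parabolic_subgroup P & fixes P p.

Definition maximal_parabolic_subgroup (P : set G) : Prop :=
  parabolic_subgroup P /\
  forall Q : set G, parabolic_subgroup Q -> P `<=` Q -> Q = P.

Definition peripheral_structure : set (set G) :=
  [set P | maximal_parabolic_subgroup P].

Definition stabilizer (p : X) : set G := [set g | rho g p = p].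

(* [P] acts cocompactly on the [P]-invariant set [A]: the translates of some
   compact subset of [A] cover [A]. *)
Definition cocompact_on (P : set G) (A : set X) : Prop :=
  exists K : set X, [/\ compact K, K `<=` A
    & A `<=` \bigcup_(g in P) (rho g @` K)].

Definition bounded_parabolic_point (p : X) : Prop :=
  parabolic_point p /\ cocompact_on (stabilizer p) (~` [set p]).

Definition conical_limit_point (p : X) : Prop :=
  exists (g : nat -> G) (a b : X),
    [/\ a <> b, rho (g n) p @[n --> \oo] --> a
      & forall x, x <> p -> rho (g n) x @[n --> \oo] --> b].

Definition geometrically_finite : Prop :=
  minimal_nonelementary_convergence_action /\
  forall p : X, conical_limit_point p \/ bounded_parabolic_point p.

End ConvergenceActions.

Section BlowUps.
Context {G : groupType} {X Y : topologicalType}.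

Definition blow_up (rhoX : homeo_action G X) (rhoY : homeo_action G Y) : Prop :=
  exists2 f : X -> Y, continuous f & forall g x, f (rhoX g x) = rhoY g (f x).

Definition blow_down (rhoY : homeo_action G Y) (rhoX : homeo_action G X) : Prop :=
  blow_up rhoX rhoY.

End BlowUps.

(* Main.v *)
(* High powers of four loxodromics with inequivalent ends play ping-pong, and the two-sided
   words of the Thue-Morse subshift, coded by these powers, describe lines. Identifying the
   two ends of each translate of such a line generates a closed invariant equivalence relation
   on X: two lines share an end only at the finitely many singular words of the subshift, so
   the classes are finite, and the nontrivial ones have finite stabilizers. The quotient Q of
   X therefore has the same peripheral structure as X. A point p of Q with several preimages
   is carried to the attracting point by every collapsing sequence, even when p is the
   repelling point. This rigidity makes it possible to choose on Q minus p a function F which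
   oscillates near p, but so slowly that collapsing sequences do not see its variation. The
   space Y is the closure of the graph of the translates of F; it blows up the orbit of p,
   where stabilizers are finite, so that Y again has the same peripheral structure. A preimage
   x of p in X is not parabolic, hence is conical, so a common blow-up of X and Y has a single
   point over x; but F oscillates along the images of a sequence converging to x.

   Instead of extracting subsequences, all limits are taken along one nonprincipal ultrafilter
   on the natural numbers, along which every sequence of a compact space converges. *)

From HB Require Import structures.
From mathcomp Require Import all_boot all_order all_algebra.
From mathcomp Require Import all_classical all_reals all_analysis.
From mathcomp Require Import lra zify.
Require Import Defs.

Set Implicit Arguments.
Unset Strict Implicit.
Unset Printing Implicit Defensive.

Import Order.TTheory GRing.Theory Num.Theory.
Import numFieldNormedType.Exports.
Import metricType_numDomainType.

Local Open Scope classical_set_scope.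
Local Open Scope ring_scope.

(** * Ultralimits *)

(** Gluing the two ends of the axis of a loxodromic element would leave that element with a single
    fixed point in the quotient and so create a new parabolic subgroup. The glued pairs must
    therefore have finite stabilizers, which calls for aperiodic lines; and as the set of glued
    pairs must be closed off the diagonal, a whole subshift of lines is needed. The Thue-Morse
    subshift is aperiodic, invariant under reversal and recognizable: a long window determines its
    position modulo a power of two, so the words with a common future and different pasts can be
    listed. High powers make the coding faithful: an equality between translates of ends becomes,
    from some position on, an equality of words. The passage to the quotient is needed because a
    collapsing sequence may carry a conical point that it repels away from its attracting point,
    whereas the control of the oscillation rests on this not happening. *)

Lemma free_ultrafilter : exists U : set_system nat, UltraFilter U /\ \oo `<=` U.
Proof. exact: ultraFilterLemma. Qed.

Definition ufil : set_system nat := sval (cid free_ultrafilter).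

#[global] Instance ufil_ultra : UltraFilter ufil.
Proof. by rewrite /ufil; case: cid => U []. Qed.

Lemma ufil_eventually (P : set nat) : (\forall n \near \oo, P n) -> \forall n \near ufil, P n.
Proof. by rewrite /ufil; case: cid => U [] ? sub; exact: sub. Qed.

Lemma ufil_ge N : \forall n \near ufil, (N <= n)%N.
Proof. by apply: ufil_eventually; exists N. Qed.

Lemma ufil_dec (P : set nat) :
  (\forall n \near ufil, P n) \/ (\forall n \near ufil, ~ P n).
Proof. exact: in_ultra_setVsetC. Qed.

Lemma ufil_not (P : set nat) :
  ~ (\forall n \near ufil, P n) -> \forall n \near ufil, ~ P n.
Proof. by case: (ufil_dec P). Qed.

Lemma ufil_ex (P : set nat) : (\forall n \near ufil, P n) -> exists n, P n.
Proof. exact: filter_ex. Qed.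

Lemma ufil_or (P Q : set nat) : (\forall n \near ufil, P n \/ Q n) ->
  (\forall n \near ufil, P n) \/ (\forall n \near ufil, Q n).
Proof.
move=> PQ; case: (ufil_dec P) => [|nP]; [by left|right].
by apply: filterS2 PQ nP => n [].
Qed.

Lemma ufil_fin (I : finType) (f : nat -> I) : exists i, \forall n \near ufil, f n = i.
Proof.
apply: contrapT => /forallNP nf.
have : \forall n \near ufil, forall i : I, f n <> i.
  have : forall s : seq I, \forall n \near ufil, forall i, i \in s -> f n <> i.
    elim=> [|i s IH]; first by near=> n.
    apply: filterS2 (ufil_not (nf i)) IH => n fi fs j.
    by rewrite inE => /orP[/eqP ->//|/fs].
  by move=> /(_ (enum I)); apply: filterS => n + i; apply; rewrite mem_enum.
by move=> /ufil_ex[n /(_ (f n))].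
Unshelve. all: by end_near. Qed.

Lemma ufil_nat (f : nat -> nat) : (exists i, \forall n \near ufil, f n = i) \/
  (forall N, \forall n \near ufil, (N <= f n)%N).
Proof.
case: (pselect (forall N, \forall n \near ufil, (N <= f n)%N)) => [|/existsNP[N fN]].
  by right.
left; have [i fi] := @ufil_fin 'I_N.+1 (fun n => inord (f n)).
exists i; apply: filterS2 fi (ufil_not fN) => n <- /negP.
by rewrite -ltnNge => fnN; rewrite inordK// ltnS ltnW.
Qed.

(* Along [ufil], [unc] plays the role of injectivity: a sequence that is constant on no set of
   the ultrafilter has an injective subsequence. *)
Definition unc (T : Type) (g : nat -> T) :=
  forall t, \forall n \near ufil, g n <> t.

Lemma not_unc (T : Type) (g : nat -> T) :
  ~ unc g -> exists t, \forall n \near ufil, g n = t.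
Proof.
move=> /existsNP[t] /ufil_not gt; exists t.
by apply: filterS gt => n /contrapT.
Qed.

Lemma inj_unc (T : Type) (g : nat -> T) : injective g -> unc g.
Proof.
move=> gi t; case: (pselect (exists n, g n = t)) => [[m gm]|/forallNP gt].
  by apply: filterS (ufil_ge m.+1) => n mn gn; move: mn; rewrite (gi n m) ?ltnn// gn.
by near=> n; apply: gt.
Unshelve. all: by end_near. Qed.

Lemma unc_inj (T U : Type) (f : T -> U) (g : nat -> T) :
  injective f -> unc g -> unc (f \o g).
Proof.
move=> fi gu u; case: (pselect (exists t, f t = u)) => [[t ft]|/forallNP nt].
  by apply: filterS (gu t) => n gt /= fg; apply/gt/fi; rewrite ft.
by near=> n => /nt.
Unshelve. all: by end_near. Qed.

(** The way back from ultralimits to honest subsequences. The terms are chosen one at a time in a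
    set of the ultrafilter, avoiding the finitely many indices and values already used; the length
    of the history list says which condition comes next. *)
Lemma extraction (T : Type) (g : nat -> T) (P : nat -> nat -> Prop) :
  unc g -> (forall i, \forall n \near ufil, P i n) ->
  exists k : nat -> nat,
    [/\ increasing_seq k, injective (g \o k) & forall i, P i (k i)].
Proof.
move=> gu PU.
have step (s : seq nat) : exists n, P (size s) n /\
    forall j, j \in s -> (j < n)%N /\ g n <> g j.
  have : \forall n \near ufil, forall j, j \in s -> (j < n)%N /\ g n <> g j.
    elim: s => [|i s IH]; first by near=> n.
    apply: filterS3 (gu (g i)) (ufil_ge i.+1) IH => n gi ni sn j.
    by rewrite inE => /orP[/eqP ->|/sn].
  move=> H; have [n [? ?]] := ufil_ex (filterI (PU (size s)) H).
  by exists n.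
have {step}[F FP] := choice step.
pose L := fix L i := if i is i'.+1 then F (L i') :: L i' else [::].
have sL i : size (L i) = i by elim: i => //= i ->.
have inL i j : (i < j)%N -> F (L i) \in L j.
  elim: j => // j IH; rewrite ltnS leq_eqVlt => /orP[/eqP ->|/IH] /=.
    by rewrite inE eqxx.
  by rewrite inE => ->; rewrite orbT.
have lt_k i j : (i < j)%N -> (F (L i) < F (L j))%N /\ g (F (L j)) <> g (F (L i)).
  by move=> /inL ij; exact: (FP (L j)).2.
exists (fun i => F (L i)); split.
- by apply/increasing_seqP => n; rewrite ltEnat; exact: (lt_k _ _ (ltnSn n)).1.
- move=> i j /= gij; have [ij|ji|//] := ltngtP i j.
    by case: (lt_k _ _ ij).2.
  by case: (lt_k _ _ ji).2.
- by move=> i; rewrite -{1}(sL i); exact: (FP _).1.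
Unshelve. all: by end_near. Qed.

Section UltraLimits.
Context {R : realType} {X : metricType R}.
Implicit Types (u v : nat -> X) (x y l : X).

Local Notation d := (@mdist R X).

Record ucv u l : Prop := Ucv { ucv_cvg : u @ ufil --> l }.

Lemma ucvP u l : ucv u l <-> forall e, 0 < e -> \forall n \near ufil, d l (u n) < e.
Proof. by split=> [[/cvgrPdist_lt]|/cvgrPdist_lt]. Qed.

Lemma ucv_cst x : ucv (fun=> x) x.
Proof. by split; exact: cvg_cst. Qed.

Lemma ucv_eq u v l : (\forall n \near ufil, u n = v n) -> ucv u l -> ucv v l.
Proof.
move=> uv /ucvP ul; apply/ucvP => e e0.
by apply: filterS2 uv (ul e e0) => n <-.
Qed.

Lemma ucv_uniq u l l' : ucv u l -> ucv u l' -> l = l'.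
Proof. by move=> [ul] [ul']; exact: (cvg_unique (@metric_hausdorff R X) ul ul'). Qed.

Lemma cvg_ucv u l : u @ \oo --> l -> ucv u l.
Proof. by move=> ul; split=> A /ul; exact: ufil_eventually. Qed.

Lemma ucv_ge u v x y r : ucv u x -> ucv v y ->
  (\forall n \near ufil, r <= d (u n) (v n)) -> r <= d x y.
Proof.
move=> /ucvP ux /ucvP vy ruv; apply/ler_addgt0Pl => e e0.
have e2 : 0 < e / 2 by rewrite divr_gt0.
have [n [[xu yv] ruvn]] := ufil_ex (filterI (filterI (ux _ e2) (vy _ e2)) ruv).
have := metric_triangle (u n) x (v n); have := metric_triangle x y (v n).
rewrite (metric_sym (u n) x); lra.
Qed.

Lemma ucv_le u v x y r : ucv u x -> ucv v y ->
  (\forall n \near ufil, d (u n) (v n) <= r) -> d x y <= r.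
Proof.
move=> /ucvP ux /ucvP vy ruv; apply/ler_addgt0Pl => e e0.
have e2 : 0 < e / 2 by rewrite divr_gt0.
have [n [[xu yv] ruvn]] := ufil_ex (filterI (filterI (ux _ e2) (vy _ e2)) ruv).
have := metric_triangle x (u n) y; have := metric_triangle (u n) (v n) y.
rewrite (metric_sym (v n) y); lra.
Qed.

Lemma mdist_gt0P x y : x <> y -> 0 < d x y.
Proof. by move=> /eqP; rewrite mdist_gt0. Qed.

Lemma ucv_neq u l x : ucv u l -> l <> x -> \forall n \near ufil, u n <> x.
Proof.
move=> /ucvP ul /mdist_gt0P lx; apply: filterS (ul _ lx) => n + unx.
by rewrite unx ltxx.
Qed.

Lemma ucv_closed u l (A : set X) : closed A -> (\forall n \near ufil, A (u n)) ->
  ucv u l -> A l.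
Proof.
move=> cA Au [ul]; apply: cA => B /ul Bu.
by have [n [? ?]] := ufil_ex (filterI Au Bu); exists (u n).
Qed.

Hypothesis X_compact : compact [set: X].

(** A cluster point of an ultrafilter is a limit: a ball around it that is not in the ultrafilter
    would have its complement there. *)
Lemma ucv_ex u : exists l, ucv u l.
Proof.
have [l [_ ul]] := X_compact (fmap_proper_filter u ultra_proper) (filterT (F := u @ ufil)).
exists l; apply/ucvP => e e0; apply: contrapT => /ufil_not nu.
have /(_ [set x | ~ d l x < e] (ball l e)) := ul.
case=> [||x [/= + ]].
- by apply: filterS nu.
- exact: nbhsx_ballx.
- by rewrite ballEmdist.
Qed.

End UltraLimits.


Lemma ucv_continuous (R : realType) (X Y : metricType R) (f : X -> Y) u l :
  continuous f -> ucv u l -> ucv (f \o u) (f l).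
Proof. by move=> fc [ul]; split; apply: cvg_comp ul (fc l). Qed.

Lemma ucv_continuousP (R : realType) (X Y : metricType R) (f : X -> Y) :
  (forall u l, ucv u l -> ucv (f \o u) (f l)) -> continuous f.
Proof.
move=> fu x; apply/cvgrPdist_lt => e e0; apply: contrapT => nf.
have ex (n : nat) : exists y, mdist x y < n.+1%:R^-1 /\ ~ mdist (f x) (f y) < e.
  apply: contrapT => /forallNP H; apply: nf.
  apply/nbhs_mdistP; exists n.+1%:R^-1 => /=; first by rewrite invr_gt0.
  by move=> y xy; apply: contrapT => fxy; apply: (H y).
have {ex}[u uP] := choice ex.
have ux : ucv u x.
  apply: cvg_ucv; apply/cvgrPdist_lt => r r0.
  have := near_infty_natSinv_lt (PosNum r0); apply: filterS => n /=.
  exact/lt_trans/(uP n).1.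
have /ucvP/(_ e e0)/ufil_ex[n] := fu _ _ ux.
by have := (uP n).2.
Qed.

Lemma card_le3P (T : Type) (A : set T) : (`I_3 #<= A)%card <->
  exists x y z, [/\ A x, A y, A z & [/\ x <> y, y <> z & x <> z]].
Proof.
split=> [/card_leP/unsquash f|[x [y [z [Ax Ay Az [xy yz xz]]]]]].
  have I0 : 0%N \in `I_3 by rewrite inE.
  have I1 : 1%N \in `I_3 by rewrite inE.
  have I2 : 2%N \in `I_3 by rewrite inE.
  pose f' i (Ii : i \in `I_3) : T := set_val (f (exist _ i Ii)).
  have fA i Ii : A (@f' i Ii) by exact: set_valP.
  have fi i j Ii Ij : i != j -> @f' i Ii <> @f' j Ij.
    move=> ij /val_inj /inj; rewrite !in_setT => /(_ isT isT)[] E.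
    by move: ij; rewrite E eqxx.
  exists (f' _ I0), (f' _ I1), (f' _ I2); split; try exact: fA.
  by split; apply: fi.
pose f (n : nat) := if n == 0%N then x else if n == 1%N then y else z.
have fi : {in `I_3 &, injective f}.
  move=> i j; rewrite !inE /f.
  case: i => [|[|[|//]]]; case: j => [|[|[|//]]] //= _ _ E;
    by [case: xy|case: yz|case: xz].
rewrite -(card_le_eql (inj_card_eq fi)).
apply: subset_card_le => _ [i /= _ <-]; rewrite /f.
by case: eqP => // _; case: eqP.
Qed.

(** * Collapsing sequences *)

Section Action.
Context {G : groupType} {T : topologicalType} (rho : homeo_action G T).

Lemma rhoK g : cancel (rho g) (rho g^-1%g).
Proof. by move=> x; rewrite -hactM mulVg hact1. Qed.

Lemma rhoVK g : cancel (rho g^-1%g) (rho g).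
Proof. by move=> x; rewrite -hactM mulgV hact1. Qed.

Lemma rho_inj g : injective (rho g).
Proof. exact: can_inj (rhoK g). Qed.

End Action.

Section Collapse.
Context {G : groupType} {R : realType} {X : metricType R}.
Variable rho : homeo_action G X.
Hypothesis X_compact : compact [set: X].
Implicit Types (g : nat -> G) (a b x y : X).

Local Notation d := (@mdist R X).

(* The ultralimit form of [collapses_to]. *)
Definition ucoll g a b := forall (x : nat -> X) l, ucv x l -> l <> a ->
  ucv (fun n => rho (g n) (x n)) b.

Lemma ucv_rho f u (l : X) : ucv u l -> ucv (fun n => rho f (u n)) (rho f l).
Proof. exact: (ucv_continuous (@hact_continuous _ _ rho f)). Qed.

(** The uniform form. If it failed, bad points could be chosen for each index, and their ultralimit,
    at distance at least [e] from [a], would contradict collapsing. *)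
Lemma ucollP g a b : ucoll g a b <-> forall e : R, 0 < e ->
  \forall n \near ufil, forall x, e <= d a x -> d b (rho (g n) x) < e.
Proof.
split=> [gab e e0|H x l xl la].
  apply: contrapT => /ufil_not nP.
  have ex n : exists x, ~ (forall x, e <= d a x -> d b (rho (g n) x) < e) ->
      e <= d a x /\ ~ d b (rho (g n) x) < e.
    case: (pselect (forall x, e <= d a x -> d b (rho (g n) x) < e)) => [?|].
      by exists a.
    by move=> /existsNP[x /not_implyP ?]; exists x.
  have {ex}[x xP] := choice ex.
  have [l xl] := ucv_ex X_compact x.
  have la : l <> a.
    move=> la; have : e <= d a l.
      by apply: ucv_ge (ucv_cst a) xl _; apply: filterS nP => n /xP[].
    by rewrite la mdistxx leNgt e0.
  have /ucvP/(_ e e0) gb := gab x l xl la.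
  by have [n [? /xP[]]] := ufil_ex (filterI gb nP).
apply/ucvP => e e0.
have la0 : 0 < d a l / 2 by rewrite divr_gt0// mdist_gt0P//; exact/nesym.
have r0 : 0 < Num.min e (d a l / 2) by rewrite lt_min e0.
have /ucvP/(_ _ la0) xl' := xl.
apply: filterS2 (H _ r0) xl' => n + xnl.
move=> /(_ (x n)) H'; apply: lt_le_trans (H' _) _; rewrite ?ge_min ?lexx//.
apply/orP; right.
have := metric_triangle a (x n) l; rewrite (metric_sym (x n) l); lra.
Qed.

Lemma ucollM f g f' a b : ucoll g a b ->
  ucoll (fun n => f * g n * f')%g (rho f'^-1%g a) (rho f b).
Proof.
move=> gab x l xl la.
have l'a : rho f' l <> a by move=> E; apply: la; rewrite -E rhoK.
have := ucv_rho f (gab _ _ (ucv_rho f' xl) l'a).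
by under eq_fun do rewrite -!hactM.
Qed.

Arguments ucollM f {g} f' {a b}.

Lemma ucollMl f g a b : ucoll g a b -> ucoll (fun n => f * g n)%g a (rho f b).
Proof.
move=> /(ucollM f 1%g); rewrite invg1 hact1.
by under eq_fun do rewrite mulg1.
Qed.

Arguments ucollMl f {g a b}.

Lemma ucollMr f g a b : ucoll g a b -> ucoll (fun n => g n * f)%g (rho f^-1%g a) b.
Proof.
move=> /(ucollM 1%g f); rewrite hact1.
by under eq_fun do rewrite mul1g.
Qed.

Arguments ucollMr f {g a b}.

(** If the points [(g n)^-1 (x n)] had a limit other than [a], applying [g n] to them would force
    [x n] to tend to [b]. *)
Lemma ucollV g a b : ucoll g a b -> ucoll (fun n => (g n)^-1)%g b a.
Proof.
move=> gab x l xl lb.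
have [y xy] := ucv_ex X_compact (fun n => rho (g n)^-1%g (x n)).
case: (pselect (y = a)) => [<-//|ya]; case: lb.
apply: ucv_uniq xl _; have := gab _ _ xy ya.
by under eq_fun do rewrite rhoVK.
Qed.

Lemma ucoll_subseq g a b : ucoll g a b -> unc g -> exists k : nat -> nat,
  [/\ increasing_seq k, injective (g \o k) & collapses_to rho (g \o k) a b].
Proof.
move=> /ucollP gab gu.
have i0 (i : nat) : 0 < i.+1%:R^-1 :> R by rewrite invr_gt0.
have [k [ki gk kP]] := extraction gu (fun i => gab _ (i0 i)).
exists k; split=> // K cK Ka A /uniform_nbhs[E [entE EA]].
have := entE; rewrite -entourage_ballE => -[/= e e0 eE].
have [r /= r0 rK] : exists2 r, 0 < r & forall x, K x -> r <= d a x.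
  have : nbhs a (~` K).
    have := compact_closed (@metric_hausdorff R X) cK; rewrite -openC => oK.
    by apply: open_nbhs_nbhs; split=> // /Ka; apply.
  rewrite -filter_from_mdist_nbhs => -[r /= r0 rK]; exists r => // x Kx.
  by rewrite leNgt; apply/negP => /rK; apply.
have m0 : 0 < Num.min e r by rewrite lt_min e0.
apply: filterS (near_infty_natSinv_lt (PosNum m0)) => n /= nm.
apply: EA => x Kx; apply: eE => /=; rewrite ballEmdist /=.
apply: lt_trans (kP n x _) _.
  by apply: le_trans (rK x Kx); apply: ltW; apply: lt_le_trans nm _; rewrite ge_min lexx orbT.
by apply: lt_le_trans nm _; rewrite ge_min lexx.
Qed.

Lemma collapses_ucoll g a b : collapses_to rho g a b -> ucoll g a b.
Proof.
move=> gab; apply/ucollP => e e0.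
pose K := [set x | e <= d a x].
have cK : compact K.
  apply: (subclosed_compact _ X_compact) => //.
  rewrite -openC openE => x /= /negP; rewrite -ltNge => xe.
  apply/nbhs_mdistP; exists (e - d a x) => /=; first by rewrite subr_gt0.
  move=> y /= xy; apply/negP; rewrite -ltNge.
  have := metric_triangle a x y; lra.
have Ka : K `<=` ~` [set a] by move=> x + xa; rewrite /K/= xa mdistxx leNgt e0.
pose E := [set xy : X * X | ball xy.1 e xy.2].
have entE : entourage E by rewrite -entourage_ballE; exists e.
have /uniform_nbhs : exists E', entourage E' /\ [set h : X -> X | forall y, K y -> E' (b, h y)]
    `<=` [set h | forall y, K y -> d b (h y) < e].
  exists E; split=> // h hE y /hE; rewrite /E /= ballEmdist; exact.
move=> /(gab K cK Ka) H; apply: ufil_eventually; exact: H.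
Qed.

Lemma ucoll_reindex g a b :
  subseq_collapses_to rho g a b -> injective g ->
  exists h : nat -> G, injective h /\ ucoll h a b.
Proof.
move=> [f fi gf] gi; exists (g \o f); split; last exact: collapses_ucoll.
by apply: inj_comp gi _; exact: increasing_seq_injective.
Qed.

Lemma limit_setP b : limit_set rho b <-> exists g, unc g /\ exists a, ucoll g a b.
Proof.
split=> [[g [gi [a gab]]]|[g [gu [a gab]]]].
  have [h [hi hab]] := ucoll_reindex gab gi.
  by exists h; split; [exact: inj_unc|exists a].
have [k [ki gk gkab]] := ucoll_subseq gab gu.
exists (g \o k); split=> //; by exists a; exists id => // n m.
Qed.

Lemma convergence_actionI : (`I_3 #<= [set: X])%card ->
  (forall g, unc g -> exists a b, ucoll g a b) -> convergence_action rho.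
Proof.
move=> X3 H; split=> // g gi; have [a [b gab]] := H g (inj_unc gi).
have [k [ki gk gkab]] := ucoll_subseq gab (inj_unc gi).
by exists a, b, k.
Qed.

(** The form in which the convergence property is used nearly everywhere. At most one of the three
    limits is the repelling point, so the images of the two others have a common limit. To show that
    a sequence of group elements is constant along the ultrafilter, it suffices to find three moving
    points whose limits and whose image limits are distinct. *)
Lemma no_triple g x1 x2 x3 y1 y2 y3 (u1 u2 u3 : nat -> X) :
  convergence_action rho -> unc g ->
  ucv u1 x1 -> ucv u2 x2 -> ucv u3 x3 ->
  ucv (fun n => rho (g n) (u1 n)) y1 ->
  ucv (fun n => rho (g n) (u2 n)) y2 ->
  ucv (fun n => rho (g n) (u3 n)) y3 ->
  x1 <> x2 -> x2 <> x3 -> x1 <> x3 -> y1 <> y2 -> y2 <> y3 -> y1 <> y3 -> False.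
Proof.
move=> [_ ca] gu c1 c2 c3 d1 d2 d3 x12 x23 x13 y12 y23 y13.
pose P (i n : nat) := [/\ d x1 (u1 n) < i.+1%:R^-1, d x2 (u2 n) < i.+1%:R^-1,
   d x3 (u3 n) < i.+1%:R^-1 & [/\ d y1 (rho (g n) (u1 n)) < i.+1%:R^-1,
   d y2 (rho (g n) (u2 n)) < i.+1%:R^-1 & d y3 (rho (g n) (u3 n)) < i.+1%:R^-1]].
have PU i : \forall n \near ufil, P i n.
  have i0 : 0 < i.+1%:R^-1 :> R by rewrite invr_gt0.
  move/ucvP/(_ _ i0) : c1 => c1; move/ucvP/(_ _ i0) : c2 => c2.
  move/ucvP/(_ _ i0) : c3 => c3; move/ucvP/(_ _ i0) : d1 => d1.
  move/ucvP/(_ _ i0) : d2 => d2; move/ucvP/(_ _ i0) : d3 => d3.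
  apply: filterS3 (filterI c1 c2) (filterI c3 d1) (filterI d2 d3).
  by move=> n [? ?] [? ?] [? ?].
have [k [ki gk kP]] := extraction gu PU.
have [a [b [k' k'i /collapses_ucoll gab]]] := ca _ gk.
have cvk (u : nat -> X) x : (forall i, d x (u (k i)) < i.+1%:R^-1) -> ucv (u \o k \o k') x.
  move=> H; apply: cvg_ucv; apply/cvgrPdist_lt => e e0.
  apply: filterS (near_infty_natSinv_lt (PosNum e0)) => n /= ne.
  apply: lt_trans (H _) _; apply: le_lt_trans ne.
  rewrite lef_pV2 ?posrE// ler_nat ltnS.
  elim: n => // n IH; apply: leq_ltn_trans IH _.
  by have /increasing_seqP/(_ n) := k'i; rewrite ltEnat.
have {}c1 : ucv (u1 \o k \o k') x1 by apply: cvk => i; case: (kP i).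
have {}c2 : ucv (u2 \o k \o k') x2 by apply: cvk => i; case: (kP i).
have {}c3 : ucv (u3 \o k \o k') x3 by apply: cvk => i; case: (kP i).
have {}d1 : ucv ((fun n => rho (g n) (u1 n)) \o k \o k') y1.
  by apply: cvk => i; case: (kP i) => _ _ _ [].
have {}d2 : ucv ((fun n => rho (g n) (u2 n)) \o k \o k') y2.
  by apply: cvk => i; case: (kP i) => _ _ _ [].
have {}d3 : ucv ((fun n => rho (g n) (u3 n)) \o k \o k') y3.
  by apply: cvk => i; case: (kP i) => _ _ _ [].
case: (pselect (x1 = a)) => [x1a|/(gab _ _ c1)/(ucv_uniq d1) y1b].
  have x2a : x2 <> a by rewrite -x1a; exact/nesym.
  have x3a : x3 <> a by rewrite -x1a; exact/nesym.
  apply: y23; rewrite (ucv_uniq d2 (gab _ _ c2 x2a)).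
  by rewrite (ucv_uniq d3 (gab _ _ c3 x3a)).
case: (pselect (x2 = a)) => [x2a|/(gab _ _ c2)/(ucv_uniq d2) y2b]; last first.
  by apply: y12; rewrite y1b y2b.
have x3a : x3 <> a by rewrite -x2a; exact/nesym.
by apply: y13; rewrite y1b (ucv_uniq d3 (gab _ _ c3 x3a)).
Qed.

End Collapse.

Arguments ucollM {G R X rho} f {g} f' {a b} _.
Arguments ucollMl {G R X rho} f {g a b} _.
Arguments ucollMr {G R X rho} f {g a b} _.

(** * Loxodromic elements *)

Lemma unc_notin (T : eqType) (u : nat -> T) (s : seq T) : unc u ->
  \forall n \near ufil, u n \notin s.
Proof.
move=> uu; elim: s => [|x s IH]; first by near=> n.
by apply: filterS2 (uu x) IH => n /eqP ux us; rewrite inE negb_or ux.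
Unshelve. all: by end_near. Qed.

Definition unb (m : nat -> nat) := forall N, \forall n \near ufil, (N <= m n)%N.

Lemma unb_id : unb id.
Proof. exact: ufil_ge. Qed.

Lemma unb_unc (T : Type) (f : nat -> T) m : injective f -> unb m -> unc (f \o m).
Proof.
move=> fi mu t; case: (pselect (exists i, f i = t)) => [[i fit]|/forallNP nt].
  apply: filterS (mu i.+1) => n; rewrite -fit => + /fi E.
  by rewrite E ltnn.
by near=> n => /nt.
Unshelve. all: by end_near. Qed.

Section Loxodromic.
Context {G : groupType} {R : realType} {X : metricType R}.
Variable rho : homeo_action G X.
Hypothesis X_compact : compact [set: X].
Hypothesis ca : convergence_action rho.
Hypothesis ne : non_elementary rho.
Implicit Types (g : nat -> G) (a b x y M P : X) (h k f : G).

Local Notation d := (@mdist R X).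
Local Notation ucoll := (ucoll rho).

(** The space is infinite: if [s] listed all of it, a collapsing sequence would be constant along
    the ultrafilter on each nonrepelling point, hence would identify two of them. *)
Lemma avoid (s : seq X) : exists x, x \notin s.
Proof.
apply: contrapT => /forallNP H.
have {}H x : x \in s by apply: contrapT => /negP; exact: H.
have /card_le3P[b [_ [_ [/(limit_setP rho X_compact)[g [gu [a gab]]] _ _ _]]]] := ne.
have /card_le3P[x [y [z [_ _ _ [xy yz xz]]]]] := ca.1.
have img v : v <> a -> \forall n \near ufil, rho (g n) v = b.
  move=> va; have vb := gab _ _ (ucv_cst v) va.
  have /not_unc[t vt] : ~ unc (fun n => rho (g n) v).
    by move=> /(unc_notin s)/ufil_ex[n]; rewrite H.
  have -> // : b = t.
  by apply: (ucv_uniq vb); apply: ucv_eq (ucv_cst t); apply: filterS vt.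
have two v w : v <> w -> v <> a -> w <> a -> False.
  move=> vw /img va /img wa; have [n [vn wn]] := ufil_ex (filterI va wa).
  by apply: vw; apply: (@rho_inj _ _ rho (g n)); rewrite vn.
case: (pselect (x = a)) => [xa|xa].
  by apply: (two y z) => //; rewrite -xa; exact/nesym.
case: (pselect (y = a)) => [ya|ya]; last exact: (two x y).
by apply: (two x z) => //; rewrite -ya; exact/nesym.
Qed.

Lemma avoid2 x y : exists z, z <> x /\ z <> y.
Proof.
have [z] := avoid [:: x; y]; rewrite !inE negb_or => /andP[/eqP ? /eqP ?].
by exists z.
Qed.

Lemma avoid3 x y t : exists z, [/\ z <> x, z <> y & z <> t].
Proof.
have [z] := avoid [:: x; y; t].
by rewrite !inE !negb_or => /and3P[/eqP ? /eqP ? /eqP ?]; exists z.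
Qed.

(** Otherwise each [b] would attract only points of a finite list, and three points could be picked
    in turn outside the lists of the earlier limits, contradicting [no_triple]. *)
Lemma ucoll_frequent g : unc g ->
  exists b, forall s : seq X, exists x, x \notin s /\ ucv (fun n => rho (g n) x) b.
Proof.
move=> gu; apply: contrapT => /forallNP H.
have H' b : exists s : seq X, forall x, x \notin s -> ~ ucv (fun n => rho (g n) x) b.
  have /existsNP[s sb] := H b; exists s => x xs xb; apply: sb; by exists x.
have {H H'}[s sP] := choice H'.
have [x1 _] := avoid [::].
have [b1 xb1] := ucv_ex X_compact (fun n => rho (g n) x1).
have [x2] := avoid (x1 :: s b1).
rewrite inE negb_or => /andP[/eqP x21 x2s].
have [b2 xb2] := ucv_ex X_compact (fun n => rho (g n) x2).
have [x3] := avoid (x1 :: x2 :: s b1 ++ s b2).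
rewrite !inE !mem_cat !negb_or => /and4P[/eqP x31 /eqP x32 x3s1 x3s2].
have [b3 xb3] := ucv_ex X_compact (fun n => rho (g n) x3).
apply: (no_triple X_compact ca gu (ucv_cst x1) (ucv_cst x2) (ucv_cst x3) xb1 xb2 xb3).
- exact/nesym.
- exact/nesym.
- exact/nesym.
- by move=> E; apply: sP x2s _; rewrite E.
- by move=> E; apply: sP x3s2 _; rewrite E.
- by move=> E; apply: sP x3s1 _; rewrite E.
Qed.

(** The definition of a convergence action collapses a subsequence, whose index set may fail to
    belong to the ultrafilter; here the sequence itself collapses. The points [b] and [a] attract,
    under [g] and its inverses, points outside any finite set. A sequence violating collapse, one
    point tending to [b] and one coming from [a] then form a forbidden triple. *)
Lemma ucoll_ex g : unc g -> exists a b, ucoll g a b.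
Proof.
move=> gu; have [b bP] := ucoll_frequent gu.
have gVu : unc (fun n => (g n)^-1%g) by exact: (unc_inj (@invg_inj G) gu).
have [a aP] := ucoll_frequent gVu.
exists a, b => x l xl la.
have [y xy] := ucv_ex X_compact (fun n => rho (g n) (x n)).
case: (pselect (y = b)) => [<-//|yb]; exfalso.
have [p [/[!inE]/[!negb_or]/andP[/eqP pl /eqP pa] pb]] := bP [:: l; a].
have [q [/[!inE]/[!negb_or]/andP[/eqP qy /eqP qb] qa]] := aP [:: y; b].
apply: (no_triple X_compact ca gu xl (ucv_cst p) qa xy pb (y3 := q)) => //.
- by under eq_fun do rewrite rhoVK; exact: ucv_cst.
- exact/nesym.
- exact/nesym.
- exact/nesym.
Qed.

Lemma ucoll_uniq g a b a' b' : ucoll g a b -> ucoll g a' b' -> a = a' /\ b = b'.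
Proof.
have bb g' v w v' w' : ucoll g' v w -> ucoll g' v' w' -> w = w'.
  move=> vw vw'; have [z [zv zv']] := avoid2 v v'.
  exact: ucv_uniq (vw _ _ (ucv_cst z) zv) (vw' _ _ (ucv_cst z) zv').
move=> gab gab'; split; last exact: bb gab gab'.
by apply: bb (ucollV X_compact gab) (ucollV X_compact gab').
Qed.

Lemma fix3_not_unc g x y z : x <> y -> y <> z -> x <> z ->
  (\forall n \near ufil, rho (g n) x = x) ->
  (\forall n \near ufil, rho (g n) y = y) ->
  (\forall n \near ufil, rho (g n) z = z) -> ~ unc g.
Proof.
move=> xy yz xz gx gy gz gu.
have cst v : (\forall n \near ufil, rho (g n) v = v) -> ucv (fun n => rho (g n) v) v.
  by move=> gv; apply: ucv_eq (ucv_cst v); apply: filterS gv.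
exact: (no_triple X_compact ca gu (ucv_cst x) (ucv_cst y) (ucv_cst z)
  (cst _ gx) (cst _ gy) (cst _ gz)).
Qed.

(** North-south dynamics, with [M] repelling and [P] attracting. All exponent sequences that are
    unbounded along the ultrafilter are covered, since later exponents depend on moving data. *)
Record lox h M P : Prop := Lox {
  lox_neq : M <> P;
  lox_rep : rho h M = M;
  lox_att : rho h P = P;
  lox_coll : forall m, unb m -> ucoll (fun n => h ^+ m n)%g M P }.

Lemma rho_pow h x n : rho h x = x -> rho (h ^+ n)%g x = x.
Proof.
by move=> hx; elim: n => [|n IH]; rewrite ?expg0 ?hact1// expgS hactM IH.
Qed.

Lemma rho_inv h x : rho h x = x -> rho h^-1%g x = x.
Proof. by move=> {1}<-; rewrite rhoK. Qed.

Lemma lox_cvg h M P x m : lox h M P -> unb m -> x <> M ->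
  ucv (fun n => rho (h ^+ m n)%g x) P.
Proof. by move=> hl mu xM; exact: (lox_coll hl mu (ucv_cst x) xM). Qed.

Lemma lox_fix h M P q x : lox h M P -> (0 < q)%N -> rho (h ^+ q)%g x = x ->
  x = M \/ x = P.
Proof.
move=> hl q0 hx; case: (pselect (x = M)) => [|xM]; [by left|right].
have qu : unb (fun n => q * n)%N.
  by move=> N; apply: filterS (ufil_ge N) => n /leq_trans; apply; exact: leq_pmull.
apply: ucv_uniq (lox_cvg hl qu xM).
by under eq_fun do rewrite expgnA rho_pow//; exact: ucv_cst.
Qed.

Lemma lox_pow_inj h M P : lox h M P -> injective (fun n => h ^+ n)%g.
Proof.
move=> hl; have [z [zM zP]] := avoid2 M P.
have H q : (0 < q)%N -> (h ^+ q)%g <> 1%g.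
  move=> q0 hq; have [] // : z = M \/ z = P.
  by apply: (lox_fix hl q0); rewrite hq hact1.
move=> i j /= hij; have [ij|ji|//] := ltngtP i j.
  case: (H (j - i)%N); first by rewrite subn_gt0.
  by rewrite expgnFr ?(ltnW ij)// hij mulgV.
case: (H (i - j)%N); first by rewrite subn_gt0.
by rewrite expgnFr ?(ltnW ji)// hij mulgV.
Qed.

Lemma lox_inv h M P : lox h M P -> lox h^-1%g P M.
Proof.
move=> hl; split.
- exact/nesym/(lox_neq hl).
- exact: rho_inv (lox_att hl).
- exact: rho_inv (lox_rep hl).
- move=> m mu; under eq_fun do rewrite expVgn.
  exact/(ucollV X_compact)/(lox_coll hl).
Qed.

Lemma conj_pow f h n : ((f * h * f^-1) ^+ n = f * h ^+ n * f^-1)%g.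
Proof.
elim: n => [|n IH]; first by rewrite !expg0 mulg1 mulgV.
by rewrite !expgS IH !mulgA mulgVK.
Qed.

Lemma lox_conj f h M P : lox h M P -> lox (f * h * f^-1)%g (rho f M) (rho f P).
Proof.
move=> hl; split.
- by move=> /rho_inj; exact: lox_neq hl.
- by rewrite !hactM rhoK (lox_rep hl).
- by rewrite !hactM rhoK (lox_att hl).
- move=> m mu; under eq_fun do rewrite conj_pow.
  by have := ucollM f f^-1%g (lox_coll hl mu); rewrite invgK.
Qed.

Lemma lox_uniq h M P M' P' : lox h M P -> lox h M' P' -> M = M' /\ P = P'.
Proof.
by move=> /lox_coll/(_ _ unb_id) h1 /lox_coll/(_ _ unb_id) h2; exact: ucoll_uniq h1 h2.
Qed.

(** Nested images place all positive powers near [b] and all negative ones near [a]. The attracting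
    and repelling points of the powers are fixed by [h], which commutes with them; as [h] has no
    other fixed points and the two lie in disjoint balls, they do not depend on the exponent
    sequence. The third point [c] witnesses that no positive power is trivial. *)
Lemma ping_pong_lox h a b c (e : R) : 0 < e -> 2 * e < d a b ->
  e <= d a c -> e <= d b c ->
  (forall x, e <= d a x -> d b (rho h x) < e) ->
  exists M P, lox h M P /\ d a M <= e /\ d b P <= e.
Proof.
move=> e0 eab eac ebc hP.
have tri x : d b x < e -> e <= d a x.
  by have := metric_triangle a x b; rewrite (metric_sym x b); lra.
have hn n x : e <= d a x -> d b (rho (h ^+ n.+1)%g x) < e.
  elim: n => [|n IH] ax; first by rewrite expg1; exact: hP.
  by rewrite expgS hactM; apply/hP/tri/IH.
have hnV n x : e <= d b x -> d a (rho (h ^- n.+1)%g x) < e.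
  move=> bx; rewrite ltNge; apply/negP => H; have := hn n _ H; rewrite rhoVK; lra.
have hi q : (0 < q)%N -> (h ^+ q)%g <> 1%g.
  by case: q => // q _ hq; have := hn q _ eac; rewrite hq hact1; lra.
have hinj : injective (fun n => h ^+ n)%g.
  move=> i j /= hij; have [ij|ji|//] := ltngtP i j.
    by case: (hi (j - i)%N); rewrite ?subn_gt0// expgnFr ?(ltnW ij)// hij mulgV.
  by case: (hi (i - j)%N); rewrite ?subn_gt0// expgnFr ?(ltnW ji)// hij mulgV.
have near_coll m : unb m -> exists M P,
    [/\ ucoll (fun n => h ^+ m n)%g M P, d a M <= e, d b P <= e,
        rho h M = M & rho h P = P].
  move=> mu; have [M [P hMP]] := ucoll_ex (unb_unc hinj mu).
  have m1 := mu 1%N.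
  have dP : d b P <= e.
    have [x [xM ax]] : exists x, x <> M /\ e <= d a x.
      case: (pselect (c = M)) => [cM|cM]; last by exists c.
      exists b; split; last by lra.
      by move=> bM; move: ebc; rewrite cM bM mdistxx; lra.
    apply: (ucv_le (ucv_cst b) (hMP _ _ (ucv_cst x) xM)).
    by apply: filterS m1 => n /=; case: (m n) => // k _; apply/ltW/hn.
  have dM : d a M <= e.
    have [x [xP bx]] : exists x, x <> P /\ e <= d b x.
      case: (pselect (c = P)) => [cP|cP]; last by exists c.
      exists a; split; last by rewrite metric_sym; lra.
      by move=> aP; move: eac; rewrite cP aP mdistxx; lra.
    apply: (ucv_le (ucv_cst a) (ucollV X_compact hMP (ucv_cst x) xP)).
    by apply: filterS m1 => n /=; case: (m n) => // k _; apply/ltW/hnV.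
  exists M, P; split=> //.
    have [x [xP xP']] := avoid2 P (rho h^-1%g P).
    have hxP : rho h x <> P by move=> E; apply: xP'; rewrite -E rhoK.
    have c1 := ucollV X_compact hMP (ucv_cst x) xP.
    have c2 := ucollV X_compact hMP (ucv_cst (rho h x)) hxP.
    apply: ucv_uniq (ucv_rho rho h c1) _.
    have comm n : (h * h ^- n = h ^- n * h)%g.
      exact: commuteV (commuteX _ (commute_refl h)).
    by under eq_fun do rewrite -hactM comm hactM.
  have [x [xM xM']] := avoid2 M (rho h^-1%g M).
  have hxM : rho h x <> M by move=> E; apply: xM'; rewrite -E rhoK.
  have c1 := hMP _ _ (ucv_cst x) xM.
  have c2 := hMP _ _ (ucv_cst (rho h x)) hxM.
  apply: ucv_uniq (ucv_rho rho h c1) _.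
  by under eq_fun do rewrite -hactM -expgS expgSr hactM.
have [M [P [hMP dM dP hM hP']]] := near_coll _ unb_id.
have MP : M <> P.
  by move=> MP; have := tri P; have := metric_triangle a P b;
     rewrite -MP (metric_sym M b) in dP *; lra.
exists M, P; split=> //; split=> // m mu.
have [M' [P' [hMP' dM' dP' hM' hP'']]] := near_coll _ mu.
have fixP x : rho h x = x -> x = M \/ x = P.
  move=> hx; case: (pselect (x = M)) => [|xM]; [by left|right].
  apply: ucv_uniq (hMP _ _ (ucv_cst x) xM).
  by under eq_fun do rewrite rho_pow//; exact: ucv_cst.
have far x : d a x <= e -> d b x <= e -> False.
  by have := metric_triangle a x b; rewrite (metric_sym x b); lra.
have -> : M = M'.
  by case: (fixP _ hM') => // M'P; case: (far M') => //; rewrite M'P.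
by have -> : P = P' by case: (fixP _ hP'') => // P'M; case: (far P') => //; rewrite P'M.
Qed.

End Loxodromic.

Section Loxodromic2.
Context {G : groupType} {R : realType} {X : metricType R}.
Variable rho : homeo_action G X.
Hypothesis X_compact : compact [set: X].
Hypothesis ca : convergence_action rho.
Hypothesis ne : non_elementary rho.
Implicit Types (g : nat -> G) (a b x y M P : X) (h k f : G).

Local Notation d := (@mdist R X).
Local Notation ucoll := (ucoll rho).
Local Notation lox := (lox rho).

Lemma ucv_lt_near u (l x : X) (e : R) : ucv u l -> d x l < e ->
  \forall n \near ufil, d x (u n) < e.
Proof.
move=> /ucvP ul xl; have e0 : 0 < e - d x l by rewrite subr_gt0.
apply: filterS (ul _ e0) => n.
have := metric_triangle x l (u n); lra.
Qed.

Lemma lox_cvgV h M P x m : lox h M P -> unb m -> x <> P ->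
  ucv (fun n => rho (h ^- m n)%g x) M.
Proof.
move=> hl mu xP; have := lox_cvg (lox_inv X_compact hl) mu xP.
by under eq_fun do rewrite expVgn.
Qed.

Lemma escape_back h M P x (e : R) : lox h M P -> e < d P M -> d P x < e -> x <> P ->
  exists n, [/\ e <= d P (rho (h ^- n.+1)%g x) &
    forall i, (i <= n)%N -> d P (rho (h ^- i)%g x) < e].
Proof.
move=> hl eM xe xP.
have : exists n, e <= d P (rho (h ^- n)%g x).
  apply: contrapT => /forallNP H.
  have : d P M <= e.
    apply: (ucv_le (ucv_cst P) (lox_cvgV hl unb_id xP)).
    by near=> n; rewrite leNgt; apply/negP => /ltW; exact: H.
  by rewrite leNgt eM.
move=> /ex_minnP[[|n]]; first by rewrite expg0 invg1 hact1 leNgt xe.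
move=> en nmin; exists n; split=> // i; rewrite ltNge => ni; apply/negP => /nmin.
by rewrite ltnNge ni.
Unshelve. all: by end_near. Qed.

(** A fundamental domain for the powers of [h]: the region between the sphere of radius [e] about
    [P] and its preimage under [h]. By [escape_lim] limits of points of this region stay away from
    both ends. *)
Lemma escape h M P x (e : R) : lox h M P -> 0 < e -> e < d P M -> x <> M -> x <> P ->
  exists k, [/\ rho k M = M, rho k P = P, e <= d P (rho k x) &
     d P (rho h (rho k x)) <= e].
Proof.
move=> hl e0 eM xM xP; have [xe|ex] := ltP (d P x) e.
  have [n [en nP]] := escape_back hl eM xe xP.
  exists (h ^- n.+1)%g; split=> //.
  - exact/rho_inv/rho_pow/(lox_rep hl).
  - exact/rho_inv/rho_pow/(lox_att hl).
  - by rewrite -hactM expgSr invgM mulVKg; apply/ltW/nP.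
have : exists n, d P (rho (h ^+ n)%g x) < e.
  have /ucvP/(_ e e0) := lox_cvg hl unb_id xM.
  by move=> /ufil_ex[n]; exists n.
move=> /ex_minnP[[|n]]; first by rewrite expg0 hact1 ltNge ex.
move=> ne' nmin; exists (h ^+ n)%g; split.
- exact/rho_pow/(lox_rep hl).
- exact/rho_pow/(lox_att hl).
- by rewrite leNgt; apply/negP => /nmin; rewrite ltnn.
- by rewrite -hactM -expgS ltW.
Qed.

Lemma escape_lim h M P (e : R) (u : nat -> X) w : lox h M P -> 0 < e -> e < d P M ->
  ucv u w -> (\forall n \near ufil, e <= d P (u n)) ->
  (\forall n \near ufil, d P (rho h (u n)) <= e) -> w <> P /\ w <> M.
Proof.
move=> hl e0 eM uw uP huP; split.
  move=> wP; have := ucv_ge (ucv_cst P) uw uP.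
  by rewrite wP mdistxx leNgt e0.
move=> wM; have := ucv_le (ucv_cst P) (ucv_rho rho h uw) huP.
by rewrite wM (lox_rep hl) leNgt eM.
Qed.

(** The points [k ^+ m y] tend to [P]; negative powers of [h] bring them back to the fundamental
    region. The resulting elements fix [P], send [M'] towards [M] and [y] to a third limit, so they
    are constant along the ultrafilter. Comparing two indices shows that a power of [k] is a product
    of powers of [h], hence fixes [M]. *)
Lemma lox_share h k M M' P : lox h M P -> lox k M' P -> M = M'.
Proof.
move=> hl kl; apply: contrapT => MM'.
have PM : 0 < d P M by apply: mdist_gt0P; exact/nesym/(lox_neq hl).
pose e := d P M / 2.
have e0 : 0 < e by rewrite divr_gt0.
have eM : e < d P M by rewrite /e; lra.
have [y [yM' yP]] := avoid2 X_compact ca ne M' P.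
have ky m : rho (k ^+ m)%g y <> P.
  by move=> /(congr1 (rho (k ^+ m)^-1%g)); rewrite rhoK rho_inv//;
     exact/rho_pow/(lox_att kl).
have ex m : exists n, d P (rho (k ^+ m)%g y) < e ->
    e <= d P (rho (h ^- n.+1 * k ^+ m)%g y) /\
    forall i, (i <= n)%N -> d P (rho (h ^- i * k ^+ m)%g y) < e.
  have [xe|_] := ltP (d P (rho (k ^+ m)%g y)) e; last by exists 0%N.
  have [n [en nP]] := escape_back hl eM xe (ky m).
  by exists n => _; rewrite hactM; split=> // i /nP; rewrite hactM.
have {ex}[n nP] := choice ex.
have kyP := lox_cvg kl unb_id yM'.
have near_e : \forall m \near ufil, d P (rho (k ^+ m)%g y) < e.
  by move/ucvP : kyP; exact.
(* For each fixed [i] the points [h ^- i (k ^+ m y)] still tend to [P], so ever more steps are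
   needed to leave the ball. *)
have nu : unb (fun m => (n m).+1).
  move=> N.
  suff : \forall m \near ufil, forall i, (i < N)%N -> d P (rho (h ^- i * k ^+ m)%g y) < e.
    apply: filterS2 near_e => m me /(_ (n m).+1) H.
    rewrite leqNgt; apply/negP => /H; rewrite ltNge => /negP; apply.
    exact: (nP m me).1.
  elim: N => [|N IH]; first by near=> m.
  have kN : \forall m \near ufil, d P (rho (h ^- N * k ^+ m)%g y) < e.
    have := ucv_rho rho (h ^- N)%g kyP.
    rewrite (rho_inv (rho_pow _ (lox_att hl))) => /ucvP/(_ e e0).
    by apply: filterS => m; rewrite hactM.
  apply: filterS2 kN IH => m mN IH i; rewrite ltnS leq_eqVlt => /orP[/eqP ->//|].
  exact: IH.
pose f m := (h ^- (n m).+1 * k ^+ m)%g.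
have /not_unc[t ft] : ~ unc f.
  move=> fu; have [w fw] := ucv_ex X_compact (fun m => rho (f m) y).
  have [wP wM] : w <> P /\ w <> M.
    apply: (escape_lim hl e0 eM fw).
      by apply: filterS near_e => m me; exact: (nP m me).1.
    apply: filterS near_e => m me; apply: ltW.
    rewrite /f -hactM mulgA expgSr invgM mulVKg; exact: (nP m me).2.
  apply: (no_triple X_compact ca fu (ucv_cst P) (ucv_cst y) (ucv_cst M') _ fw _
      (y1 := P) (y3 := M)) => //.
  - under eq_fun do rewrite hactM (rho_pow _ (lox_att kl)) (rho_inv (rho_pow _ (lox_att hl))).
    exact: ucv_cst.
  - under eq_fun do rewrite hactM (rho_pow _ (lox_rep kl)).
    exact: lox_cvgV hl nu (lox_neq kl).
  - exact/nesym.
  - exact/nesym/(lox_neq kl).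
  - exact/nesym.
  - exact/nesym/(lox_neq hl).
have [i fi] := ufil_ex ft.
have [j [fj ij]] := ufil_ex (filterI ft (ufil_ge i.+1)).
have kk : (k ^+ (j - i) = h ^+ (n j).+1 * h ^- (n i).+1)%g.
  rewrite expgnFr ?(ltnW ij)//.
  have -> : (k ^+ j = h ^+ (n j).+1 * t)%g by rewrite -fj mulgA mulgV mul1g.
  by rewrite -fi -!mulgA mulgV mulg1.
have [] : M = M' \/ M = P.
  apply: (lox_fix kl (q := (j - i)%N)); first by rewrite subn_gt0.
  by rewrite kk hactM (rho_inv (rho_pow _ (lox_rep hl))) (rho_pow _ (lox_rep hl)).
- by [].
- exact: lox_neq hl.
Unshelve. all: by end_near. Qed.

(** The translates of a pair of ends accumulate only on the diagonal. Correcting [f n] by elements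
    fixing [M] and [P] brings the preimage of a third point [z] into the fundamental region; the
    corrected elements then send three points with distinct limits to three points with distinct
    limits. *)
Lemma lox_pair_discrete h M P (f : nat -> G) a b : lox h M P ->
  ucv (fun n => rho (f n) M) a -> ucv (fun n => rho (f n) P) b -> a <> b ->
  \forall n \near ufil, rho (f n) M = a /\ rho (f n) P = b.
Proof.
move=> hl fa fb ab.
have PM : 0 < d P M by apply: mdist_gt0P; exact/nesym/(lox_neq hl).
pose e := d P M / 2.
have e0 : 0 < e by rewrite divr_gt0.
have eM : e < d P M by rewrite /e; lra.
have [z [za zb]] := avoid2 X_compact ca ne a b.
have ex n : exists k, rho (f n) M <> z -> rho (f n) P <> z ->
    [/\ rho k M = M, rho k P = P, e <= d P (rho (k * (f n)^-1)%g z) &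
     d P (rho h (rho (k * (f n)^-1)%g z)) <= e].
  case: (pselect (rho (f n) M = z)) => [?|fM]; first by exists 1%g.
  case: (pselect (rho (f n) P = z)) => [?|fP]; first by exists 1%g.
  have [||k] := escape (x := rho (f n)^-1%g z) hl e0 eM.
  - by move=> E; apply: fM; rewrite -E rhoVK.
  - by move=> E; apply: fP; rewrite -E rhoVK.
  by exists k => _ _; rewrite hactM.
have {ex}[k kP] := choice ex.
have {}kP : \forall n \near ufil, [/\ rho (k n) M = M, rho (k n) P = P,
    e <= d P (rho (k n * (f n)^-1)%g z) &
     d P (rho h (rho (k n * (f n)^-1)%g z)) <= e].
  by apply: filterS2 (ucv_neq fa (nesym za)) (ucv_neq fb (nesym zb)) => n; exact: kP.
pose phi n := (f n * (k n)^-1)%g.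
have [w zw] := ucv_ex X_compact (fun n => rho (k n * (f n)^-1)%g z).
have [wP wM] : w <> P /\ w <> M.
  by apply: (escape_lim hl e0 eM zw); apply: filterS kP => n [].
have phiM : \forall n \near ufil, rho (f n) M = rho (phi n) M.
  by apply: filterS kP => n [kM _ _ _]; rewrite hactM rho_inv.
have phiP : \forall n \near ufil, rho (f n) P = rho (phi n) P.
  by apply: filterS kP => n [_ kP' _ _]; rewrite hactM rho_inv.
have pa := ucv_eq phiM fa; have pb := ucv_eq phiP fb.
have /not_unc[t pt] : ~ unc phi.
  move=> pu; apply: (no_triple X_compact ca pu (ucv_cst M) (ucv_cst P) zw pa pb (y3 := z)).
  - by under eq_fun do rewrite -hactM mulgA mulgVK mulgV hact1; exact: ucv_cst.
  - exact: lox_neq hl.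
  - exact/nesym.
  - exact/nesym.
  - exact: ab.
  - exact/nesym.
  - exact/nesym.
have -> : a = rho t M.
  by apply: ucv_uniq pa _; apply: ucv_eq (ucv_cst _); apply: filterS pt => n ->.
have -> : b = rho t P.
  by apply: ucv_uniq pb _; apply: ucv_eq (ucv_cst _); apply: filterS pt => n ->.
by apply: filterS3 phiM phiP pt => n -> -> ->.
Qed.

Lemma ucoll_lox g a b : unc g -> ucoll g a b -> a <> b ->
  exists Ms Ps : nat -> X, [/\ \forall n \near ufil, lox (g n) (Ms n) (Ps n),
    ucv Ms a & ucv Ps b].
Proof.
move=> gu gab ab.
have ex n : exists MP : X * X, (exists M P, lox (g n) M P) -> lox (g n) MP.1 MP.2.
  case: (pselect (exists M P, lox (g n) M P)) => [[M [P ?]]|?].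
    by exists (M, P).
  by exists (a, a).
have {ex}[MP MPP] := choice ex.
have [c [ca' cb]] := avoid2 X_compact ca ne a b.
have H (e : R) : 0 < e -> \forall n \near ufil,
    lox (g n) (MP n).1 (MP n).2 /\ d a (MP n).1 <= e /\ d b (MP n).2 <= e.
  move=> e0.
  have ab0 := mdist_gt0P ab; have ca0 := mdist_gt0P ca'; have cb0 := mdist_gt0P cb.
  (* The radius meets the hypotheses of [ping_pong_lox]: the balls about [a] and [b] are disjoint
     and [c] lies in neither. *)
  pose r := Num.min e (Num.min (d a b / 3) (Num.min (d c a) (d c b))).
  have r0 : 0 < r by rewrite !lt_min e0 divr_gt0//= ca0.
  have re : r <= e by rewrite ge_min lexx.
  have rab : r <= d a b / 3 by rewrite !ge_min lexx !orbT.
  have rca : r <= d c a by rewrite !ge_min lexx !orbT.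
  have rcb : r <= d c b by rewrite !ge_min lexx !orbT.
  have /(ucollP rho X_compact)/(_ r r0) := gab.
  apply: filterS => n gn.
  have [|||M [P [gMP [aM bP]]]] := ping_pong_lox X_compact ca ne (c := c) r0 _ _ _ gn.
  - lra.
  - by rewrite metric_sym.
  - by rewrite metric_sym.
  have l := MPP n (ex_intro _ M (ex_intro _ P gMP)).
  have [<- <-] := lox_uniq X_compact ca ne gMP l.
  by split=> //; split; apply: le_trans re.
exists (fun n => (MP n).1), (fun n => (MP n).2); split.
- by apply: filterS (H 1 ltr01) => n [].
- apply/ucvP => e e0; have e2 : 0 < e / 2 by rewrite divr_gt0.
  by apply: filterS (H _ e2) => n [_ [? _]]; lra.
- apply/ucvP => e e0; have e2 : 0 < e / 2 by rewrite divr_gt0.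
  by apply: filterS (H _ e2) => n [_ [_ ?]]; lra.
Qed.

(** If [a = b], composing with an element that moves [b] separates them. If no element does, [b] is
    a global fixed point, and a sequence with another attracting point [c] must have [b] as its
    repelling point. *)
Lemma ucoll_distinct_ex : exists g a b, [/\ unc g, ucoll g a b & a <> b].
Proof.
have /card_le3P[b [c [_ [/(limit_setP rho X_compact)[g [gu [a gab]]] + _ [bc _ _]]]]] := ne.
move=> /(limit_setP rho X_compact)[g' [gu' [a' gab']]].
case: (pselect (a = b)) => [E|ab]; last by exists g, a, b.
case: (pselect (exists f, rho f b <> a)) => [[f fb]|/forallNP fb].
  exists (fun n => f * g n)%g, a, (rho f b); split; last exact/nesym.
    exact: (unc_inj (@mulgI _ f) gu).
  exact: ucollMl.
have {}fb f : rho f b = a by apply: contrapT => ?; apply: (fb f).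
have ab : a = b by rewrite -(fb 1%g) hact1.
exists g', a', c; split=> // a'c.
case: (pselect (b = a')) => [ba'|ba']; first by apply: bc; rewrite ba'.
apply/bc/esym; apply: ucv_uniq (gab' _ _ (ucv_cst b) ba') _.
by apply: ucv_eq (ucv_cst b); near=> n; rewrite fb ab.
Unshelve. all: by end_near. Qed.

Lemma lox_ex : exists h M P, lox h M P.
Proof.
have [g [a [b [gu gab ab]]]] := ucoll_distinct_ex.
have [Ms [Ps [gl _ _]]] := ucoll_lox gu gab ab.
by have [n gn] := ufil_ex gl; exists (g n), (Ms n), (Ps n).
Qed.

(* A finite orbit would absorb all limit points. *)
Lemma no_orbit2 p q : p <> q ->
  ~ (forall f, (rho f p = p \/ rho f p = q) /\ (rho f q = p \/ rho f q = q)).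
Proof.
move=> pq H.
have /card_le3P[x [y [z [Lx Ly Lz [xy yz xz]]]]] := ne.
have L v : limit_set rho v -> v = p \/ v = q.
  move=> /(limit_setP rho X_compact)[g [gu [a gab]]].
  have cl u : (forall f, rho f u = p \/ rho f u = q) -> u <> a -> v = p \/ v = q.
    move=> Hu ua; have uv := gab _ _ (ucv_cst u) ua.
    have : \forall n \near ufil, rho (g n) u = p \/ rho (g n) u = q by near=> n.
    by move=> /ufil_or[] E; [left|right]; apply: (ucv_uniq uv);
       apply: ucv_eq (ucv_cst _); apply: filterS E.
  case: (pselect (p = a)) => [pa|pa]; last by apply: (cl p) => // f; case: (H f).
  by apply: (cl q) => [f|qa]; [case: (H f)|apply: pq; rewrite pa].
by case: (L _ Lx) => ?; case: (L _ Ly) => ?; case: (L _ Lz) => ?; congruence.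
Unshelve. all: by end_near. Qed.

(** Otherwise the orbit of [P] lies in the pair of ends, which gives either an invariant pair or, by
    [lox_share], two fixed ends. *)
Lemma lox_move h M P : lox h M P -> exists f, rho f P <> M /\ rho f P <> P.
Proof.
move=> hl; apply: contrapT => /forallNP H.
have {}H f : rho f P = P \/ rho f P = M.
  case: (pselect (rho f P = P)) => [|fP]; [by left|right].
  by apply: contrapT => fM; apply: (H f).
case: (no_orbit2 (nesym (lox_neq hl))).
case: (pselect (exists f, rho f P = M)) => [[f0 f0P] f|/forallNP fP f].
  split; first exact: H.
  by rewrite -f0P -hactM; have := H (f * f0)%g; rewrite f0P.
have {}H f' : rho f' P = P by case: (H f') => // E; case: (fP f').
split; first by left.
have := lox_conj f hl; rewrite H => /lox_share/(_ hl) ->; by right.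
Qed.

Lemma no_global_fix q : exists f, rho f q <> q.
Proof.
have [h [M [P hl]]] := lox_ex.
apply: contrapT => /forallNP H.
have {}H f : rho f q = q by apply: contrapT; exact: H.
have key h' M' P' : lox h' M' P' -> q <> P'.
  move=> hl' qP'; have [f [_]] := lox_move hl'.
  by rewrite -qP' H.
have [] := lox_fix hl (q := 1%N) (x := q) isT (H _).
  exact: key (lox_inv X_compact hl).
exact: key hl.
Qed.

(** The elements [f * h ^+ n] are loxodromic, with ends tending to [M] and [rho f P]. If these ends
    always met the orbits of [s], the pairs of ends would be translates of one fixed pair, so by
    discreteness they would equal their limits for some [n]; such an element would share the end [M]
    with [h], forcing [rho f P = P]. *)
Lemma lox_new (s : seq X) : (forall q, q \in s -> exists k Q, lox k Q q) ->
  exists h M P, lox h M P /\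
    forall q f, q \in s -> rho f q <> M /\ rho f q <> P.
Proof.
move=> sl; have [h [M [P hl]]] := lox_ex; have [f [fM fP]] := lox_move hl.
pose k n := (f * h ^+ n)%g.
have ku : unc k.
  apply: (unc_inj (@mulgI _ f)); apply: (unb_unc (m := id)) unb_id.
  exact: lox_pow_inj hl.
have kMP : ucoll k M (rho f P) := ucollMl f (lox_coll hl unb_id).
have [Ms [Ps [kl MsM PsP]]] := ucoll_lox ku kMP (nesym fM).
apply: contrapT => /forallNP H.
have H' : \forall n \near ufil, exists q f, q \in s /\ (rho f q = Ms n \/ rho f q = Ps n).
  apply: filterS kl => n kn; apply: contrapT => nn.
  apply: (H (k n)); exists (Ms n), (Ps n); split=> // q f' qs.
  split=> E; apply: nn; exists q, f'; split=> //; [by left|by right].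
have [q [qs {}H']] : exists q, q \in s /\
    \forall n \near ufil, exists f, rho f q = Ms n \/ rho f q = Ps n.
  elim: s {H sl} H' => [/ufil_ex[n [q [? []]]]//|q s IH] H.
  have : \forall n \near ufil, (exists f, rho f q = Ms n \/ rho f q = Ps n) \/
     exists q f, q \in s /\ (rho f q = Ms n \/ rho f q = Ps n).
    apply: filterS H => n [q' [f' []]]; rewrite inE => /orP[/eqP ->|q's] E.
      by left; exists f'.
    by right; exists q', f'.
  move=> /ufil_or[Hq|/IH[q' [q's H']]]; first by exists q; rewrite inE eqxx.
  by exists q'; rewrite inE q's orbT.
have {H'}H' : exists phi : nat -> G, (\forall n \near ufil, rho (phi n) q = Ms n) \/
    (\forall n \near ufil, rho (phi n) q = Ps n).
  have ex n : exists f, (exists f, rho f q = Ms n \/ rho f q = Ps n) ->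
      rho f q = Ms n \/ rho f q = Ps n.
    case: (pselect (exists f, rho f q = Ms n \/ rho f q = Ps n)) => [[f' ?]|?].
      by exists f'.
    by exists 1%g.
  have {ex}[phi phiP] := choice ex; exists phi; apply: ufil_or.
  by apply: filterS H' => n; exact: phiP.
have [c [Q cl]] := sl _ qs.
have [phi [phiq|phiq]] := H'.
- have phiQ : \forall n \near ufil, rho (phi n) Q = Ps n.
    apply: filterS2 phiq kl => n E kn; have := lox_conj (phi n) cl; rewrite E => l.
    exact: lox_share l (lox_inv X_compact kn).
  have cq : ucv (fun n => rho (phi n) q) M.
    by apply: ucv_eq MsM; apply: filterS phiq.
  have cQ : ucv (fun n => rho (phi n) Q) (rho f P).
    by apply: ucv_eq PsP; apply: filterS phiQ.
  have D := lox_pair_discrete cl cQ cq fM.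
  have [n [[[E1 E2] [E3 E4]] kn]] := ufil_ex (filterI (filterI D (filterI phiq phiQ)) kl).
  move: kn; rewrite -E3 E2 -E4 E1 => kn.
  by apply: fP; exact: lox_share (lox_inv X_compact kn) (lox_inv X_compact hl).
- have phiQ : \forall n \near ufil, rho (phi n) Q = Ms n.
    apply: filterS2 phiq kl => n E kn; have := lox_conj (phi n) cl; rewrite E => l.
    exact: lox_share l kn.
  have cq : ucv (fun n => rho (phi n) q) (rho f P).
    by apply: ucv_eq PsP; apply: filterS phiq.
  have cQ : ucv (fun n => rho (phi n) Q) M.
    by apply: ucv_eq MsM; apply: filterS phiQ.
  have D := lox_pair_discrete cl cQ cq (nesym fM).
  have [n [[[E1 E2] [E3 E4]] kn]] := ufil_ex (filterI (filterI D (filterI phiq phiQ)) kl).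
  move: kn; rewrite -E3 E2 -E4 E1 => kn.
  by apply: fP; exact: lox_share (lox_inv X_compact kn) (lox_inv X_compact hl).
Qed.

End Loxodromic2.

(** * Ping-pong *)

(* A letter [(c, s)] stands for the loxodromic [h_c] if [s] holds, for its inverse otherwise. *)
Definition letter := ('I_4 * bool)%type.
Definition neg (x : letter) : letter := (x.1, ~~ x.2).

Lemma negK : involutive neg.
Proof. by case=> c s; rewrite /neg /= negbK. Qed.

Lemma neg_neq x y : x.1 != y.1 -> neg x <> y.
Proof. by move=> /eqP xy E; apply: xy; rewrite -E. Qed.

Lemma neg_self x : neg x <> x.
Proof. by case: x => c [] []. Qed.

(** The index, not merely the letter, changes at every step: repetitions are absorbed in the
    exponent [N]. *)
Definition reduced (s : nat -> letter) := forall i, (s i).1 != (s i.+1).1.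

Definition sdrop (T : Type) k (s : nat -> T) := fun i => s (k + i)%N.

Lemma reduced_drop k s : reduced s -> reduced (sdrop k s).
Proof. by move=> sr i; rewrite /sdrop addnS. Qed.

Section PingPong.
Context {G : groupType} {R : realType} {X : metricType R}.
Variable rho : homeo_action G X.
Hypothesis X_compact : compact [set: X].
Hypothesis ca : convergence_action rho.
Hypothesis ne : non_elementary rho.
Implicit Types (x y : letter) (s : nat -> letter).

Local Notation d := (@mdist R X).
Local Notation ucoll := (ucoll rho).
Local Notation lox := (lox rho).

Variables (H : letter -> G) (P : letter -> X).
Hypothesis HV : forall x, H (neg x) = (H x)^-1%g.
Hypothesis H_lox : forall x, lox (H x) (P (neg x)) (P x).
Hypothesis P_inj : injective P.

Lemma small_radius : exists (r : R) z0, [/\ 0 < r,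
  forall x y, x <> y -> 2 * r < d (P x) (P y) & forall x, r < d (P x) z0].
Proof.
have [z0 z0P] := avoid X_compact ca ne [seq P x | x <- enum {: letter}].
have z0x x : P x <> z0.
  by move=> E; move: z0P; rewrite -E map_f// mem_enum.
pose m := \big[Num.min/1]_(xy : letter * letter | xy.1 != xy.2) d (P xy.1) (P xy.2).
pose m' := \big[Num.min/1]_(x : letter) d (P x) z0.
have m0 : 0 < m.
  apply: (big_ind (fun a => 0 < a)) => // [a b a0 b0|xy nxy].
    by rewrite lt_min a0.
  by apply: mdist_gt0P => /P_inj E; move: nxy; rewrite E eqxx.
have m'0 : 0 < m'.
  apply: (big_ind (fun a => 0 < a)) => // [a b a0 b0|x _].
    by rewrite lt_min a0.
  exact/mdist_gt0P/z0x.
exists (Num.min (m / 3) (m' / 3)), z0; split.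
- by rewrite lt_min !divr_gt0.
- move=> x y /eqP xy.
  have : m <= d (P x) (P y) by exact: (bigmin_le_cond _ (j := (x, y))).
  have : Num.min (m / 3) (m' / 3) <= m / 3 by rewrite ge_min lexx.
  lra.
- move=> x; have : m' <= d (P x) z0 by exact: bigmin_le_cond.
  have : Num.min (m / 3) (m' / 3) <= m' / 3 by rewrite ge_min lexx orbT.
  lra.
Qed.

Variables (r : R) (z0 : X).
Hypothesis r0 : 0 < r.
Hypothesis rP : forall x y, x <> y -> 2 * r < d (P x) (P y).
Hypothesis rz : forall x, r < d (P x) z0.

Definition nb x : set X := [set q | d (P x) q <= r].

Lemma nb_disj x y q : x <> y -> nb x q -> nb y q -> False.
Proof.
move=> /rP; rewrite /nb/=; have := metric_triangle (P x) q (P y).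
rewrite (metric_sym q); lra.
Qed.

Lemma nb_z0 x : ~ nb x z0.
Proof. by rewrite /nb/= => /le_lt_trans/(_ (rz x)); rewrite ltxx. Qed.

Lemma nb_P x y : nb x (P y) -> x = y.
Proof.
move=> xy; apply: contrapT => nxy; apply: (nb_disj nxy xy).
by rewrite /nb/= mdistxx ltW.
Qed.

Lemma nb_lim x u l : ucv u l -> (\forall n \near ufil, nb x (u n)) -> nb x l.
Proof. exact: ucv_le (ucv_cst _). Qed.

Lemma nnb_lim x u l : ucv u l -> (\forall n \near ufil, ~ nb x (u n)) -> l <> P x.
Proof.
move=> ul nu lP; have : r <= d (P x) l.
  apply: (ucv_ge (ucv_cst _) ul); apply: filterS nu => n /negP.
  by rewrite -ltNge => /ltW.
by rewrite lP mdistxx leNgt r0.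
Qed.

Lemma ufil_nb x u : ucv u (P x) -> \forall n \near ufil, nb x (u n).
Proof. by move=> /ucvP/(_ r r0); apply: filterS => n /ltW. Qed.

Lemma pow_exists : exists N0, forall N, (N0 <= N)%N -> forall x q,
  ~ nb (neg x) q -> nb x (rho (H x ^+ N)%g q).
Proof.
have ex x : exists N0, forall N, (N0 <= N)%N -> forall q,
    ~ nb (neg x) q -> nb x (rho (H x ^+ N)%g q).
  apply: contrapT => /forallNP nN.
  have {}nN n : exists Nq : nat * X, [/\ (n <= Nq.1)%N, ~ nb (neg x) Nq.2 &
      ~ nb x (rho (H x ^+ Nq.1)%g Nq.2)].
    have /existsNP[N /not_implyP[nN' /existsNP[q /not_implyP[? ?]]]] := nN n.
    by exists (N, q).
  have {nN}[Nq NqP] := choice nN.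
  have mu : unb (fun n => (Nq n).1).
    by move=> N; apply: filterS (ufil_ge N) => n /leq_trans; apply; case: (NqP n).
  have [l ql] := ucv_ex X_compact (fun n => (Nq n).2).
  have lP : l <> P (neg x) by apply: (nnb_lim ql); near=> n; case: (NqP n).
  have /ufil_nb/ufil_ex[n] := lox_coll (H_lox x) mu ql lP.
  by case: (NqP n).
have {ex}[N0 N0P] := choice ex.
exists (\max_x N0 x) => N NN x; apply: N0P; apply: leq_trans NN.
exact: leq_bigmax.
Unshelve. all: by end_near. Qed.

Variable N0 : nat.
Hypothesis N0P : forall N, (N0 <= N)%N -> forall x q,
  ~ nb (neg x) q -> nb x (rho (H x ^+ N)%g q).

Lemma powV_nb N x q : (N0 <= N)%N -> ~ nb x q -> nb (neg x) (rho (H x ^- N)%g q).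
Proof. by move=> NN nq; rewrite -expVgn -HV; apply: N0P; rewrite ?negK. Qed.

Lemma pow_lim N (q : nat -> X) x : unb N -> (\forall n \near ufil, ~ nb (neg x) (q n)) ->
  ucv (fun n => rho (H x ^+ N n)%g (q n)) (P x).
Proof.
move=> Nu nq; have [l ql] := ucv_ex X_compact q.
exact: (lox_coll (H_lox x) Nu ql (nnb_lim ql nq)).
Qed.

Section Words.
Variable N : nat.
Hypothesis NN : (N0 <= N)%N.

Fixpoint rw s k := (if k is k'.+1 then rw s k' * H (s k') ^+ N else 1)%g.

Lemma rw_add s i k : rw s (i + k) = (rw s i * rw (sdrop i s) k)%g.
Proof. by elim: k => [|k IH]; rewrite ?addn0 ?mulg1// addnS /= IH -mulgA. Qed.

Lemma rw_S s k : rw s k.+1 = (H (s 0%N) ^+ N * rw (sdrop 1 s) k)%g.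
Proof. by rewrite -add1n rw_add /= mul1g. Qed.

Lemma rw_eq s s' k : (forall i, (i < k)%N -> s i = s' i) -> rw s k = rw s' k.
Proof.
elim: k => //= k IH ss; rewrite IH ?ss// => i ik; apply: ss; exact: ltnW.
Qed.

Lemma rw_nb s k q : reduced s -> ~ nb (neg (s k)) q -> nb (s 0%N) (rho (rw s k.+1) q).
Proof.
move=> sr; elim: k q => [|k IH] q nq; first by rewrite /= mul1g; exact: N0P.
rewrite /= hactM; apply: IH => nq'.
by apply: nb_disj nq' (N0P NN nq); exact: neg_neq.
Qed.

Lemma rwV_nb s k q : reduced s -> ~ nb (s 0%N) q -> nb (neg (s k)) (rho (rw s k.+1)^-1%g q).
Proof.
move=> sr nq; elim: k => [|k IH]; first by rewrite /= mul1g; exact: powV_nb.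
rewrite -/(rw s k.+1 * _)%g invgM hactM; apply: powV_nb => // nq'.
by apply: nb_disj IH nq'; exact: neg_neq.
Qed.

Lemma rw_neq1 s k : reduced s -> rw s k.+1 <> 1%g.
Proof.
move=> sr E; have := rw_nb sr (@nb_z0 (neg (s k))).
by rewrite E hact1; exact: nb_z0.
Qed.

(** The first letter of a nonempty word is read off from the ball containing the image of [z0], so
    it can be cancelled. *)
Lemma rw_inj_len s s' k k' : reduced s -> reduced s' -> rw s k = rw s' k' -> k = k'.
Proof.
elim: k s s' k' => [|k IH] s s' [|k'] sr sr' //.
- by move=> E; case: (@rw_neq1 s' k').
- by move=> /rw_neq1; case.
move=> E; have E0 : s 0%N = s' 0%N.
  apply: contrapT => n0; apply: nb_disj n0 _ (rw_nb sr' (@nb_z0 (neg (s' k')))).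
  by rewrite -E; apply: rw_nb => //; exact: nb_z0.
congr S; apply: (IH (sdrop 1 s) (sdrop 1 s')); [exact: reduced_drop..|].
by move: E; rewrite !rw_S E0 => /mulgI.
Qed.

End Words.

(** Words of unbounded length leave every finite set, by [rw_inj_len], hence collapse. Their
    repelling point lies in the ball of the inverse of the last letter, disjoint from the ball of
    the next letter, where the points [u n] are. *)
Lemma words_shrink N (s : nat -> nat -> letter) (k : nat -> nat) :
  (N0 <= N)%N -> (forall n, reduced (s n)) -> unb k ->
  exists b, forall u : nat -> X, (\forall n \near ufil, nb (s n (k n)) (u n)) ->
    ucv (fun n => rho (rw N (s n) (k n)) (u n)) b.
Proof.
move=> NN sr ku; pose g n := rw N (s n) (k n).
have gu : unc g.
  move=> t; apply: contrapT => /ufil_not gt.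
  have [n /contrapT gn] := ufil_ex gt.
  have [n' [/contrapT gn' kn']] := ufil_ex (filterI gt (ku (k n).+1)).
  have := rw_inj_len NN (sr n) (sr n') (etrans gn (esym gn')).
  by move=> E; move: kn'; rewrite E ltnn.
have [a [b gab]] := ucoll_ex X_compact ca ne gu.
have [x0 sx0] := ufil_fin (fun n => s n 0%N).
have [x sx] := ufil_fin (fun n => s n (k n).-1).
have [y sy] := ufil_fin (fun n => s n (k n)).
have xy : x.1 != y.1.
  have [n [[sxn syn] kn]] := ufil_ex (filterI (filterI sx sy) (ku 1%N)).
  by rewrite -sxn -syn; have := sr n (k n).-1; rewrite prednK.
have back q : ~ nb x0 q -> \forall n \near ufil, nb (neg x) (rho (g n)^-1%g q).
  move=> nq; apply: filterS3 sx0 sx (ku 1%N) => n s0 sk kn.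
  rewrite -sk -s0 in nq *; rewrite /g -{2}(prednK kn).
  exact: rwV_nb.
have ax : nb (neg x) a.
  have [q [nq qb]] : exists q, ~ nb x0 q /\ q <> b.
    case: (pselect (z0 = b)) => [E|]; last by exists z0; split=> //; exact: nb_z0.
    exists (P (neg x0)); split; first by move=> /nb_P/esym/neg_self.
    by move=> E'; apply: (@nb_z0 (neg x0)); rewrite E -E' /nb /= mdistxx ltW.
  exact: nb_lim (ucollV X_compact gab (ucv_cst q) qb) (back q nq).
exists b => u uy; have [l ul] := ucv_ex X_compact u.
have yl : nb y l by apply: (nb_lim ul); apply: filterS2 uy sy => n + <-.
apply: gab ul _ => la; apply: nb_disj ax _; first exact: neg_neq xy.
by rewrite -la.
Qed.

Section Endpoint.
Variable N : nat.
Hypothesis NN : (N0 <= N)%N.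

Local Notation rw := (rw N).

(** The ray determined by [s] is located by its itinerary: read from position [k], its end lies in
    the ball of the letter [s k]. The end is an ultralimit of attracting points along the ray. *)
Lemma endpoint_ex s : reduced s -> exists e, forall k, nb (s k) (rho (rw s k)^-1%g e).
Proof.
move=> sr; have [e qe] := ucv_ex X_compact (fun k => rho (rw s k) (P (s k))).
exists e => k; apply: (nb_lim (ucv_rho rho (rw s k)^-1%g qe)).
apply: filterS (ufil_ge k) => n kn; rewrite -hactM -(subnKC kn) rw_add mulKg.
have -> : s (k + (n - k))%N = sdrop k s (n - k) by [].
have -> : s k = sdrop k s 0%N by rewrite /sdrop addn0.
move: (sdrop k s) (reduced_drop k sr) (n - k)%N => t tr [|i].
  by rewrite /= hact1 /nb /= mdistxx ltW.
apply: rw_nb => // /nb_P/neg_neq; exact.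
Qed.

Definition endpoint s : X :=
  if pselect (exists e, forall k, nb (s k) (rho (rw s k)^-1%g e)) is left E
  then sval (cid E) else z0.

Lemma endpointP s k : reduced s -> nb (s k) (rho (rw s k)^-1%g (endpoint s)).
Proof.
move=> /endpoint_ex E; rewrite /endpoint; case: pselect => // E'.
by case: cid => e eP; exact: eP.
Qed.

Lemma endpoint_uniq s e : reduced s -> (forall k, nb (s k) (rho (rw s k)^-1%g e)) ->
  e = endpoint s.
Proof.
move=> sr es; have [b bP] := words_shrink NN (fun=> sr) unb_id.
have key e' : (forall k, nb (s k) (rho (rw s k)^-1%g e')) -> e' = b.
  move=> e's.
  have : ucv (fun k => rho (rw s k) (rho (rw s k)^-1%g e')) b.
    by apply: bP; near=> k; exact: e's.
  by under eq_fun do rewrite rhoVK; move=> /(ucv_uniq (ucv_cst e')).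
by rewrite (key e es) (key (endpoint s))// => k; exact: endpointP.
Unshelve. all: by end_near. Qed.

Lemma endpoint_drop s k : reduced s -> endpoint s = rho (rw s k) (endpoint (sdrop k s)).
Proof.
move=> sr; apply/esym/endpoint_uniq => // i.
have [ki|ik] := leqP k i.
  rewrite -(subnKC ki) rw_add invgM hactM rhoK.
  exact: (endpointP (i - k) (reduced_drop k sr)).
rewrite -(subnKC (ltnW ik)) rw_add hactM rhoK.
have -> : s i = sdrop i s 0%N by rewrite /sdrop addn0.
have -> : sdrop (i + (k - i)) s = sdrop (k - i) (sdrop i s).
  by apply/funext => j; rewrite /sdrop addnA.
move: ik; rewrite -subn_gt0; case: (k - i)%N => // j _.
have tr := reduced_drop i sr.
apply: rw_nb => // nq; have := endpointP 0 (reduced_drop j.+1 tr).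
rewrite /= invg1 hact1 /sdrop addn0 => nq'.
by apply: nb_disj nq nq'; rewrite /sdrop; apply: neg_neq; have := tr j; rewrite /sdrop.
Qed.

Lemma endpoint_nb s : reduced s -> nb (s 0%N) (endpoint s).
Proof. by move=> /(endpointP 0); rewrite /= invg1 hact1. Qed.

Lemma endpoint_eq s s' : s =1 s' -> endpoint s = endpoint s'.
Proof. by move=> /funext ->. Qed.

Lemma endpoint_cvg (s : nat -> nat -> letter) t (k : nat -> nat) :
  (forall n, reduced (s n)) -> reduced t -> unb k ->
  (\forall n \near ufil, forall i, (i <= k n)%N -> s n i = t i) ->
  ucv (fun n => endpoint (s n)) (endpoint t).
Proof.
move=> sr tr ku st; have [b bP] := words_shrink NN (fun=> tr) ku.
have tb : ucv (fun n => rho (rw t (k n)) (rho (rw t (k n))^-1%g (endpoint t))) b.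
  by apply: bP; near=> n; exact: endpointP.
move: tb; under eq_fun do rewrite rhoVK; move=> /(ucv_uniq (ucv_cst _)) ->.
have : ucv (fun n => rho (rw t (k n)) (rho (rw t (k n))^-1%g (endpoint (s n)))) b.
  apply: bP; apply: filterS st => n st; rewrite -(st _ (leqnn _)).
  rewrite (@rw_eq _ _ (s n)); first exact: endpointP.
  by move=> i ik; rewrite st// ltnW.
by under eq_fun do rewrite rhoVK.
Unshelve. all: by end_near. Qed.

End Endpoint.

End PingPong.

Lemma ex_min_prop (Q : nat -> Prop) : (exists n, Q n) ->
  exists n, Q n /\ forall m, Q m -> (n <= m)%N.
Proof.
move=> [n Qn]; have /ex_minnP[m /asboolP Qm mmin] : exists n, `[< Q n >].
  by exists n; exact/asboolP.
by exists m; split=> // k /asboolP; exact: mmin.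
Qed.

(** * Alignment of rays with equivalent ends *)

Section Align.
Context {G : groupType} {R : realType} {X : metricType R}.
Variable rho : homeo_action G X.
Hypothesis X_compact : compact [set: X].
Hypothesis ca : convergence_action rho.
Hypothesis ne : non_elementary rho.
Implicit Types (x y : letter) (s t : nat -> letter).

Local Notation d := (@mdist R X).
Local Notation ucoll := (ucoll rho).
Local Notation lox := (lox rho).

Variables (H : letter -> G) (P : letter -> X).
Hypothesis HV : forall x, H (neg x) = (H x)^-1%g.
Hypothesis H_lox : forall x, lox (H x) (P (neg x)) (P x).
Hypothesis P_inj : injective P.
Variables (r : R) (z0 : X).
Hypothesis r0 : 0 < r.
Hypothesis rP : forall x y, x <> y -> 2 * r < d (P x) (P y).
Hypothesis rz : forall x, r < d (P x) z0.
Local Notation nb := (nb P r).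
Variable N0 : nat.
Hypothesis N0P : forall N, (N0 <= N)%N -> forall x q,
  ~ nb (neg x) q -> nb x (rho (H x ^+ N)%g q).
Local Notation rw := (rw H).
Local Notation endpoint := (endpoint rho H P r z0).
Local Notation nb_disj := (nb_disj rP).
Local Notation nb_z0 := (nb_z0 rz).
Local Notation nb_P := (nb_P r0 rP).
Local Notation powV_nb := (powV_nb HV N0P).
Local Notation rwV_nb := (rwV_nb HV rP N0P).
Local Notation endpoint_uniq := (endpoint_uniq X_compact ca ne HV r0 rP rz N0P).
Local Notation endpoint_drop := (endpoint_drop X_compact ca ne HV r0 rP rz N0P).
Local Notation endpoint_nb := (endpoint_nb X_compact z0 r0 rP N0P).

(** Once a point has left the itinerary of [t] it never rejoins it: from then on it is seen behind,
    in the ball of the inverse of the last letter read. *)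
Lemma exit_nb N t j i q : (N0 <= N)%N -> reduced t -> (j <= i)%N ->
  ~ nb (t j) (rho (rw N t j)^-1%g q) -> ~ nb (t i) (rho (rw N t i)^-1%g q).
Proof.
move=> NN tr ji nj; rewrite -(subnKC ji); elim: (i - j)%N => [|l IH].
  by rewrite addn0.
rewrite addnS /= invgM hactM => n1.
by apply: nb_disj (powV_nb NN IH) n1; exact: neg_neq.
Qed.

Lemma exit_nb_neg N t j q : (N0 <= N)%N ->
  ~ nb (t j) (rho (rw N t j)^-1%g q) -> nb (neg (t j)) (rho (rw N t j.+1)^-1%g q).
Proof. by move=> NN nj; rewrite /= invgM hactM; exact: powV_nb. Qed.

(** The point [xi] serves as a past for both rays, being off both itineraries. The base point,
    transported to position [k.+1] of the ray [s], tends to the common end, so for large [k] it is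
    not yet behind position [j0.+1] of [t]. The first later position that has it behind locates it
    within one syllable of [t]. *)
Lemma search N s t g : (N0 <= N)%N -> reduced s -> reduced t ->
  rho g (endpoint N s) = endpoint N t -> exists k0, forall k, (k0 <= k)%N ->
  exists j xi, [/\ ~ nb (s k) (rho (rw N s k)^-1%g xi),
    ~ nb (t j) (rho (rw N t j)^-1%g (rho g xi)),
    ~ nb (neg (t j)) (rho ((rw N t j.+1)^-1 * g * rw N s k.+1)%g z0) &
    nb (neg (t j.+1)) (rho ((rw N t j.+2)^-1 * g * rw N s k.+1)%g z0)].
Proof.
move=> NN sr tr ge; pose xi := P (neg (s 0%N)).
have xi_s k : ~ nb (s k) (rho (rw N s k)^-1%g xi).
  have xi0 : ~ nb (s 0%N) xi by move=> /nb_P/esym/neg_self.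
  by apply: (exit_nb NN sr (leq0n k)); rewrite /= invg1 hact1.
have leave q : q <> endpoint N t -> exists j, ~ nb (t j) (rho (rw N t j)^-1%g q).
  move=> qe; apply: contrapT => /forallNP nj; apply: qe.
  by apply: (endpoint_uniq NN tr) => j; exact: contrapT.
have [j0 j0P] : exists j, ~ nb (t j) (rho (rw N t j)^-1%g (rho g xi)).
  apply: leave; rewrite -ge => /rho_inj E.
  have := endpoint_nb NN sr; rewrite -E => /nb_P/esym; exact: neg_self.
pose y k j := rho ((rw N t j.+1)^-1 * g * rw N s k.+1)%g z0.
have [k0 k0P] : exists k0, forall k, (k0 <= k)%N -> ~ nb (neg (t j0)) (y k j0).
  apply: contrapT => /forallNP nk.
  have {}nk n : exists k, (n <= k)%N /\ nb (neg (t j0)) (y k j0).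
    have /existsNP[k /not_implyP[nk' /contrapT ?]] := nk n; by exists k.
  have {nk}[k kP] := choice nk.
  have ku : unb k.
    by move=> n; apply: filterS (ufil_ge n) => i /leq_trans; apply; case: (kP i).
  have [b bP] := words_shrink X_compact ca ne HV r0 rP rz N0P NN (fun=> sr) ku.
  have eb : ucv (fun n => endpoint N s) b.
    have : ucv (fun n => rho (rw N s (k n)) (rho (rw N s (k n))^-1%g (endpoint N s))) b.
      by apply: bP; near=> n; exact: (endpointP X_compact z0 r0 rP N0P NN).
    by under eq_fun do rewrite rhoVK.
  rewrite -(ucv_uniq (ucv_cst _) eb) in bP.
  have zb : ucv (fun n => rho (rw N s (k n)) (rho (H (s (k n)) ^+ N)%g z0)) (endpoint N s).
    by apply: bP; near=> n; apply: (N0P NN); exact: nb_z0.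
  have := nb_lim (ucv_rho rho ((rw N t j0.+1)^-1 * g)%g zb).
  move=> /(_ P r (neg (t j0))); rewrite hactM ge => C.
  have : nb (neg (t j0)) (rho (rw N t j0.+1)^-1%g (endpoint N t)).
    by apply: C; near=> n; rewrite -!hactM -!mulgA !mulgA; have [_] := kP n; rewrite /y /= !mulgA.
  move=> n1; apply: nb_disj n1 (endpointP X_compact z0 r0 rP N0P NN j0.+1 tr).
  exact: neg_neq.
exists k0 => k kk.
have [j1 j1P] : exists j, ~ nb (t j) (rho (rw N t j)^-1%g (rho (g * rw N s k.+1)%g z0)).
  apply: leave; rewrite -ge hactM => /rho_inj E.
  apply: (@nb_z0 (s k.+1)).
  have := endpointP X_compact z0 r0 rP N0P NN k.+1 sr.
  by rewrite -E rhoK.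
have : exists i, nb (neg (t (j0 + i)%N)) (y k (j0 + i)%N).
  exists j1; have := exit_nb NN tr (leq_addl j0 j1) j1P.
  by move=> /(exit_nb_neg NN); rewrite -hactM mulgA.
move=> /ex_min_prop[[|i]].
  by rewrite addn0 => -[nj _]; case: (k0P k kk).
move=> [nj imin]; exists (j0 + i)%N, xi; split=> //.
- exact: (exit_nb NN tr (leq_addr i j0)).
- by move=> /imin; rewrite ltnn.
- by move: nj; rewrite addnS.
Unshelve. all: by end_near. Qed.

(** All the data of a counterexample in one record, so that a single choice yields the sequences. *)
Record align_data := AlignData { dN : nat; ds : nat -> letter; dt : nat -> letter;
  dg : G; dk : nat; dj : nat; dxi : X }.

(** The change of position [kappa] matches the ends surrounding position [k.+1] of [s], backward end
    of the previous letter and forward end of the next one, with those at position [j.+1] of [t]. *)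
Definition aligned N s t g k j :=
  let kappa := ((rw N t j.+1)^-1 * g * rw N s k.+1)%g in
  rho kappa (P (neg (s k))) = P (neg (t j)) /\ rho kappa (P (s k.+1)) = P (t j.+1).

Hypothesis P_orbit : forall f x y, rho f (P x) = P y -> x.1 = y.1.

(* As the exponent [N] tends to infinity, the two lines seen from well chosen
   points converge to pairs of ends of loxodromics, and the group element relating them stays
   bounded, hence is eventually constant along the ultrafilter and preserves these ends. *)
Lemma align_exists : exists N1, (N0 <= N1)%N /\ forall N s t g, (N1 <= N)%N ->
  reduced s -> reduced t -> rho g (endpoint N s) = endpoint N t ->
  exists k0, forall k, (k0 <= k)%N -> exists j, aligned N s t g k j.
Proof.
apply: contrapT => /forallNP nN.
have ex n : exists D : align_data,
  [/\ (n <= dN D)%N /\ (N0 <= dN D)%N, reduced (ds D) /\ reduced (dt D),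
    rho (dg D) (endpoint (dN D) (ds D)) = endpoint (dN D) (dt D),
    (forall j, ~ aligned (dN D) (ds D) (dt D) (dg D) (dk D) j) &
    [/\ ~ nb (ds D (dk D)) (rho (rw (dN D) (ds D) (dk D))^-1%g (dxi D)),
    ~ nb (dt D (dj D)) (rho (rw (dN D) (dt D) (dj D))^-1%g (rho (dg D) (dxi D))),
    ~ nb (neg (dt D (dj D)))
      (rho ((rw (dN D) (dt D) (dj D).+1)^-1 * dg D * rw (dN D) (ds D) (dk D).+1)%g z0) &
    nb (neg (dt D (dj D).+1))
      (rho ((rw (dN D) (dt D) (dj D).+2)^-1 * dg D * rw (dN D) (ds D) (dk D).+1)%g z0)]].
  have /not_andP[H'|] := nN (maxn n N0).
    by exfalso; apply: H'; rewrite leq_maxr.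
  move=> /existsNP[N /existsNP[s /existsNP[t /existsNP[g]]]].
  move=> /not_implyP[]; rewrite geq_max => /andP[nN' NN] /not_implyP[sr].
  move=> /not_implyP[tr] /not_implyP[ge] /forallNP nk.
  have [k0 k0P] := search NN sr tr ge.
  have /existsNP[k /not_implyP[kk /forallNP nj]] := nk k0.
  have [j [xi F]] := k0P k kk.
  by exists (AlignData N s t g k j xi).
have {nN ex}[D DP] := choice ex.
pose N n := dN (D n).
have Nu : unb N.
  move=> m; apply: filterS (ufil_ge m) => n mn.
  by apply: leq_trans mn _; case: (DP n) => -[].
have NN n : (N0 <= N n)%N by case: (DP n) => -[].
pose s n := ds (D n); pose t n := dt (D n); pose g n := dg (D n).
pose k n := dk (D n); pose j n := dj (D n); pose xi n := dxi (D n).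
have sr n : reduced (s n) by case: (DP n) => _ [].
have tr n : reduced (t n) by case: (DP n) => _ [].
have ge n : rho (g n) (endpoint (N n) (s n)) = endpoint (N n) (t n) by case: (DP n).
have bad n i : ~ aligned (N n) (s n) (t n) (g n) (k n) i by case: (DP n).
have F1 n : ~ nb (s n (k n)) (rho (rw (N n) (s n) (k n))^-1%g (xi n)).
  by case: (DP n) => _ _ _ _ [].
have F2 n : ~ nb (t n (j n)) (rho (rw (N n) (t n) (j n))^-1%g (rho (g n) (xi n))).
  by case: (DP n) => _ _ _ _ [].
pose T n := ((rw (N n) (t n) (j n).+1)^-1 * g n * rw (N n) (s n) (k n).+1)%g.
pose y n := rho (T n) z0.
have F3 n : ~ nb (neg (t n (j n))) (y n) by case: (DP n) => _ _ _ _ [].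
have F4 n : nb (neg (t n (j n).+1)) (rho (H (t n (j n).+1) ^- N n)%g (y n)).
  have : nb (neg (t n (j n).+1))
    (rho ((rw (N n) (t n) (j n).+2)^-1 * g n * rw (N n) (s n) (k n).+1)%g z0).
    by case: (DP n) => _ _ _ _ [].
  have -> : rw (N n) (t n) (j n).+2 = (rw (N n) (t n) (j n).+1 * H (t n (j n).+1) ^+ N n)%g.
    by [].
  by rewrite invgM /y /T !hactM.
have [a aP] := ufil_fin (fun n => s n (k n)).
have [c cP] := ufil_fin (fun n => s n (k n).+1).
have [a' a'P] := ufil_fin (fun n => t n (j n)).
have [c' c'P] := ufil_fin (fun n => t n (j n).+1).
have [b' b'P] := ufil_fin (fun n => t n (j n).+2).
have ac : a.1 != c.1.
  by have [n [an cn]] := ufil_ex (filterI aP cP); rewrite -an -cn; exact: sr.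
have ac' : a'.1 != c'.1.
  by have [n [an cn]] := ufil_ex (filterI a'P c'P); rewrite -an -cn; exact: tr.
have cb' : c'.1 != b'.1.
  by have [n [an cn]] := ufil_ex (filterI c'P b'P); rewrite -an -cn; exact: tr.
have Pneq x y' : x <> y' -> P x <> P y' by move=> xy /P_inj.
have exm n : exists m, (m <= N n)%N /\
    nb (neg (t n (j n).+1)) (rho (H (t n (j n).+1) ^- m)%g (y n)) /\
    forall i, nb (neg (t n (j n).+1)) (rho (H (t n (j n).+1) ^- i)%g (y n)) -> (m <= i)%N.
  have [|m [nm mmin]] := @ex_min_prop
    (fun i => nb (neg (t n (j n).+1)) (rho (H (t n (j n).+1) ^- i)%g (y n))).
    by exists (N n).
  by exists m; split; [exact: mmin|split].
have {exm}[m mP] := choice exm.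
(* The last exponent before the transported base point falls behind, or 0 if it starts there. After
   [q n] steps along the axis of [c'], its limit is not the attracting end, nor the repelling end
   when [q] is unbounded. *)
pose q n := (m n).-1.
have qN n : (q n <= N n)%N by apply: leq_trans (leq_pred _) _; case: (mP n).
pose w n := rho (H c' ^- q n)%g (y n).
pose Phi n := (H c' ^- q n * T n)%g.
have [wl wlP] := ucv_ex X_compact w.
(* The past [um] and the future [up] of the ray [s], seen from position [k.+1], tend to ends of
   loxodromics because each is a high power applied to a point off the repelling ball; [vm] and [vp]
   do the same for [t]. *)
pose um n := rho (rw (N n) (s n) (k n).+1)^-1%g (xi n).
have umP : ucv um (P (neg a)).
  pose um0 n := rho (rw (N n) (s n) (k n))^-1%g (xi n).
  have : ucv (fun n => rho (H (neg a) ^+ N n)%g (um0 n)) (P (neg a)).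
    apply: (pow_lim X_compact H_lox r0 Nu).
    by apply: filterS aP => n <-; rewrite negK; exact: F1.
  apply: ucv_eq; apply: filterS aP => n an.
  by rewrite /um /um0 /= invgM hactM HV expVgn -an.
pose up n := endpoint (N n) (sdrop (k n).+1 (s n)).
have far_next x (v : X) t' : reduced t' -> nb (t' 1%N) v -> t' 0%N = x -> ~ nb (neg x) v.
  by move=> tr' nv tx nv'; apply: nb_disj nv' nv; rewrite -tx; exact: neg_neq.
have upP : ucv up (P c).
  have : ucv (fun n => rho (H c ^+ N n)%g (endpoint (N n) (sdrop (k n).+2 (s n)))) (P c).
    apply: (pow_lim X_compact H_lox r0 Nu).
    apply: filterS cP => n cn.
    apply: (@far_next _ _ (sdrop (k n).+1 (s n))).
    - exact: reduced_drop.
    - have -> : sdrop (k n).+1 (s n) 1 = sdrop (k n).+2 (s n) 0.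
        by rewrite /sdrop addn1 addn0.
      exact/(endpoint_nb (NN n))/reduced_drop.
    - by rewrite /sdrop addn0.
  apply: ucv_eq; apply: filterS cP => n cn.
  rewrite /up (endpoint_drop (NN n) 1 (reduced_drop (k n).+1 (sr n))) /= mul1g /sdrop addn0 cn.
  by congr (rho _ _); apply: endpoint_eq => i; rewrite addSn addnS.
pose vm n := rho (T n) (um n).
have vmP : ucv vm (P (neg a')).
  pose vm0 n := rho (rw (N n) (t n) (j n))^-1%g (rho (g n) (xi n)).
  have : ucv (fun n => rho (H (neg a') ^+ N n)%g (vm0 n)) (P (neg a')).
    apply: (pow_lim X_compact H_lox r0 Nu).
    by apply: filterS a'P => n <-; rewrite negK; exact: F2.
  apply: ucv_eq; apply: filterS a'P => n an.
  by rewrite /vm /vm0 /um /T -!hactM mulgK /= invgM HV expVgn -an.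
pose vp n := endpoint (N n) (sdrop (j n).+2 (t n)).
have vpP : ucv vp (P b').
  have : ucv (fun n => rho (H b' ^+ N n)%g (endpoint (N n) (sdrop (j n).+3 (t n)))) (P b').
    apply: (pow_lim X_compact H_lox r0 Nu).
    apply: filterS b'P => n cn.
    apply: (@far_next _ _ (sdrop (j n).+2 (t n))).
    - exact: reduced_drop.
    - have -> : sdrop (j n).+2 (t n) 1 = sdrop (j n).+3 (t n) 0.
        by rewrite /sdrop addn1 addn0.
      exact/(endpoint_nb (NN n))/reduced_drop.
    - by rewrite /sdrop addn0.
  apply: ucv_eq; apply: filterS b'P => n cn.
  rewrite /vp (endpoint_drop (NN n) 1 (reduced_drop (j n).+2 (tr n))) /= mul1g /sdrop addn0 cn.
  by congr (rho _ _); apply: endpoint_eq => i; rewrite addSn addnS.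
have TupE n : rho (T n) (up n) = rho (H (t n (j n).+1) ^+ N n)%g (vp n).
  have rw1 M t' : rw M t' 1 = (H (t' 0%N) ^+ M)%g by rewrite /= mul1g.
  have E1 : rho (g n) (rho (rw (N n) (s n) (k n).+1) (up n)) = endpoint (N n) (t n).
    by rewrite -ge (endpoint_drop (NN n) (k n).+1 (sr n)).
  have E2 : endpoint (N n) (t n) = rho (rw (N n) (t n) (j n).+1)
      (rho (H (t n (j n).+1) ^+ N n)%g (vp n)).
    rewrite (endpoint_drop (NN n) (j n).+1 (tr n)).
    rewrite (endpoint_drop (NN n) 1 (reduced_drop (j n).+1 (tr n))) rw1.
    have -> : sdrop (j n).+1 (t n) 0%N = t n (j n).+1 by rewrite /sdrop addn0.
    congr (rho _ (rho _ _)); apply: endpoint_eq => i.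
    by rewrite /sdrop addSn addnS.
  by rewrite /T 2!hactM E1 E2 rhoK.
(* [Phi] sends three points with distinct limits to three points with distinct limits. *)
have PhiC (aN aP' : X) : ucv (fun n => rho (Phi n) (um n)) aN ->
    ucv (fun n => rho (Phi n) (up n)) aP' -> aN <> aP' -> aP' <> wl -> aN <> wl ->
    exists phi, [/\ \forall n \near ufil, Phi n = phi, rho phi (P (neg a)) = aN &
      rho phi (P c) = aP'].
  move=> cN cP' n1 n2 n3.
  have zP x : z0 <> P x by move=> E; apply: (@nb_z0 x); rewrite E /nb /= mdistxx ltW.
  have /not_unc[phi Pphi] : ~ unc Phi.
    move=> Pu; apply: (no_triple X_compact ca Pu umP upP (ucv_cst z0) cN cP' _
       (y3 := wl)) => //.
    - apply: ucv_eq wlP; by near=> n; rewrite /w /y -hactM.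
    - by apply: Pneq; exact: neg_neq.
    - exact/nesym/zP.
    - exact/nesym/zP.
  exists phi; split=> //.
    apply: ucv_uniq (ucv_rho rho phi umP) _.
    by apply: ucv_eq cN; apply: filterS Pphi => n ->.
  apply: ucv_uniq (ucv_rho rho phi upP) _.
  by apply: ucv_eq cP'; apply: filterS Pphi => n ->.
have H_att x i : rho (H x ^+ i)%g (P x) = P x by exact: rho_pow (lox_att (H_lox x)).
have H_rep x i : rho (H x ^+ i)%g (P (neg x)) = P (neg x).
  by exact: rho_pow (lox_rep (H_lox x)).
have nbP x : nb x (P x) by rewrite /nb /= mdistxx ltW.
have wpos n : (0 < m n)%N -> t n (j n).+1 = c' ->
    ~ nb (neg c') (w n) /\ nb (neg c') (rho (H c')^-1%g (w n)).
  move=> m0 tc; have [_ [nm mmin]] := mP n; rewrite tc in nm mmin; split.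
    by move=> /mmin; rewrite /q; case: (m n) m0 => // i _; rewrite ltnn.
  by rewrite /w -hactM -invgM -expgSr /q prednK.
have w_att : wl <> P c'.
  have [mz|mz] := ufil_dec (fun n => (m n = 0)%N).
    have : nb (neg c') wl.
      apply: (nb_lim wlP); apply: filterS2 mz c'P => n m0 tc.
      have [_ [nm _]] := mP n; move: nm; rewrite tc m0 /w /q m0; exact.
    by move=> + E; rewrite E => /nb_P/neg_self.
  have : nb (neg c') (rho (H c')^-1%g wl).
    apply: (nb_lim (ucv_rho rho _ wlP)); apply: filterS2 mz c'P => n m0 tc.
    by apply: (wpos n _ tc).2; rewrite lt0n; apply/eqP.
  by move=> + E; rewrite E (rho_inv (lox_att (H_lox c'))) => /nb_P/neg_self.
have bounded_minus i : (\forall n \near ufil, q n = i) ->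
    ucv (fun n => rho (Phi n) (um n)) (rho (H c' ^- i)%g (P (neg a'))).
  move=> qi; apply: ucv_eq (ucv_rho rho _ vmP).
  by apply: filterS qi => n <-; rewrite /Phi hactM.
have unb_minus : unb q -> ucv (fun n => rho (Phi n) (um n)) (P (neg c')).
  move=> qu; have := lox_coll (lox_inv X_compact (H_lox c')) qu vmP.
  move=> /(_ (Pneq _ _ (neg_neq ac'))).
  by under eq_fun do rewrite expVgn /vm -hactM.
have plusE : \forall n \near ufil,
    rho (Phi n) (up n) = rho (H c' ^+ (N n - q n))%g (vp n).
  apply: filterS c'P => n tc.
  rewrite /Phi hactM TupE tc -hactM; congr (rho _ _).
  by rewrite -{1}(subnKC (qN n)) expgnDr mulKg.
have bounded_plus i : (\forall n \near ufil, (N n - q n)%N = i) ->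
    ucv (fun n => rho (Phi n) (up n)) (rho (H c' ^+ i)%g (P b')).
  move=> qi; apply: ucv_eq (ucv_rho rho _ vpP).
  by apply: filterS2 plusE qi => n -> ->.
have unb_plus : unb (fun n => N n - q n)%N -> ucv (fun n => rho (Phi n) (up n)) (P c').
  move=> qu; have := lox_coll (H_lox c') qu vpP.
  move=> /(_ (Pneq _ _ (fun E => neg_neq cb' (esym E)))).
  by apply: ucv_eq; apply: filterS plusE => n ->.
(* The base point projects near the beginning of the syllable of [t], near its end, or far from
   both. The first two cases align position [k] with [j] and with [j.+1]. *)
have [[i qi]|qu] := ufil_nat q.
  have Nqu : unb (fun n => N n - q n)%N.
    move=> M; apply: filterS2 qi (Nu (i + M)%N) => n -> ?.
    by rewrite leq_subRL// (leq_trans (leq_addr M i)).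
  have wy : wl <> rho (H c' ^- i)%g (P (neg a')).
    move=> E; have := nnb_lim r0 (ucv_rho rho (H c' ^+ i)%g wlP) (x := neg a').
    rewrite E rhoVK; apply => //.
    by apply: filterS2 qi a'P => n <- <-; rewrite /w rhoVK.
  have [|||phi [Pphi pN pP]] := PhiC _ _ (bounded_minus i qi) (unb_plus Nqu).
  - rewrite -(rho_inv (H_att c' i)) => /rho_inj; by apply: Pneq; exact: neg_neq.
  - exact/nesym.
  - exact/nesym.
  have [n [[En qn] [[an cn] [a'n c'n]]]] := ufil_ex (filterI (filterI Pphi qi)
    (filterI (filterI aP cP) (filterI a'P c'P))).
  apply: (bad n (j n)); rewrite /aligned an cn a'n c'n -/(T n).
  have -> : T n = (H c' ^+ i * phi)%g by rewrite -En /Phi qn mulVKg.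
  by rewrite !hactM pN pP rhoVK H_att.
have m1 := qu 1%N.
have w_rep : wl <> P (neg c').
  apply: (nnb_lim r0 wlP); apply: filterS2 m1 c'P => n qn tc.
  by apply: (wpos n _ tc).1; move: qn; rewrite /q; case: (m n).
have [[i qi]|Nqu] := ufil_nat (fun n => N n - q n)%N.
  have wy : wl <> rho (H c' ^+ i)%g (P b').
    have : nb (neg c') (rho (H c' ^- i)%g wl).
      apply: (nb_lim (ucv_rho rho _ wlP)); apply: filterS2 qi c'P => n <- tc.
      rewrite /w -hactM -invgM -expgnDr subnKC//; have := F4 n; rewrite tc; exact.
    move=> + E; rewrite E rhoK => /nb_P; exact: neg_neq.
  have [|||phi [Pphi pN pP]] := PhiC _ _ (unb_minus qu) (bounded_plus i qi).
  - rewrite -(H_rep c' i) => /rho_inj; by apply: Pneq; exact: neg_neq.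
  - exact/nesym.
  - exact/nesym.
  have [n [[En qn] [[an cn] [b'n c'n]]]] := ufil_ex (filterI (filterI Pphi qi)
    (filterI (filterI aP cP) (filterI b'P c'P))).
  apply: (bad n (j n).+1); rewrite /aligned an cn b'n c'n.
  have -> : ((rw (N n) (t n) (j n).+2)^-1 * g n * rw (N n) (s n) (k n).+1 =
      H c' ^- i * phi)%g.
    have -> : rw (N n) (t n) (j n).+2 = (rw (N n) (t n) (j n).+1 * H c' ^+ N n)%g.
      by rewrite -c'n.
    transitivity (H c' ^- N n * T n)%g; first by rewrite invgM /T !mulgA.
    rewrite -En /Phi [RHS]mulgA; congr (_ * _)%g.
    by rewrite -qn -invgM -expgnDr subnKC.
  by rewrite !hactM pN pP rhoK (rho_inv (H_rep c' i)).
have [|||phi [Pphi pN pP]] := PhiC _ _ (unb_minus qu) (unb_plus Nqu).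
- by apply: Pneq; exact: neg_self.
- exact/nesym.
- exact/nesym.
(* Far from both, [phi] would carry the ends of [neg a] and [c] to the two ends of the one axis
   [c'], so consecutive letters of [s] would have the same index. *)
by move: ac; rewrite (P_orbit pN : a.1 = _) (P_orbit pP) eqxx.
Unshelve. all: by end_near. Qed.

End Align.

(** * Commutation with high powers and equality of tails *)

Section Commute.
Context {G : groupType} {R : realType} {X : metricType R}.
Variable rho : homeo_action G X.
Hypothesis X_compact : compact [set: X].
Hypothesis ca : convergence_action rho.
Hypothesis ne : non_elementary rho.
Local Notation lox := (lox rho).

Lemma lox_fix_rep h (M P : X) k : lox h M P -> rho k P = P -> rho k M = M.
Proof.
by move=> hl kP; have := lox_conj k hl; rewrite kP => /(lox_share X_compact ca ne)/(_ hl).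
Qed.

Lemma fix3_eq (x y z : X) (g : nat -> G) : x <> y -> y <> z -> x <> z ->
  (forall n, rho (g n) x = x) -> (forall n, rho (g n) y = y) ->
  (forall n, rho (g n) z = z) -> exists t, \forall n \near ufil, g n = t.
Proof.
move=> xy yz xz gx gy gz; apply: not_unc.
by apply: (fix3_not_unc X_compact ca xy yz xz); near=> n.
Unshelve. all: by end_near. Qed.

(** Fixing three points, [k] has finite order. If its conjugates by powers of [h] were unbounded
    they would collapse with distinct repelling and attracting points, as they fix both ends of [h],
    so some conjugate would be loxodromic. Hence two conjugates coincide. *)
Lemma commute_pow h (M P Q : X) k : lox h M P -> Q <> M -> Q <> P ->
  rho k P = P -> rho k Q = Q -> exists2 m, (0 < m)%N & (k * h ^+ m = h ^+ m * k)%g.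
Proof.
move=> hl QM QP kP kQ; have kM := lox_fix_rep hl kP.
have kfin : exists2 q, (0 < q)%N & (k ^+ q = 1)%g.
  have [t kt] := @fix3_eq M P Q (fun n => k ^+ n)%g (lox_neq hl) (nesym QP) (nesym QM)
    (fun n => rho_pow n kM) (fun n => rho_pow n kP) (fun n => rho_pow n kQ).
  have [i ki] := ufil_ex kt; have [j [kj ij]] := ufil_ex (filterI kt (ufil_ge i.+1)).
  exists (j - i)%N; first by rewrite subn_gt0.
  by rewrite expgnFr ?(ltnW ij)// kj ki mulgV.
pose f n := (h ^+ n * k * h ^- n)%g.
have fM n : rho (f n) M = M.
  by rewrite /f !hactM (rho_inv (rho_pow n (lox_rep hl))) kM (rho_pow n (lox_rep hl)).
have fP n : rho (f n) P = P.
  by rewrite /f !hactM (rho_inv (rho_pow n (lox_att hl))) kP (rho_pow n (lox_att hl)).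
have /not_unc[t ft] : ~ unc f.
  move=> fu; have [a [b fab]] := ucoll_ex X_compact ca ne fu.
  have cst v : (forall n, rho (f n) v = v) -> v <> a -> v = b.
    move=> fv va; apply: ucv_uniq (ucv_cst v) _.
    by have := fab _ _ (ucv_cst v) va; under eq_fun do rewrite fv.
  have ab : a <> b.
    case: (pselect (M = a)) => [Ma|/(cst _ fM) Mb] E; last first.
      have Pa : P <> a by rewrite E -Mb; exact/nesym/(lox_neq hl).
      by apply: (lox_neq hl); rewrite Mb (cst _ fP Pa).
    have Pa : P <> a by rewrite -Ma; exact/nesym/(lox_neq hl).
    by apply: (Pa); rewrite (cst _ fP Pa) E.
  have [Ms [Ps [fl _ _]]] := ucoll_lox X_compact ca ne fu fab ab.
  have [n fn] := ufil_ex fl; have [q q0 kq] := kfin.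
  have fq : (f n ^+ q = 1)%g by rewrite conj_pow kq mulg1 mulgV.
  have := lox_pow_inj X_compact ca ne fn (x1 := q) (x2 := 0%N).
  by rewrite fq expg0 => /(_ erefl) E; move: q0; rewrite E.
have [i fi] := ufil_ex ft; have [j [fj ij]] := ufil_ex (filterI ft (ufil_ge i.+1)).
exists (j - i)%N; first by rewrite subn_gt0.
rewrite expgnFr ?(ltnW ij)//.
have E : (h ^+ i * k * h ^- i = h ^+ j * k * h ^- j)%g by rewrite -/(f i) fi -fj.
have comm : (h ^+ j * h ^- i = h ^- i * h ^+ j)%g.
  by apply: commuteV; exact: (commuteX2 _ _ (commute_refl h)).
apply: (mulgI (h ^+ i)%g); apply: (mulIg (h ^- j)%g).
by rewrite comm !mulgA mulgK mulgV mul1g.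
Qed.

(** One exponent serves all [k]: counterexamples to the exponents [n]![all fix three points, hence
    are constant along the ultrafilter, while the exponent
    that]commute_pow[gives for this constant divides]n[!] for large [n]. *)
Lemma commute_exponent h (M P Q : X) : lox h M P -> Q <> M -> Q <> P ->
  exists2 m, (0 < m)%N & forall k, rho k P = P -> rho k Q = Q ->
    forall N, (m %| N)%N -> (k * h ^+ N = h ^+ N * k)%g.
Proof.
move=> hl QM QP; apply: contrapT => nm.
have ex n : exists k, [/\ rho k P = P, rho k Q = Q & (k * h ^+ n`! <> h ^+ n`! * k)%g].
  apply: contrapT => /forallNP nk; apply: nm; exists n`!; first exact: fact_gt0.
  move=> k kP kQ N /dvdnP[q ->].
  have : commute k (h ^+ n`!)%g by apply: contrapT => nc; apply: (nk k).
  by move=> /(commuteX q); rewrite -expgnA mulnC.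
have {ex}[k kP] := choice ex.
have kM n : rho (k n) M = M by case: (kP n) => kP' _ _; exact: lox_fix_rep hl kP'.
have [t kt] := @fix3_eq M P Q k (lox_neq hl) (nesym QP) (nesym QM) kM
  (fun n => let: And3 H _ _ := kP n in H) (fun n => let: And3 _ H _ := kP n in H).
have [i ki] := ufil_ex kt.
have tP : rho t P = P by rewrite -ki; case: (kP i).
have tQ : rho t Q = Q by rewrite -ki; case: (kP i).
have [m m0 tm] := commute_pow hl QM QP tP tQ.
have [n [kn mn]] := ufil_ex (filterI kt (ufil_ge m)).
have [_ _] := kP n; rewrite kn; apply.
have /dvdnP[q ->] : (m %| n`!)%N by rewrite dvdn_fact// m0.
by have : commute t (h ^+ m)%g by []; move=> /(commuteX q); rewrite -expgnA mulnC.
Qed.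

End Commute.

Section Tail.
Context {G : groupType} {R : realType} {X : metricType R}.
Variable rho : homeo_action G X.
Hypothesis X_compact : compact [set: X].
Hypothesis ca : convergence_action rho.
Hypothesis ne : non_elementary rho.
Implicit Types (x y : letter) (s t : nat -> letter).

Local Notation d := (@mdist R X).
Local Notation lox := (lox rho).

Variables (H : letter -> G) (P : letter -> X).
Hypothesis HV : forall x, H (neg x) = (H x)^-1%g.
Hypothesis H_lox : forall x, lox (H x) (P (neg x)) (P x).
Hypothesis P_inj : injective P.
Variables (r : R) (z0 : X).
Hypothesis r0 : 0 < r.
Hypothesis rP : forall x y, x <> y -> 2 * r < d (P x) (P y).
Hypothesis rz : forall x, r < d (P x) z0.
Local Notation nb := (nb P r).
Variable N0 : nat.
Hypothesis N0P : forall N, (N0 <= N)%N -> forall x q,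
  ~ nb (neg x) q -> nb x (rho (H x ^+ N)%g q).
Hypothesis P_orbit : forall f x y, rho f (P x) = P y -> x.1 = y.1.

Lemma commute_all : exists2 m, (0 < m)%N & forall k x y, x.1 != y.1 ->
  rho k (P x) = P x -> rho k (P y) = P y ->
  forall N, (m %| N)%N -> (k * H x ^+ N = H x ^+ N * k)%g.
Proof.
have ex (xy : letter * letter) : exists m, (0 < m)%N /\ (xy.1.1 != xy.2.1 ->
  forall k, rho k (P xy.1) = P xy.1 -> rho k (P xy.2) = P xy.2 ->
  forall N, (m %| N)%N -> (k * H xy.1 ^+ N = H xy.1 ^+ N * k)%g).
  case: xy => x y /=; case: (boolP (x.1 != y.1)) => [xy|_]; last by exists 1%N.
  have [||m m0 mP] := commute_exponent X_compact ca ne (H_lox x) (Q := P y).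
  - by move=> /P_inj/esym; exact: neg_neq.
  - by move=> /P_inj E; move: xy; rewrite E eqxx.
  by exists m; split=> // _ k kx ky; exact: mP.
have {ex}[m mP] := choice ex.
exists (\prod_(xy : letter * letter) m xy)%N.
  by rewrite prodn_gt0// => xy; case: (mP xy).
move=> k x y xy kx ky N mN; apply: (mP (x, y)).2 => //=.
by apply: dvdn_trans mN; rewrite (bigD1 (x, y))//= dvdn_mulr.
Qed.

Variable N : nat.
Hypothesis NN : (N0 <= N)%N.
Hypothesis N_align : forall s t g, reduced s -> reduced t ->
  rho g (endpoint rho H P r z0 N s) = endpoint rho H P r z0 N t ->
  exists k0, forall k, (k0 <= k)%N -> exists j, aligned rho H P N s t g k j.
Hypothesis N_comm : forall k x y, x.1 != y.1 ->
  rho k (P x) = P x -> rho k (P y) = P y -> (k * H x ^+ N = H x ^+ N * k)%g.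

Local Notation rw := (rw H N).
Local Notation endpoint := (endpoint rho H P r z0 N).
Local Notation nb_P := (nb_P r0 rP).

(** By ping-pong the image lies in the ball of the first letter, whose sign is opposite to that of
    the inverse of the last one. *)
Lemma rw_no_fix t n : reduced t -> (t 0%N).2 = (t n.+1).2 ->
  rho (rw t n.+2) (P (neg (t n.+1))) <> P (neg (t n.+1)).
Proof.
move=> tr tn; rewrite -/(rw t n.+1 * _)%g hactM.
rewrite (rho_pow _ (lox_rep (H_lox _))) => E.
have : nb (t 0%N) (P (neg (t n.+1))).
  rewrite -E; apply: (rw_nb rP N0P NN tr) => /nb_P E'.
  by have := tr n; rewrite -[(t n).1]/((neg (t n)).1) E' eqxx.
by move=> /nb_P E'; move: tn; rewrite E' /=; case: (t n.+1).2.
Qed.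

(** Alignment gives one position of [t] for each late position of [s]. As [kappa] commutes with the
    powers used, advancing both positions by one keeps it; any other match for the next position
    would give a nonempty subword of [t] fixing an end, against [rw_no_fix]. The constant sign [b]
    upgrades equal indices to equal letters. *)
Lemma tail_eq s t g b : reduced s -> reduced t ->
  (forall i, (s i).2 = b) -> (forall i, (t i).2 = b) ->
  rho g (endpoint s) = endpoint t -> exists k j kappa, forall i,
  [/\ (g * rw s (k + i) = rw t (j + i) * kappa)%g, s (k + i)%N = t (j + i)%N,
    rho kappa (P (s (k + i)%N)) = P (s (k + i)%N) &
    rho kappa (P (neg (s (k + i)%N))) = P (neg (s (k + i)%N))].
Proof.
move=> sr tr sb tb ge; have [k0 k0P] := N_align sr tr ge.
have same i j f : rho f (P (s i)) = P (t j) -> s i = t j.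
  by move=> /P_orbit E; apply: injective_projections; rewrite ?sb ?tb.
have sameV i j f : rho f (P (neg (s i))) = P (neg (t j)) -> s i = t j.
  by move=> /P_orbit E; apply: injective_projections; rewrite ?sb ?tb.
pose kap k j := ((rw t j.+1)^-1 * g * rw s k.+1)%g.
have al k : (k0 <= k)%N -> exists j, [/\ s k = t j, s k.+1 = t j.+1,
    rho (kap k j) (P (neg (s k))) = P (neg (s k)) &
    rho (kap k j) (P (s k.+1)) = P (s k.+1)].
  move=> /k0P[j [k1 k2]]; exists j; have E1 := sameV _ _ _ k1; have E2 := same _ _ _ k2.
  by move: k1 k2; rewrite -/(kap k j) -E1 -E2.
have step k j j' : s k = t j -> s k.+1 = t j.+1 ->
    rho (kap k j) (P (neg (s k))) = P (neg (s k)) ->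
    rho (kap k j) (P (s k.+1)) = P (s k.+1) ->
    s k.+1 = t j' ->
    rho (kap k.+1 j') (P (neg (s k.+1))) = P (neg (s k.+1)) ->
    j' = j.+1 /\ kap k.+1 j' = kap k j.
  move=> e1 e2 f1 f2 e1' f1'.
  have comm : (kap k j * H (s k.+1) ^+ N = H (s k.+1) ^+ N * kap k j)%g.
    by apply: (@N_comm _ _ (neg (s k))) => //=; rewrite eq_sym; exact: sr.
  have kapE : kap k.+1 j.+1 = kap k j.
    have -> : kap k.+1 j.+1 = (H (t j.+1) ^- N * (kap k j * H (s k.+1) ^+ N))%g.
      have rE u i : rw u i.+1 = (rw u i * H (u i) ^+ N)%g by [].
      by rewrite /kap (rE t j.+1) (rE s k.+1) invgM !mulgA.
    by rewrite comm -e2 mulKg.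
  have f2' : rho (kap k j) (P (neg (s k.+1))) = P (neg (s k.+1)).
    exact: lox_fix_rep (H_lox _) f2.
  have VE : kap k.+1 j' = ((rw t j'.+1)^-1 * rw t j.+2 * kap k j)%g.
    rewrite -kapE /kap; move: (rw t j'.+1) (rw t j.+2) (rw s k.+2) => A B C.
    by rewrite !mulgA mulgK.
  have Vfix : rho ((rw t j'.+1)^-1 * rw t j.+2)%g (P (neg (s k.+1))) = P (neg (s k.+1)).
    by move: f1'; rewrite VE hactM f2'.
  have [jj|jj|->] := ltngtP j' j.+1; last by [].
    exfalso; move: Vfix.
    have -> : (j.+2 = j'.+1 + (j - j').+1)%N by lia.
    rewrite rw_add mulKg.
    case E : (j - j')%N => [|n].
      have jE : j = j' by lia.
      by move=> _; have := tr j; rewrite -e2 e1' -jE eqxx.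
    have tE : s k.+1 = sdrop j'.+1 t n.+1.
      by rewrite e2 /sdrop; congr t; lia.
    rewrite tE; apply: rw_no_fix; first exact: reduced_drop.
    by rewrite /sdrop !tb.
  exfalso; have := rho_inv Vfix; rewrite invgM invgK.
  have -> : (j'.+1 = j.+2 + (j' - j.+1))%N by lia.
  rewrite rw_add mulKg; case E : (j' - j.+1)%N => [|n]; first by lia.
  case: n E => [|n] E.
    have jE : j' = j.+2 by lia.
    by have := tr j.+1; rewrite -e2 e1' jE eqxx.
  have tE : s k.+1 = sdrop j.+2 t n.+1 by rewrite e1' /sdrop; congr t; lia.
  rewrite tE; apply: rw_no_fix; first exact: reduced_drop.
  by rewrite /sdrop !tb.
have [j0 [a1 a2 a3 a4]] := al k0 (leqnn _).
have all i : [/\ s (k0 + i)%N = t (j0 + i)%N, s (k0 + i).+1 = t (j0 + i).+1,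
    rho (kap k0 j0) (P (neg (s (k0 + i)%N))) = P (neg (s (k0 + i)%N)),
    rho (kap k0 j0) (P (s (k0 + i).+1)) = P (s (k0 + i).+1) &
    kap (k0 + i)%N (j0 + i)%N = kap k0 j0].
  elim: i => [|i [b1 b2 b3 b4 b5]]; first by rewrite !addn0.
  have [j' [c1 c2 c3 c4]] := al (k0 + i).+1%N (leqW (leq_addr _ _)).
  rewrite -b5 in b3 b4.
  have [jE kE] := step _ _ _ b1 b2 b3 b4 c1 c3.
  rewrite !addnS; rewrite jE in c1 c2 c3 c4 kE; rewrite kE b5 in c3 c4.
  by split=> //; rewrite kE b5.
exists k0.+1, j0.+1, (kap k0 j0) => i; rewrite !addSn.
have [b1 b2 b3 b4 b5] := all i; have [c1 c2 c3 c4 c5] := all i.+1.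
rewrite !addnS in c3; split=> //.
by rewrite -b5 /kap !mulgA mulgV mul1g.
Qed.

End Tail.

(** * Coded lines *)

(** A diagonal argument: [k n] is the largest index, at most [n], up to which [Q n] holds. In the
    proof it is written [n - m] with [m] least. *)
Lemma unb_agree (Q : nat -> nat -> Prop) : (forall i, \forall n \near ufil, Q n i) ->
  exists k : nat -> nat, unb k /\ \forall n \near ufil, forall i, (i <= k n)%N -> Q n i.
Proof.
move=> HQ.
have all M : \forall n \near ufil, forall i, (i <= M)%N -> Q n i.
  elim: M => [|M IH].
    by apply: filterS (HQ 0%N) => n ? i; rewrite leqn0 => /eqP ->.
  apply: filterS2 (HQ M.+1) IH => n ? IH i.
  by rewrite leq_eqVlt => /orP[/eqP ->//|/IH].
have ex n : exists k, (k <= n)%N /\ ((exists j, (j <= n)%N /\ forall i, (i <= j)%N -> Q n i) ->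
    (forall i, (i <= k)%N -> Q n i) /\
    forall j, (j <= n)%N -> (forall i, (i <= j)%N -> Q n i) -> (j <= k)%N).
  case: (pselect (exists j, (j <= n)%N /\ forall i, (i <= j)%N -> Q n i)) => [E|nE]; last first.
    by exists 0%N; split=> // /nE.
  have /ex_min_prop[m [[mn Qm] mmin]] : exists m, (m <= n)%N /\
      forall i, (i <= n - m)%N -> Q n i.
    by case: E => j [jn Qj]; exists (n - j)%N; rewrite leq_subr subKn.
  exists (n - m)%N; rewrite leq_subr; split=> // _; split=> // j jn Qj.
  have := mmin (n - j)%N; rewrite leq_subr subKn// => /(_ (conj isT Qj)); lia.
have {ex}[k kP] := choice ex; exists k; split.
  move=> M; apply: filterS2 (all M) (ufil_ge M) => n QM Mn.
  by apply: (proj2 ((kP n).2 _)) => //; exists M.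
apply: filterS (all 0%N) => n Q0; apply: (proj1 ((kP n).2 _)).
by exists 0%N.
Qed.

Definition bits := nat -> bool.

Definition scons (c : bool) (v : bits) : bits := fun i => if i is i'.+1 then v i' else c.

Lemma sconsK v : scons (v 0%N) (sdrop 1 v) = v.
Proof. by apply/funext => -[]. Qed.

Lemma sdrop_scons c v : sdrop 1 (scons c v) = v.
Proof. by apply/funext. Qed.

Definition recurrent (v : bits) := forall k c, exists i, (k <= i)%N /\ v i = c.

(* The bit [c] is coded by the three letters [0, 1, 2 + c]; reading the code
   backwards with inverse letters gives the lines pointing in the opposite direction.
   Using [h_1] between [h_0] and [h_2], [h_3] makes the code non reversible. *)
Definition pos (m : nat) (c : bool) : 'I_4 :=
  if m is 0 then @Ordinal 4 0 isT else if m is 1 then @Ordinal 4 1 isT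
  else if c then @Ordinal 4 3 isT else @Ordinal 4 2 isT.

Definition code (b : bool) (v : bits) (i : nat) : letter :=
  (pos (if b then i %% 3 else 2 - i %% 3)%N (v (i %/ 3)%N), b).

Lemma code3 b v q m : (m < 3)%N ->
  code b v (3 * q + m)%N = (pos (if b then m else 2 - m)%N (v q), b).
Proof.
by move=> m3; rewrite /code mulnC modnMDl divnMDl// modn_small// divn_small// addn0.
Qed.

Lemma code_reduced b v : reduced (code b v).
Proof.
move=> i; rewrite (divn_eq i 3) mulnC; have := ltn_pmod i (isT : (0 < 3)%N).
case: (i %% 3)%N => [|[|[|//]]] _.
- by rewrite -addnS !code3//; case: b => //=; case: (v _).
- by rewrite -addnS !code3//; case: b => //=; case: (v _).
- have -> : (3 * (i %/ 3) + 2).+1 = (3 * (i %/ 3).+1 + 0)%N by lia.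
  by rewrite !code3//; case: b => //=; case: (v _).
Qed.

Lemma code_drop b v k : sdrop (3 * k)%N (code b v) = code b (sdrop k v).
Proof.
apply/funext => i; rewrite /sdrop /code mulnC modnMDl divnMDl//.
Qed.

Section Code.
Context {G : groupType} {R : realType} {X : metricType R}.
Variable rho : homeo_action G X.
Hypothesis X_compact : compact [set: X].
Hypothesis ca : convergence_action rho.
Hypothesis ne : non_elementary rho.
Implicit Types (x y : letter) (s t : nat -> letter) (u v : bits).

Local Notation d := (@mdist R X).
Local Notation lox := (lox rho).

Variables (H : letter -> G) (P : letter -> X).
Hypothesis HV : forall x, H (neg x) = (H x)^-1%g.
Hypothesis H_lox : forall x, lox (H x) (P (neg x)) (P x).
Hypothesis P_inj : injective P.
Variables (r : R) (z0 : X).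
Hypothesis r0 : 0 < r.
Hypothesis rP : forall x y, x <> y -> 2 * r < d (P x) (P y).
Hypothesis rz : forall x, r < d (P x) z0.
Local Notation nb := (nb P r).
Variable N0 : nat.
Hypothesis N0P : forall N, (N0 <= N)%N -> forall x q,
  ~ nb (neg x) q -> nb x (rho (H x ^+ N)%g q).
Hypothesis P_orbit : forall f x y, rho f (P x) = P y -> x.1 = y.1.
Variable N : nat.
Hypothesis NN : (N0 <= N)%N.
Hypothesis N_align : forall s t g, reduced s -> reduced t ->
  rho g (endpoint rho H P r z0 N s) = endpoint rho H P r z0 N t ->
  exists k0, forall k, (k0 <= k)%N -> exists j, aligned rho H P N s t g k j.
Hypothesis N_comm : forall k x y, x.1 != y.1 ->
  rho k (P x) = P x -> rho k (P y) = P y -> (k * H x ^+ N = H x ^+ N * k)%g.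

Local Notation rw := (rw H N).
Local Notation endpoint := (endpoint rho H P r z0 N).
Local Notation shrink := (words_shrink X_compact ca ne HV r0 rP rz N0P NN).

Definition E b v := endpoint (code b v).
Definition W b v k := rw (code b v) (3 * k).
Definition sl (c : bool) : G := rw (code true (fun=> c)) 3.
Definition fixall (k : G) := forall x, rho k (P x) = P x.

Lemma W_add b v k i : W b v (k + i) = (W b v k * W b (sdrop k v) i)%g.
Proof. by rewrite /W mulnDr rw_add code_drop. Qed.

Lemma W_true1 v : W true v 1 = sl (v 0%N). Proof. by []. Qed.

Lemma W_false1 v : W false v 1 = (sl (v 0%N))^-1%g.
Proof.
have HVN x : (H (neg x) ^+ N = H x ^- N)%g by rewrite HV expVgn.
rewrite /W /sl /= !mul1g !invgM -!HVN mulgA.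
by congr (H _ ^+ _ * H _ ^+ _ * H _ ^+ _)%g.
Qed.

Lemma W_S b v k : W b v k.+1 = (W b v 1 * W b (sdrop 1 v) k)%g.
Proof. exact: W_add 1 k. Qed.

Lemma E_drop b v k : E b v = rho (W b v k) (E b (sdrop k v)).
Proof.
by rewrite /E (endpoint_drop X_compact ca ne HV r0 rP rz N0P NN (3 * k) (@code_reduced b v))
    code_drop.
Qed.

Lemma E_true c v : E true (scons c v) = rho (sl c) (E true v).
Proof. by rewrite (E_drop _ _ 1) W_true1 sdrop_scons. Qed.

Lemma E_false c v : E false (scons c v) = rho (sl c)^-1%g (E false v).
Proof. by rewrite (E_drop _ _ 1) W_false1 sdrop_scons. Qed.

Lemma E_z0 b v : E b v <> z0.
Proof.
move=> E0; have := endpoint_nb X_compact z0 r0 rP N0P NN (@code_reduced b v).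
rewrite -/(E b v) E0; exact: (nb_z0 rz).
Qed.

(** Alignment would match the consecutive indices 0, 1 of a positive code with consecutive indices
    of a negative one, where 0 is followed by 2 or 3. *)
Lemma E_mixed g u v : rho g (E true v) <> E false u.
Proof.
move=> /(N_align (@code_reduced _ _) (@code_reduced _ _))[k0 kP].
have kk : (k0 <= 3 * k0 + 0)%N by lia.
have [j] := kP _ kk.
rewrite /aligned -addnS !code3// => -[/P_orbit + /P_orbit].
rewrite (divn_eq j 3) mulnC; have := ltn_pmod j (isT : (0 < 3)%N).
case: (j %% 3)%N => [|[|[|//]]] _.
- by rewrite -addnS !code3//=; case: (u _).
- by rewrite -addnS !code3.
- have -> : (3 * (j %/ 3) + 2).+1 = (3 * (j %/ 3).+1 + 0)%N by lia.
  by rewrite !code3//=; case: (u _).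
Qed.

Lemma E_neq u v : E true v <> E false u.
Proof. by have := @E_mixed 1%g u v; rewrite hact1. Qed.

Lemma E_tail b g v v' : recurrent v -> rho g (E b v) = E b v' ->
  exists k j kappa, [/\ (g * W b v k = W b v' j * kappa)%g,
    sdrop k v = sdrop j v' & fixall kappa].
Proof.
move=> rv gE.
have [k [j [kap kP]]] := tail_eq X_compact ca ne H_lox r0 rP N0P P_orbit NN N_align N_comm
  (@code_reduced b v) (@code_reduced b v') (fun=> erefl) (fun=> erefl) gE.
have posE m c : (val (pos m c) == 0)%N = (m == 0)%N by case: m => [|[|m]] //=; case: c.
pose z := if b then 0%N else 2.
(* The index 0 occurs exactly once in each block of three letters, at residue [z], and so
   synchronizes the two codes. *)
have kj : (k = j %[mod 3])%N.
  have H1 i : ((k + i) %% 3 == z)%N = ((j + i) %% 3 == z)%N.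
    have [_ /(congr1 fst)/(congr1 val) + _ _] := kP i; rewrite /code /=.
    move=> /(congr1 (fun m => m == 0)%N); rewrite !posE /z.
    have := ltn_pmod (k + i) (isT : (0 < 3)%N); have := ltn_pmod (j + i) (isT : (0 < 3)%N).
    by case: (b) => //; rewrite !subn_eq0; lia.
  have := H1 0%N; have := H1 1%N; have := H1 2; rewrite /z.
  by case: (b); lia.
(* Shifting both positions by [2 * k] makes them multiples of 3, that is, boundaries between
   bits. *)
pose i0 := (2 * k)%N.
pose k' := k; pose j' := ((j + i0) %/ 3)%N.
have ki0 : (k + i0 = 3 * k')%N by rewrite /i0 /k'; lia.
have ji0 : (j + i0 = 3 * j')%N by rewrite /j' /i0; lia.
have fa : fixall kap.
  have fx i m : (m < 3)%N -> rho kap (P (pos (if b then m else 2 - m)%N (v (k' + i)%N), b)) =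
      P (pos (if b then m else 2 - m)%N (v (k' + i)%N), b) /\
      rho kap (P (neg (pos (if b then m else 2 - m)%N (v (k' + i)%N), b))) =
      P (neg (pos (if b then m else 2 - m)%N (v (k' + i)%N), b)).
    move=> m3; have [_ _ + +] := kP (i0 + 3 * i + m)%N.
    have -> : (k + (i0 + 3 * i + m) = 3 * (k' + i) + m)%N by rewrite /k'; lia.
    by rewrite code3.
  have fl (c : 'I_4) : rho kap (P (c, b)) = P (c, b) /\ rho kap (P (c, ~~ b)) = P (c, ~~ b).
    have [i0' [ki vi]] := rv k' false; have [i1' [ki1 vi1]] := rv k' true.
    have e0 : (k' + (i0' - k') = i0')%N by rewrite subnKC.
    have e1 : (k' + (i1' - k') = i1')%N by rewrite subnKC.
    have [m [m3 [i Ei]]] : exists m, (m < 3)%N /\ exists i,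
        pos (if b then m else 2 - m)%N (v (k' + i)%N) = c.
      case: c => -[|[|[|[|//]]]] c4.
      - exists z; split; first by rewrite /z; case: (b).
        by exists 0%N; apply: val_inj; rewrite /z; case: (b).
      - by exists 1%N; split=> //; exists 0%N; apply: val_inj; case: (b).
      - exists (2 - z)%N; split; first by rewrite /z; case: (b).
        by exists (i0' - k')%N; rewrite e0 vi; apply: val_inj; rewrite /z; case: (b).
      - exists (2 - z)%N; split; first by rewrite /z; case: (b).
        by exists (i1' - k')%N; rewrite e1 vi1; apply: val_inj; rewrite /z; case: (b).
    by have := fx i m m3; rewrite Ei.
  by move=> [c b']; have [f1 f2] := fl c; case: (b =P b') => [<-//|/eqP bb];
     have -> : b' = ~~ b by case: (b) b' bb => -[].
exists k', j', kap; split=> //.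
- by have [+ _ _ _] := kP i0; rewrite ki0 ji0.
- apply/funext => i; have [_ + _ _] := kP (i0 + 3 * i + (2 - z))%N.
  have -> : (k + (i0 + 3 * i + (2 - z)) = 3 * (k' + i) + (2 - z))%N by rewrite /k'; lia.
  have -> : (j + (i0 + 3 * i + (2 - z)) = 3 * (j' + i) + (2 - z))%N by lia.
  rewrite !code3; [|by rewrite /z; case: (b)..].
  move=> /(congr1 fst); rewrite /z /sdrop /=.
  by case: (b) => /=; case: (v _); case: (v' _).
Qed.

Lemma fixall_H k x : fixall k -> (k * H x ^+ N = H x ^+ N * k)%g.
Proof.
move=> kf; case: (x.1 =P ord0) => [x0|/eqP x0].
  by apply: (@N_comm k x (ord_max, true)) => //=; rewrite x0.
exact: (@N_comm k x (ord0, true)).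
Qed.

Lemma fixall_rw k s n : fixall k -> (k * rw s n = rw s n * k)%g.
Proof.
move=> kf; elim: n => [|n IH] /=; first by rewrite mulg1 mul1g.
by rewrite mulgA IH -mulgA fixall_H// mulgA.
Qed.

Lemma fixall_E k b v : fixall k -> rho k (E b v) = E b v.
Proof.
move=> kf; have sr := @code_reduced b v.
have [q qP] := shrink (fun=> sr) unb_id.
have Eq : ucv (fun n => E b v) q.
  have : ucv (fun n => rho (rw (code b v) n) (rho (rw (code b v) n)^-1%g (E b v))) q.
    by apply: qP; near=> n; exact: (endpointP X_compact z0 r0 rP N0P NN).
  by under eq_fun do rewrite rhoVK.
have Pq : ucv (fun n => rho (rw (code b v) n) (P (code b v n))) q.
  by apply: qP; near=> n; rewrite /nb /= mdistxx ltW.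
rewrite (ucv_uniq (ucv_cst _) Eq); apply: ucv_uniq (ucv_rho rho k Pq) _.
by under eq_fun do rewrite -hactM fixall_rw// hactM kf.
Unshelve. all: by end_near. Qed.

Lemma E_cvg b (v : nat -> bits) (w : bits) :
  (forall i, \forall n \near ufil, v n i = w i) -> ucv (fun n => E b (v n)) (E b w).
Proof.
move=> /unb_agree[k [ku kv]].
apply: (endpoint_cvg X_compact ca ne HV r0 rP rz N0P NN (k := k)) => //.
- by move=> n; exact: code_reduced.
- exact: code_reduced.
- apply: filterS kv => n vw i ik; rewrite /code vw//.
  by apply: leq_trans ik; exact: leq_div.
Qed.

Lemma W_cvg b v : ucv (fun k => rho (W b v k) z0) (E b v).
Proof.
have sr := @code_reduced b v.
have ku : unb (fun n => (3 * n).-1)%N.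
  by move=> M; apply: filterS (ufil_ge M.+1) => n; lia.
have [q qP] := shrink (fun=> sr) ku.
have Eq : ucv (fun n => E b v) q.
  have : ucv (fun n => rho (rw (code b v) (3 * n).-1)
      (rho (rw (code b v) (3 * n).-1)^-1%g (E b v))) q.
    by apply: qP; near=> n; exact: (endpointP X_compact z0 r0 rP N0P NN).
  by under eq_fun do rewrite rhoVK.
rewrite (ucv_uniq (ucv_cst _) Eq).
have : ucv (fun n => rho (rw (code b v) (3 * n).-1)
    (rho (H (code b v (3 * n).-1) ^+ N)%g z0)) q.
  apply: qP; near=> n; apply: (N0P NN); exact: (nb_z0 rz).
apply: ucv_eq; apply: filterS (ufil_ge 1%N) => n n0.
rewrite -hactM /W; have E : (3 * n = (3 * n).-1.+1)%N by lia.
by rewrite [in RHS]E.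
Unshelve. all: by end_near. Qed.

(** A coded line with a marked position: [lg] carries the base point there, [lv] is the future and
    [lu] the past read outwards. The moves [fwd] and [bwd] shift the mark and keep both ends. *)
Record line := Line { lg : G; lu : bits; lv : bits }.

Definition fwd (p : line) := Line (lg p * sl (lv p 0%N))%g (scons (lv p 0%N) (lu p)) (sdrop 1 (lv
    p)).
Definition bwd (p : line) := Line (lg p * (sl (lu p 0%N))^-1)%g (sdrop 1 (lu p)) (scons (lu p
    0%N) (lv p)).

Definition em p := rho (lg p) (E false (lu p)).
Definition ep p := rho (lg p) (E true (lv p)).

Lemma fwdK p : fwd (bwd p) = p.
Proof. by case: p => g u v; rewrite /fwd /= mulgVK sconsK sdrop_scons. Qed.

Lemma em_fwd p : em (fwd p) = em p.
Proof. by rewrite /em /fwd /= E_false -hactM mulgK. Qed.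

Lemma ep_fwd p : ep (fwd p) = ep p.
Proof. by rewrite /ep /fwd /= hactM -E_true sconsK. Qed.

Lemma em_bwd p : em (bwd p) = em p.
Proof. by rewrite -[in RHS](fwdK p) em_fwd. Qed.

Lemma ep_bwd p : ep (bwd p) = ep p.
Proof. by rewrite -[in RHS](fwdK p) ep_fwd. Qed.

Lemma em_iter_fwd k p : em (iter k fwd p) = em p.
Proof. by elim: k => //= k IH; rewrite em_fwd. Qed.
Lemma ep_iter_fwd k p : ep (iter k fwd p) = ep p.
Proof. by elim: k => //= k IH; rewrite ep_fwd. Qed.
Lemma em_iter_bwd k p : em (iter k bwd p) = em p.
Proof. by elim: k => //= k IH; rewrite em_bwd. Qed.
Lemma ep_iter_bwd k p : ep (iter k bwd p) = ep p.
Proof. by elim: k => //= k IH; rewrite ep_bwd. Qed.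

Lemma lg_iter_fwd k p : lg (iter k fwd p) = (lg p * W true (lv p) k)%g.
Proof.
elim: k p => [|k IH] p; first by rewrite mulg1.
by rewrite iterSr IH W_S -mulgA.
Qed.

Lemma lg_iter_bwd k p : lg (iter k bwd p) = (lg p * W false (lu p) k)%g.
Proof.
elim: k p => [|k IH] p; first by rewrite mulg1.
by rewrite iterSr IH W_S W_false1 -mulgA.
Qed.

(* The set of pairs of endpoints of lines is closed away from the diagonal: re-base each
   line where its orbit of [z0] leaves a ball around the limit of the first endpoints. *)
Lemma line_closed (S : bits -> bits -> Prop) (p : nat -> line) a b :
  (forall p, S (lu p) (lv p) -> S (lu (fwd p)) (lv (fwd p))) ->
  (forall p, S (lu p) (lv p) -> S (lu (bwd p)) (lv (bwd p))) ->
  (forall (us vs : nat -> bits) u v, (forall n, S (us n) (vs n)) ->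
    (forall i, \forall n \near ufil, us n i = u i) ->
    (forall i, \forall n \near ufil, vs n i = v i) -> S u v) ->
  (forall n, S (lu (p n)) (lv (p n))) ->
  ucv (fun n => em (p n)) a -> ucv (fun n => ep (p n)) b -> a <> b ->
  exists q, [/\ S (lu q) (lv q), em q = a & ep q = b].
Proof.
move=> Sf Sb Sc Sp pa pb ab.
have ab0 := mdist_gt0P ab; pose e := d a b / 2.
have e0 : 0 < e by rewrite divr_gt0.
have ex n : exists q, [/\ S (lu q) (lv q), em q = em (p n), ep q = ep (p n) &
    d a (em (p n)) < e -> e < d a (ep (p n)) ->
    d a (rho (lg q) z0) <= e /\ e < d a (rho (lg (fwd q)) z0)].
  case: (pselect (d a (em (p n)) < e /\ e < d a (ep (p n)))) => [[n1 n2]|nn]; last first.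
    by exists (p n); split=> // n1 n2; case: nn.
  have Sif k : S (lu (iter k fwd (p n))) (lv (iter k fwd (p n))).
    by elim: k => //= k IH; exact: Sf.
  have Sib k : S (lu (iter k bwd (p n))) (lv (iter k bwd (p n))).
    by elim: k => //= k IH; exact: Sb.
  have [in0|out0] := leP (d a (rho (lg (p n)) z0)) e.
    have : exists k, e < d a (rho (lg (iter k fwd (p n))) z0).
      have C : ucv (fun k => rho (lg (iter k fwd (p n))) z0) (ep (p n)).
        under eq_fun do rewrite lg_iter_fwd hactM.
        exact: ucv_rho (W_cvg true (lv (p n))).
      apply: contrapT => /forallNP nk.
      have : d a (ep (p n)) <= e.
        apply: (ucv_le (ucv_cst a) C); near=> k; rewrite leNgt; apply/negP; exact: nk.
      by rewrite leNgt n2.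
    move=> /ex_min_prop[[|k]]; first by rewrite ltNge in0 => -[].
    move=> [kout kmin]; exists (iter k fwd (p n)); split=> //.
    - exact: em_iter_fwd.
    - exact: ep_iter_fwd.
    - move=> _ _; split=> //; rewrite leNgt; apply/negP => /kmin; by rewrite ltnn.
  have : exists k, d a (rho (lg (iter k bwd (p n))) z0) <= e.
    have C : ucv (fun k => rho (lg (iter k bwd (p n))) z0) (em (p n)).
      under eq_fun do rewrite lg_iter_bwd hactM.
      exact: ucv_rho (W_cvg false (lu (p n))).
    by have [k /ltW] := ufil_ex (ucv_lt_near C n1); exists k.
  move=> /ex_min_prop[[|k]]; first by rewrite leNgt out0 => -[].
  move=> [kin kmin]; exists (iter k.+1 bwd (p n)); split=> //.
  - exact: em_iter_bwd.
  - exact: ep_iter_bwd.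
  - move=> _ _; split=> //; rewrite iterS fwdK ltNge; apply/negP => /kmin; by rewrite ltnn.
have {ex}[q qP] := choice ex.
have qa : ucv (fun n => em (q n)) a.
  by apply: ucv_eq pa; near=> n; case: (qP n).
have qb : ucv (fun n => ep (q n)) b.
  by apply: ucv_eq pb; near=> n; case: (qP n).
have near_cross : \forall n \near ufil,
    d a (rho (lg (q n)) z0) <= e /\ e < d a (rho (lg (fwd (q n))) z0).
  have na : \forall n \near ufil, d a (em (p n)) < e.
    by apply: (ucv_lt_near pa); rewrite mdistxx.
  have nbb : \forall n \near ufil, e < d a (ep (p n)).
    move/ucvP : pb => /(_ e e0); apply: filterS => n.
    by have := metric_triangle a (ep (p n)) b; rewrite (metric_sym (ep (p n))) /e; lra.
  by apply: filterS2 na nbb => n; case: (qP n) => _ _ _; apply.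
have exl (f : nat -> bits) : exists l : bits, forall i, \forall n \near ufil, f n i = l i.
  have fi i : exists c, \forall n \near ufil, f n i = c by exact: ufil_fin.
  by have [l lP] := choice fi; exists l.
have [u uP] := exl (fun n => lu (q n)); have [v vP] := exl (fun n => lv (q n)).
have cu := E_cvg false uP; have cv := E_cvg true vP.
have Suv : S u v by apply: Sc uP vP => n; case: (qP n).
(* If the marks were unbounded, the repelling point would be one of the two ends, since [a] and [b]
   differ. The image of [z0] stays in the ball about [a], which leaves [E true v] as repelling point
   and [a] as attracting point; but the next mark along the line, also attracted to [a], stays
   outside the ball. *)
have /not_unc[f fP] : ~ unc (fun n => lg (q n)).
  move=> gu; have [al [be gab]] := ucoll_ex X_compact ca ne gu.
  have al_uv : al = E false u \/ al = E true v.
    apply: contrapT => /not_orP[nu nv]; apply: ab.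
    by rewrite (ucv_uniq qa (gab _ _ cu (nesym nu))) (ucv_uniq qb (gab _ _ cv (nesym nv))).
  have zal : z0 <> al by case: al_uv => -> /esym; exact: E_z0.
  have zbe := gab _ _ (ucv_cst z0) zal.
  have be_in : d a be <= e.
    by apply: (ucv_le (ucv_cst a) zbe); apply: filterS near_cross => n [].
  have be_b : be <> b by move=> E; move: be_in; rewrite E /e; lra.
  have al_v : al = E true v.
    case: al_uv => // al_u; exfalso; apply: be_b.
    by apply: ucv_uniq (gab _ _ cv _) qb; rewrite al_u; exact: E_neq.
  have be_a : be = a.
    by apply: ucv_uniq (gab _ _ cu _) qa; rewrite al_v; exact/nesym/E_neq.
  have sz : rho (sl (v 0%N)) z0 <> al.
    rewrite al_v -[v in E true v]sconsK E_true => /rho_inj/esym; exact: E_z0.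
  have C := gab _ _ (ucv_cst _) sz.
  have : e <= d a be.
    apply: (ucv_ge (ucv_cst a) C); apply: filterS2 near_cross (vP 0%N) => n [_ +] v0.
    by rewrite /fwd /= v0 hactM => /ltW.
  by rewrite be_a mdistxx leNgt e0.
exists (Line f u v); split=> //.
- apply: ucv_uniq (ucv_rho rho f cu) _.
  by apply: ucv_eq qa; apply: filterS fP => n <-.
- apply: ucv_uniq (ucv_rho rho f cv) _.
  by apply: ucv_eq qb; apply: filterS fP => n <-.
Unshelve. all: by end_near. Qed.

End Code.

(** * The Thue-Morse lamination *)

Section ThueMorse.
Local Open Scope nat_scope.

(** The parity of the binary digit sum; the fuel makes the recursion on halves structural. *)
Fixpoint tm_fuel (f n : nat) : bool :=
  if f is f'.+1 then if n is 0 then false else odd n (+) tm_fuel f' n./2 else false.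

Definition tm (n : nat) : bool := tm_fuel n n.

Lemma tm_fuelE f n : n <= f -> tm_fuel f n = tm n.
Proof.
elim/ltn_ind: n f => -[|n] IH [|f] //= nf.
have h : n.+1./2 <= n by have := odd_double_half n.+1; case: (odd n.+1); lia.
rewrite /tm /=; congr (_ (+) _).
by rewrite !IH ?ltnS// (leq_trans h).
Qed.

Lemma tmE n : 0 < n -> tm n = odd n (+) tm n./2.
Proof.
case: n => // n _; rewrite {1}/tm /=; congr (_ (+) _); apply: tm_fuelE.
by have := odd_double_half n.+1; case: (odd n.+1); lia.
Qed.

Lemma tm_even n : tm (2 * n) = tm n.
Proof.
case: n => // n; rewrite tmE ?muln_gt0// mul2n odd_double doubleK.
by rewrite addFb.
Qed.

Lemma tm_odd n : tm (2 * n).+1 = ~~ tm n.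
Proof. by rewrite tmE// mul2n /= odd_double uphalf_double addTb. Qed.

Lemma parityP n : exists k, n = 2 * k \/ n = (2 * k).+1.
Proof. by exists n./2; have := odd_double_half n; case: (odd n); lia. Qed.

Lemma tm_not3 n : tm n = tm n.+1 -> tm n.+1 = tm n.+2 -> False.
Proof.
have [k [->|->]] := parityP n; first by rewrite tm_odd tm_even; case: (tm k).
have -> : (2 * k).+2 = 2 * k.+1 by lia.
by rewrite !tm_odd !tm_even => _; case: (tm k.+1).
Qed.

Lemma tm_block n q i : i < 2 ^ n -> tm (2 ^ n * q + i) = tm q (+) tm i.
Proof.
elim: n q i => [|n IH] q i; first by rewrite expn0 ltnS leqn0 => /eqP ->; rewrite mul1n addn0 addbF.
rewrite expnS => i2; have [k [E|E]] := parityP i; rewrite E.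
  have -> : 2 * 2 ^ n * q + 2 * k = 2 * (2 ^ n * q + k) by lia.
  by rewrite !tm_even IH//; lia.
have -> : 2 * 2 ^ n * q + (2 * k).+1 = (2 * (2 ^ n * q + k)).+1 by lia.
by rewrite !tm_odd IH ?addbN//; lia.
Qed.

Lemma tm_rev n i : i < 2 ^ n -> tm (2 ^ n - 1 - i) = odd n (+) tm i.
Proof.
elim: n i => [|n IH] i; first by rewrite expn0 ltnS leqn0 => /eqP ->.
rewrite expnS => i2; have [k [E|E]] := parityP i; rewrite E /=.
  have -> : 2 * 2 ^ n - 1 - 2 * k = (2 * (2 ^ n - 1 - k)).+1 by lia.
  by rewrite tm_odd tm_even IH ?addNb//; lia.
have -> : 2 * 2 ^ n - 1 - (2 * k).+1 = 2 * (2 ^ n - 1 - k) by lia.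
by rewrite tm_odd tm_even IH ?addNb ?addbN ?negbK//; lia.
Qed.

(** The two letters at positions [2 * K] and [(2 * K).+1] differ. If five letters could be read with
    both parities they would alternate, and then three consecutive letters at half scale would be
    equal. *)
Lemma tm_parity c N N' : (forall i, i < 5 -> tm (N + i) = c (+) tm (N' + i)) ->
  odd N = odd N'.
Proof.
have key c' K K' : (forall i, i < 5 -> tm (2 * K + i) = c' (+) tm ((2 * K').+1 + i)) -> False.
  move=> HK; have := HK 0 isT; have := HK 1 isT; have := HK 2 isT; have := HK 3 isT.
  have := HK 4 isT.
  have -> : (2 * K').+1 + 4 = (2 * (K' + 2)).+1 by lia.
  have -> : (2 * K').+1 + 3 = 2 * (K' + 2) by lia.
  have -> : (2 * K').+1 + 2 = (2 * (K' + 1)).+1 by lia.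
  have -> : (2 * K').+1 + 1 = 2 * (K' + 1) by lia.
  have -> : 2 * K + 4 = 2 * K.+2 by lia.
  have -> : 2 * K + 3 = (2 * K.+1).+1 by lia.
  have -> : 2 * K + 2 = 2 * K.+1 by lia.
  have -> : 2 * K + 1 = (2 * K).+1 by lia.
  rewrite !addn0 !tm_odd !tm_even.
  have := @tm_not3 K.
  clear HK; move: (tm K) (tm K.+1) (tm K.+2) (tm (K' + 2)) (tm (K' + 1)) (tm K') c'.
  by move=> [] [] [] [] [] [] [] //= n3; first [case: (n3 erefl erefl)|move=> *].
have [K [->|->]] := parityP N; have [K' [->|->]] := parityP N'.
- by rewrite !mul2n !odd_double.
- by move=> /key.
- move=> HK; exfalso; apply: (key c K' K) => i i5.
  by rewrite HK// addbA addbb addFb.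
- by rewrite !mul2n /= !odd_double.
Qed.

(** Recognizability: the parity of the position is determined first, then the word is halved. The
    window is five letters at the coarsest scale. *)
Lemma tm_recog n c N N' : (forall i, i < 5 * 2 ^ n -> tm (N + i) = c (+) tm (N' + i)) ->
  N = N' %[mod 2 ^ n].
Proof.
elim: n c N N' => [|n IH] c N N' HN; first by rewrite expn0 !modn1.
have w : 5 <= 5 * 2 ^ n.+1 by have := expn_gt0 2 n.+1; lia.
have := tm_parity (fun i i5 => HN i (leq_trans i5 w)).
rewrite expnS; have [K [EK|EK]] := parityP N; have [K' [EK'|EK']] := parityP N';
    rewrite EK EK' /= !mul2n ?odd_double//= => _.
- rewrite -!mul2n -!muln_modr; congr (2 * _); apply: (IH c) => i i5.
  rewrite -(tm_even (K + i)) -(tm_even (K' + i)) !mulnDr -EK -EK'.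
  by apply: HN; rewrite expnS; lia.
- rewrite -!mul2n -addn1 -(addn1 (2 * K')) -modnDml -(modnDml (2 * K')).
  rewrite -!muln_modr; congr ((2 * _ + 1) %% _); apply: (IH c) => i i5.
  apply: negb_inj; rewrite -addbN -!tm_odd.
  have -> : (2 * (K + i)).+1 = N + 2 * i by lia.
  have -> : (2 * (K' + i)).+1 = N' + 2 * i by lia.
  by apply: HN; rewrite expnS; lia.
Qed.

(** An odd position is preceded by the complement of its own letter, so occurrences preceded by
    different letters start at even positions; halving preserves the situation. *)
Lemma tm_recog_cut n N N' : 0 < N -> 0 < N' ->
  (forall i, i < 5 * 2 ^ n -> tm (N + i) = tm (N' + i)) ->
  tm N.-1 <> tm N'.-1 -> (2 ^ n %| N) && (2 ^ n %| N').
Proof.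
elim: n N N' => [|n IH] N N' N0 N'0 HN NN; first by rewrite expn0 !dvd1n.
have w : 5 <= 5 * 2 ^ n.+1 by have := expn_gt0 2 n.+1; lia.
have HN' i (i5 : i < 5) : tm (N + i) = false (+) tm (N' + i).
  by rewrite HN// (leq_trans i5).
have := tm_parity HN'.
have HN0 : tm N = tm N' by rewrite -(addn0 N) -(addn0 N') HN//; lia.
have [K [EK|EK]] := parityP N; have [K' [EK'|EK']] := parityP N';
    rewrite EK EK' /= !mul2n ?odd_double//= => _; last first.
  exfalso; apply: NN; move: HN0; rewrite EK EK' !tm_odd !succnK !tm_even; exact: negb_inj.
rewrite -!mul2n expnS !dvdn_pmul2l//; apply: IH.
- by lia.
- by lia.
- move=> i i5; rewrite -(tm_even (K + i)) -(tm_even (K' + i)) !mulnDr -EK -EK'.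
  by apply: HN; rewrite expnS; lia.
- move=> E; apply: NN; have -> : N.-1 = (2 * K.-1).+1 by lia.
  have -> : N'.-1 = (2 * K'.-1).+1 by lia.
  by rewrite !tm_odd E.
Qed.

(* [tm_line u v]: the two-sided word with past [u], read outwards, and future [v] belongs to the
   Thue-Morse subshift. *)
Definition tm_line (u v : bits) := forall m, exists M, m <= M /\
  forall i, i < m -> v i = tm (M + i) /\ u i = tm (M - 1 - i).

Lemma tm_line_fwd u v : tm_line u v -> tm_line (scons (v 0) u) (sdrop 1 v).
Proof.
move=> Suv m; have [M [mM uvM]] := Suv m.+1; exists M.+1; split; first by lia.
move=> i im; split; first by rewrite /sdrop add1n (uvM i.+1 _).1// addSn addnS.
case: i im => [|i] im /=.
  by rewrite (uvM 0 _).1// addn0; congr tm; lia.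
by rewrite (uvM i _).2; [congr tm; lia|lia].
Qed.

Lemma tm_line_bwd u v : tm_line u v -> tm_line (sdrop 1 u) (scons (u 0) v).
Proof.
move=> Suv m; have [M [mM uvM]] := Suv m.+1; exists M.-1; split; first by lia.
move=> i im; split; last by rewrite /sdrop add1n (uvM i.+1 _).2//; congr tm; lia.
case: i im => [|i] im /=.
  by rewrite (uvM 0 _).2//; congr tm; lia.
by rewrite (uvM i _).1; [congr tm; lia|lia].
Qed.

Lemma tm_line_sym u v : tm_line u v -> tm_line v u.
Proof.
(* For even [n] the prefix of length [2 ^ n] is a palindrome, so position [M] has the mirror image
   [2 ^ n - M]. *)
move=> Suv m; have [M [mM uvM]] := Suv m; pose n := (M + m)%N.*2.
have n2 : M + m < 2 ^ n by apply: leq_ltn_trans (ltn_expl n (ltnSn 1)); rewrite /n -addnn leq_addr.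
have R j : j < 2 ^ n -> tm j = tm (2 ^ n - 1 - j).
  by move=> jn; rewrite tm_rev// odd_double addFb.
clearbody n; exists (2 ^ n - M); split; first by lia.
move=> i im; have [vi ui] := uvM i im; rewrite vi ui; split.
  by rewrite R; [congr tm; lia|lia].
by rewrite R; [congr tm; lia|lia].
Qed.

Lemma tm_line_recurrent u v : tm_line u v -> recurrent v.
Proof.
move=> Suv k c; have [M [_ uvM]] := Suv k.+3.
have v3 i : i < 3 -> v (k + i) = tm (M + k + i) by move=> i3; rewrite (uvM _ _).1 ?addnA; lia.
have := @tm_not3 (M + k).
have := v3 0 isT; have := v3 1 isT; have := v3 2 isT; rewrite !addn0 !addn1 !addn2.
move=> <- <- <- n3; apply: contrapT => /forallNP nv.
have vc i : k <= i -> v i = ~~ c.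
  by move=> ki; have /not_andP[//|] := nv i; case: (v i) (c) => -[].
by apply: n3; rewrite !vc//; lia.
Qed.

(** Equal tails give equal windows, so the two positions agree modulo a power of two larger than
    both shifts. *)
Lemma tm_line_aperiodic u v k j : tm_line u v -> sdrop k v = sdrop j v -> k = j.
Proof.
have key k' j' : k' < j' -> tm_line u v -> sdrop k' v = sdrop j' v -> False.
  move=> kj Suv E; pose n := j'; have n2 : j' < 2 ^ n by exact: ltn_expl.
  have [M [_ uvM]] := Suv (j' + 5 * 2 ^ n).
  have : M + k' = M + j' %[mod 2 ^ n].
    apply: (@tm_recog n false) => i i5; rewrite addFb -!addnA -!(uvM _ _).1; try by lia.
    by have := congr1 (fun f => f i) E.
  move=> /eqP; rewrite eqn_modDl => /eqP; rewrite !modn_small//; lia.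
by move=> Suv E; have [kj|jk|//] := ltngtP k j;
  [case: (key _ _ kj Suv E)|case: (key _ _ jk Suv (esym E))].
Qed.

Definition tm_ray (c : bool) : bits := fun i => c (+) tm i.

Lemma tm_ray_drop c e k j : sdrop k (tm_ray c) = sdrop j (tm_ray e) -> k = j /\ c = e.
Proof.
move=> E.
have kj : k = j.
  pose n := k + j; have n2 : k + j < 2 ^ n by exact: ltn_expl.
  have : k = j %[mod 2 ^ n].
    apply: (@tm_recog n (c (+) e)) => i i5.
    have := congr1 (fun f => f i) E; rewrite /sdrop /tm_ray.
    by case: c e (tm _) (tm _) {E n n2 i5} => -[] [] [].
  by rewrite !modn_small; lia.
split=> //; have := congr1 (fun f => f 0) E; rewrite kj /sdrop /tm_ray.
by case: c e (tm _) {E} => -[] [].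
Qed.

(** Different preceding letters force the cut to lie at multiples of every [2 ^ n]; hence both sides
    are Thue-Morse blocks of every level, up to complement. *)
Lemma tm_line_cut u u' v : tm_line u v -> tm_line u' v -> u 0 <> u' 0 -> v = tm_ray (v 0) /\ u =
    tm_ray (u 0).
Proof.
move=> Suv Su'v uu.
have cut n : exists q, 0 < q /\ forall i, i < 2 ^ n -> v i = tm (2 ^ n * q + i) /\
    u i = tm (2 ^ n * q - 1 - i).
  have pos2 := expn_gt0 2 n.
  have [M [mM uvM]] := Suv (5 * 2 ^ n); have [M' [mM' uvM']] := Su'v (5 * 2 ^ n).
  have /andP[/dvdnP[q qE] _] : (2 ^ n %| M) && (2 ^ n %| M').
    apply: tm_recog_cut; [lia|lia| |].
      by move=> i i5; rewrite -(uvM i i5).1 -(uvM' i i5).1.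
    have z5 : 0 < 5 * 2 ^ n by lia.
    move: uu; rewrite (uvM 0 z5).2 (uvM' 0 z5).2.
    by rewrite !subn0 !subn1.
  exists q; split; first by case: q qE => //; lia.
  by move=> i i2; have := uvM i; rewrite qE (mulnC q); apply; lia.
split; apply/funext => i; have i2 : i < 2 ^ i by exact: ltn_expl.
  have [q [q0 qP]] := cut i; have p2 := expn_gt0 2 i.
  by rewrite /tm_ray (qP i i2).1 (qP 0 p2).1 !tm_block// addbF.
have [q [q0 qP]] := cut i; have p2 := expn_gt0 2 i.
rewrite /tm_ray (qP i i2).2 (qP 0 p2).2.
have E j : j < 2 ^ i -> 2 ^ i * q - 1 - j = 2 ^ i * q.-1 + (2 ^ i - 1 - j).
  by case: (q) q0 => // q' _ j2; rewrite mulnS /=; lia.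
rewrite !E// !tm_block ?tm_rev//; try by lia.
by rewrite addbF addbA.
Qed.

Lemma tm_line_rays c e : tm_line (tm_ray c) (tm_ray e).
Proof.
move=> m; pose n := m.*2; have nm : m < 2 ^ n.
  by apply: leq_ltn_trans (ltn_expl n (ltnSn 1)); rewrite /n -addnn leq_addr.
have [q [q0 qc qe]] : exists q, [/\ 0 < q, tm q.-1 = c & tm q = e].
  (* All four two-letter words occur in the sequence: 11, 10, 01 and 00 end at these positions. *)
  by case: c e => -[]; [exists 2|exists 3|exists 1|exists 6].
exists (2 ^ n * q); split; first by case: q q0 {qc qe} => // q; lia.
move=> i im; split; first by rewrite tm_block ?qe//; lia.
have -> : 2 ^ n * q - 1 - i = 2 ^ n * q.-1 + (2 ^ n - 1 - i).
  by case: q q0 {qc qe} => // q' _; rewrite mulnS /=; lia.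
by rewrite tm_block ?tm_rev ?qc ?odd_double ?addFb//; lia.
Qed.

Lemma tm_line_closed (us vs : nat -> bits) u v : (forall n, tm_line (us n) (vs n)) ->
  (forall i, \forall n \near ufil, us n i = u i) ->
  (forall i, \forall n \near ufil, vs n i = v i) -> tm_line u v.
Proof.
move=> Suv Hu Hv m.
have /unb_agree[k [ku kP]] i : \forall n \near ufil, us n i = u i /\ vs n i = v i.
  exact: filterS2 (Hu i) (Hv i).
have [n [uvn mk]] := ufil_ex (filterI kP (ku m)).
have [M [mM uvM]] := Suv n m; exists M; split=> // i im.
by have [<- <-] := uvn i (ltnW (leq_trans im mk)); exact: uvM.
Qed.

End ThueMorse.

(** * The equivalence relation generated by coded lines *)

Fixpoint wd (G : groupType) (s : bool -> G) (v : bits) k : G :=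
  if k is k'.+1 then (s (v 0%N) * wd s (sdrop 1 v) k')%g else 1%g.

Section Singular.
Context {G : groupType} {T0 : topologicalType} (rho : homeo_action G T0).
Variables (s : bool -> G) (E : bool -> bits -> T0) (K : set G).
Hypothesis Et : forall c v, E true (scons c v) = rho (s c) (E true v).
Hypothesis Ef : forall c v, E false (scons c v) = rho (s c)^-1%g (E false v).
Hypothesis KE : forall k b v, K k -> rho k (E b v) = E b v.
Hypothesis tail : forall b g v v', recurrent v -> rho g (E b v) = E b v' ->
  exists k j kappa, let sb c := if b then s c else (s c)^-1%g in
  [/\ (g * wd sb v k = wd sb v' j * kappa)%g, sdrop k v = sdrop j v' & K kappa].

Lemma line_fwd k g u v : tm_line u v -> exists u', [/\ tm_line u' (sdrop k v),
  rho g (E true v) = rho (g * wd s v k)%g (E true (sdrop k v)) &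
  rho g (E false u) = rho (g * wd s v k)%g (E false u')].
Proof.
elim: k g u v => [|k IH] g u v Suv.
  by exists u; rewrite mulg1 (_ : sdrop 0 v = v)//; apply/funext.
have [u' [Su' E1 E2]] := IH (g * s (v 0%N))%g _ _ (tm_line_fwd Suv).
have dS : sdrop k (sdrop 1 v) = sdrop k.+1 v by [].
exists u'; split=> //=.
  by rewrite -[v in LHS]sconsK Et -hactM mulgA E1 dS.
by rewrite mulgA -E2 Ef -hactM mulgK.
Qed.

Lemma line_cut i g u u' v : tm_line u v -> tm_line u' v -> (forall j, (j < i)%N -> u j = u' j) ->
  u i <> u' i -> exists f e c, [/\ rho f (E true (tm_ray e)) = rho g (E true v),
    rho f (E false (tm_ray c)) = rho g (E false u) &
    rho f (E false (tm_ray (~~ c))) = rho g (E false u')].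
Proof.
elim: i g u u' v => [|i IH] g u u' v Suv Suv' eqi neqi.
  have [-> ->] := tm_line_cut Suv Suv' neqi.
  have [_ ->] := tm_line_cut Suv' Suv (nesym neqi).
  exists g, (v 0%N), (u 0%N); split=> //.
  by have -> : u' 0%N = ~~ u 0%N by move: neqi; case: (u 0%N) (u' 0%N) => -[].
have u0 := eqi 0%N isT.
have Suv2 := tm_line_bwd Suv'; rewrite -u0 in Suv2.
have [||f [e [c [E1 E2 E3]]]] := IH (g * (s (u 0%N))^-1)%g _ _ _ (tm_line_bwd Suv) Suv2.
- by move=> j ji; apply: eqi.
- by [].
exists f, e, c; split.
- by rewrite E1 Et -hactM mulgVK.
- by rewrite E2 -[u in RHS]sconsK Ef -hactM.
- by rewrite E3 u0 -[u' in RHS]sconsK Ef -hactM.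
Qed.

(** Equality of tails moves both marks to positions with the same future, up to an element of [K],
    which fixes every [E b v]. The pasts then differ at a first index, and moving the mark back to
    it exposes a singular word. *)
Lemma line_singular g u v g' u' v' : tm_line u v -> tm_line u' v' ->
  rho g (E true v) = rho g' (E true v') -> rho g (E false u) <> rho g' (E false u') ->
  exists f e c, [/\ rho f (E true (tm_ray e)) = rho g (E true v),
    rho f (E false (tm_ray c)) = rho g (E false u) &
    rho f (E false (tm_ray (~~ c))) = rho g' (E false u')].
Proof.
move=> Suv Suv' Ev Eu.
have : rho (g'^-1 * g)%g (E true v) = E true v' by rewrite hactM Ev rhoK.
move=> /(tail (tm_line_recurrent Suv))[k [j [kap [/= gw dv Kk]]]].
have [u1 [S1 E1 E2]] := line_fwd k g Suv.
have [u2 [S2 E3 E4]] := line_fwd j g' Suv'.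
have gE : (g * wd s v k = g' * wd s v' j * kap)%g.
  by rewrite -mulgA -[in RHS]gw !mulgA mulgV mul1g.
set h := (g' * wd s v' j)%g in gE E3 E4.
have E5 : rho g (E false u) = rho h (E false u1) by rewrite E2 gE hactM KE.
have neq12 : u1 <> u2 by move=> u12; apply: Eu; rewrite E5 E4 u12.
have /ex_min_prop[i [ui imin]] : exists i, u1 i <> u2 i.
  by apply: contrapT => /forallNP e; apply: neq12; apply/funext => i; exact: contrapT.
rewrite Ev E3 E5 E4; apply: (@line_cut i).
- by rewrite -dv.
- by [].
- by move=> l li; apply: contrapT => /imin; rewrite leqNgt li.
- by [].
Qed.

End Singular.

Section Lamination.
Context {G : groupType} {T0 : topologicalType} (rho : homeo_action G T0).
Variables (s : bool -> G) (E : bool -> bits -> T0) (K : set G).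
Hypothesis Et : forall c v, E true (scons c v) = rho (s c) (E true v).
Hypothesis Ef : forall c v, E false (scons c v) = rho (s c)^-1%g (E false v).
Hypothesis Em : forall g u v, rho g (E true v) <> E false u.
Hypothesis KE : forall k b v, K k -> rho k (E b v) = E b v.
Hypothesis Ks : forall k c, K k -> (k * s c = s c * k)%g.
Hypothesis Kfin : forall g : nat -> G, (forall n, K (g n)) -> ~ unc g.
Hypothesis tail : forall b g v v', recurrent v -> rho g (E b v) = E b v' ->
  exists k j kappa, let sb c := if b then s c else (s c)^-1%g in
  [/\ (g * wd sb v k = wd sb v' j * kappa)%g, sdrop k v = sdrop j v' & K kappa].

(** The previous lemma for the reversed coding, obtained by inverting [s] and exchanging the two
    kinds of rays. *)
Lemma line_singular_mirror g u v g' u' v' : tm_line u v -> tm_line u' v' ->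
  rho g (E false u) = rho g' (E false u') -> rho g (E true v) <> rho g' (E true v') ->
  exists f e c, [/\ rho f (E false (tm_ray e)) = rho g (E false u),
    rho f (E true (tm_ray c)) = rho g (E true v) &
    rho f (E true (tm_ray (~~ c))) = rho g' (E true v')].
Proof.
move=> Suv Suv'.
apply: (@line_singular _ _ rho (fun c => (s c)^-1%g) (fun b => E (~~ b)) K) => //=.
- by move=> c w; rewrite invgK Et.
- by move=> k b w; exact: KE.
- move=> b h w w' rw /(tail rw)[k [j [kap H]]]; exists k, j, kap => /=.
  have sE : (fun c => if b then (s c)^-1 else (s c)^-1^-1)%g =
      (fun c => if ~~ b then s c else (s c)^-1)%g.
    by apply/funext => c; case: (b); rewrite /= ?invgK.
  by rewrite sE.
- exact: tm_line_sym.
- exact: tm_line_sym.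
Qed.

Lemma wd_comm k (s' : bool -> G) v n : (forall c, k * s' c = s' c * k)%g ->
  (k * wd s' v n = wd s' v n * k)%g.
Proof.
move=> ks; elim: n v => [|n IH] v /=; first by rewrite mulg1 mul1g.
by rewrite mulgA ks -mulgA IH mulgA.
Qed.

Lemma KsV k c : K k -> (k * (s c)^-1 = (s c)^-1 * k)%g.
Proof. by move=> /Ks-/(_ c) E0; apply: (mulgI (s c)); rewrite mulVKg mulgA -E0 mulgK. Qed.

Lemma wdK k b v n (sb := fun c => if b then s c else (s c)^-1%g) : K k ->
  (k * wd sb v n = wd sb v n * k)%g.
Proof. by move=> Kk; apply: wd_comm => c; rewrite /sb; case: (b); [exact: Ks|exact: KsV]. Qed.

Lemma tm_ray_tail b g c e : rho g (E b (tm_ray c)) = E b (tm_ray e) -> c = e /\ K g.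
Proof.
move=> /(tail (tm_line_recurrent (tm_line_rays true c)))[k [j [kap [gw]]]].
move=> /tm_ray_drop[kj ce] Kk; split=> //; move: gw.
by rewrite ce kj -wdK// => /mulIg ->.
Qed.

(** An element fixing an end shifts the tail of its coding into itself; by aperiodicity the shift is
    zero, and only [K] is left. *)
Lemma E_stab b f g u v : tm_line u v -> rho g (rho f (E b v)) = rho f (E b v) ->
  K (f^-1 * g * f)%g.
Proof.
move=> Suv gx; have : rho (f^-1 * g * f)%g (E b v) = E b v by rewrite !hactM gx rhoK.
move=> /(tail (tm_line_recurrent Suv))[k [j [kap [gw /(tm_line_aperiodic Suv) kj Kk]]]].
by move: gw; rewrite -kj -wdK// => /mulIg ->.
Qed.

Definition leaf a b := exists g u v,
  [/\ tm_line u v, a = rho g (E false u) & b = rho g (E true v)].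

Lemma leaf_rho g a b : leaf a b -> leaf (rho g a) (rho g b).
Proof.
by move=> [f [u [v [Suv -> ->]]]]; exists (g * f)%g, u, v; rewrite !hactM.
Qed.

Lemma leaf_orient a b c : leaf a b -> leaf b c -> False.
Proof.
move=> [f [u [v [Suv _ ->]]]] [g [u' [v' [Suv' + _]]]].
by move=> /(congr1 (rho g^-1%g)); rewrite rhoK -hactM => /Em.
Qed.

Lemma singular_t a a' b : leaf a b -> leaf a' b -> a <> a' -> exists f e c,
  [/\ b = rho f (E true (tm_ray e)), a = rho f (E false (tm_ray c)) &
    a' = rho f (E false (tm_ray (~~ c)))].
Proof.
move=> [f [u [v [Suv -> ->]]]] [g [u' [v' [Suv' -> E']]]] aa.
by have [h [e [c [<- <- <-]]]] := line_singular Et Ef KE tail Suv Suv' E' aa; exists h, e, c.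
Qed.

Lemma singular_f a b b' : leaf a b -> leaf a b' -> b <> b' -> exists f e c,
  [/\ a = rho f (E false (tm_ray e)), b = rho f (E true (tm_ray c)) &
    b' = rho f (E true (tm_ray (~~ c)))].
Proof.
move=> [f [u [v [Suv -> ->]]]] [g [u' [v' [Suv' E' ->]]]] bb.
by have [h [e [c [<- <- <-]]]] := line_singular_mirror Suv Suv' E' bb; exists h, e, c.
Qed.

Lemma tm_ray_base b f g c e : rho f (E b (tm_ray c)) = rho g (E b (tm_ray e)) ->
  c = e /\ forall b' v, rho f (E b' v) = rho g (E b' v).
Proof.
move=> H; have /tm_ray_tail[ce Kfg] : rho (g^-1 * f)%g (E b (tm_ray c)) = E b (tm_ray e).
  by rewrite hactM H rhoK.
split=> // b' v; rewrite -[in RHS](KE b' v Kfg) -hactM; congr (rho _ _).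
by rewrite mulVKg.
Qed.

(** If [a] and [a'] differ, as do [b] and [b'], all four points are ends of singular lines based at
    the same element. Any singular past fits with any singular future, so they form a complete
    bipartite graph. *)
Lemma leaf_rect a a' b b' : leaf a b -> leaf a' b -> leaf a' b' -> leaf a b'.
Proof.
move=> ab a'b a'b'; have [->//|aa] := pselect (a = a').
have [<-//|bb] := pselect (b = b').
have [f [e [c [Eb Ea Ea']]]] := singular_t ab a'b aa.
have [g [e' [c' [Fa Fb Fb']]]] := singular_f a'b a'b' bb.
have [_ fg] := tm_ray_base (etrans (esym Ea') Fa).
by exists g, (tm_ray c), (tm_ray (~~ c')); split; [exact: tm_line_rays|rewrite Ea fg|].
Qed.

Lemma leaf_two_t a a' a'' b : leaf a b -> leaf a' b -> leaf a'' b ->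
  a <> a' -> a <> a'' -> a' = a''.
Proof.
move=> ab a'b a''b aa aa'.
have [f [e [c [Eb Ea ->]]]] := singular_t ab a'b aa.
have [g [e' [c' [Fb Fa ->]]]] := singular_t ab a''b aa'.
by have [-> fg] := tm_ray_base (etrans (esym Ea) Fa); rewrite fg.
Qed.

Lemma leaf_two_f a b b' b'' : leaf a b -> leaf a b' -> leaf a b'' ->
  b <> b' -> b <> b'' -> b' = b''.
Proof.
move=> ab ab' ab'' bb bb'.
have [f [e [c [Ea Eb ->]]]] := singular_f ab ab' bb.
have [g [e' [c' [Fa Fb ->]]]] := singular_f ab ab'' bb'.
by have [-> fg] := tm_ray_base (etrans (esym Eb) Fb); rewrite fg.
Qed.

(** The connected component of the leaf from [a] to [b]: by [leaf_rect] components are complete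
    bipartite, so it suffices to look at the neighbours of [a] and of [b]. *)
Definition gap a b x := leaf x b \/ leaf a x.

Definition glue x y := x = y \/ exists a b, [/\ leaf a b, gap a b x & gap a b y].

Lemma gap_sub a b a' b' x z : leaf a b -> leaf a' b' -> gap a b x -> gap a' b' x ->
  gap a b z -> gap a' b' z.
Proof.
move=> ab ab' [xb|ax] [xb'|ax'] [zb|az].
- by left; exact: leaf_rect zb xb xb'.
- by right; exact: leaf_rect ab' (leaf_rect ab xb xb') az.
- by case: (leaf_orient ax' xb).
- by case: (leaf_orient ax' xb).
- by case: (leaf_orient ax xb').
- by case: (leaf_orient ax xb').
- by left; exact: leaf_rect zb ab (leaf_rect ax ax' ab').
- by right; exact: leaf_rect ax' ax az.
Qed.

Lemma glue_refl x : glue x x. Proof. by left. Qed.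

Lemma glue_sym x y : glue x y -> glue y x.
Proof. by move=> [->|[a [b [ab ax ay]]]]; [left|right; exists a, b]. Qed.

Lemma glue_trans x y z : glue x y -> glue y z -> glue x z.
Proof.
move=> [->//|[a [b [ab ax ay]]]] [<-|[c [e [ce cy cz]]]]; right; first by exists a, b.
by exists c, e; split=> //; exact: gap_sub ab ce ay cy ax.
Qed.

Lemma glue_rho g x y : glue x y -> glue (rho g x) (rho g y).
Proof.
have gapr a b z : gap a b z -> gap (rho g a) (rho g b) (rho g z).
  by move=> [/(leaf_rho g)|/(leaf_rho g)]; [left|right].
move=> [->|[a [b [ab ax ay]]]]; [by left|right; exists (rho g a), (rho g b)].
by split; [exact: leaf_rho|exact: gapr|exact: gapr].
Qed.

Lemma glue_leaf a b : leaf a b -> glue a b.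
Proof. by move=> ab; right; exists a, b; split=> //; [left|right]. Qed.

Lemma end_stab x y g : leaf x y \/ leaf y x -> (forall n, rho (g n) x = x) -> ~ unc g.
Proof.
have key b f u v (g' : nat -> G) : tm_line u v ->
    (forall n, rho (g' n) (rho f (E b v)) = rho f (E b v)) -> ~ unc g'.
  move=> Suv gx ug; apply: (Kfin (g := fun n => (f^-1 * g' n * f)%g)).
    by move=> n; apply: E_stab Suv (gx n).
  have injf : injective (fun h => f^-1 * h * f)%g by move=> h h' /mulIg/mulgI.
  exact: (unc_inj injf ug).
move=> [[f [u [v [Suv -> _]]]]|[f [u [v [Suv _ ->]]]]]; last exact: key Suv.
exact: key (tm_line_sym Suv).
Qed.

(** A class has at most two points on each side, so along the ultrafilter the images of [x] would be
    constant, and quotients of the [g n] would be unboundedly many elements fixing an end. *)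
Lemma glue_fin x y g : x <> y -> glue x y -> unc g -> ~ forall n, glue x (rho (g n) x).
Proof.
move=> xy [//|[a [b [ab ax _]]]] ug gx.
have [z xz] : exists z, leaf x z \/ leaf z x by case: ax; [exists b; left|exists a; right].
have ncst t : ~ \forall n \near ufil, rho (g n) x = t.
  move=> gt; have [N Nt] := ufil_ex gt.
  pose h n := if pselect (rho (g n) x = t) is left _ then ((g N)^-1 * g n)%g else 1%g.
  apply: (end_stab (g := h) xz).
    move=> n; rewrite /h; case: pselect => [E0|]; last by rewrite hact1.
    by rewrite hactM E0 -Nt rhoK.
  move=> r; apply: filterS2 gt (ug (g N * r)%g) => n gn; rewrite /h; case: pselect => // _.
  by move=> + E0; apply; rewrite -E0 mulVKg.
have gapE n : gap a b (rho (g n) x).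
  case: (gx n) => [<-//|[c [e [ce cx cg]]]]; exact: gap_sub ce ab cx ax cg.
have fin : \forall n \near ufil, rho (g n) x <> a /\ rho (g n) x <> b.
  by apply: filterI; exact: ufil_not.
have [lf|lf] := ufil_or (filterS (fun n _ => gapE n) (ufil_ge 0)).
  have [N [Nb [Na _]]] := ufil_ex (filterI lf fin).
  apply: (ncst (rho (g N) x)); apply: filterS2 lf fin => n nb [na _].
  by apply: leaf_two_t ab nb Nb _ _; apply: nesym.
have [N [Na [_ Nb]]] := ufil_ex (filterI lf fin).
apply: (ncst (rho (g N) x)); apply: filterS2 lf fin => n na [_ nb].
by apply: leaf_two_f ab na Na _ _; apply: nesym.
Qed.

End Lamination.

(** The last field expresses, without cardinals, that a point with a nontrivial class is brought
    back to its class by finitely many elements only. *)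
Record gluing {G : groupType} {R : realType} {X : metricType R} (rho : homeo_action G X)
    (eqv : X -> X -> Prop) : Prop := Gluing {
  eqv_refl : forall x, eqv x x;
  eqv_sym : forall x y, eqv x y -> eqv y x;
  eqv_trans : forall x y z, eqv x y -> eqv y z -> eqv x z;
  eqv_rho : forall g x y, eqv x y -> eqv (rho g x) (rho g y);
  eqv_closed : forall (u v : nat -> X) x y, ucv u x -> ucv v y ->
    (\forall n \near ufil, eqv (u n) (v n)) -> eqv x y;
  eqv_fin : forall x y g, x <> y -> eqv x y -> unc g -> ~ forall n, eqv x (rho (g n) x) }.

Section GlueClosed.
Context {G : groupType} {R : realType} {X : metricType R} (rho : homeo_action G X).
Hypothesis X_compact : compact [set: X].
Variables (s : bool -> G) (E : bool -> bits -> X) (K : set G).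
Hypothesis Et : forall c v, E true (scons c v) = rho (s c) (E true v).
Hypothesis Ef : forall c v, E false (scons c v) = rho (s c)^-1%g (E false v).
Hypothesis Em : forall g u v, rho g (E true v) <> E false u.
Hypothesis KE : forall k b v, K k -> rho k (E b v) = E b v.
Hypothesis Ks : forall k c, K k -> (k * s c = s c * k)%g.
Hypothesis Kfin : forall g : nat -> G, (forall n, K (g n)) -> ~ unc g.
Hypothesis tail : forall b g v v', recurrent v -> rho g (E b v) = E b v' ->
  exists k j kappa, let sb c := if b then s c else (s c)^-1%g in
  [/\ (g * wd sb v k = wd sb v' j * kappa)%g, sdrop k v = sdrop j v' & K kappa].
Local Notation leaf := (leaf rho E).
Hypothesis leaf_closed : forall (u v : nat -> X) x y, (forall n, leaf (u n) (v n)) ->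
  ucv u x -> ucv v y -> x <> y -> leaf x y.

Lemma glue_gluing : gluing rho (glue rho E).
Proof.
split.
- exact: glue_refl.
- exact: glue_sym.
- exact: (glue_trans Et Ef Em KE Ks tail).
- exact: glue_rho.
(* Leaves degenerate only to points, which the diagonal absorbs. *)
- have lim (u v : nat -> X) x y : (\forall n \near ufil, leaf (u n) (v n)) ->
      ucv u x -> ucv v y -> glue rho E x y.
    move=> uv cu cv; have [->|xy] := pselect (x = y); first exact: glue_refl.
    have [N uvN] := ufil_ex uv; apply: glue_leaf.
    pose m n := if pselect (leaf (u n) (v n)) is left _ then n else N.
    apply: (leaf_closed (u := u \o m) (v := v \o m)) => //.
    + by move=> n; rewrite /= /m; case: pselect.
    + by apply: ucv_eq cu; apply: filterS uv => n uvn; rewrite /= /m; case: pselect.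
    + by apply: ucv_eq cv; apply: filterS uv => n uvn; rewrite /= /m; case: pselect.
  have trans := glue_trans Et Ef Em KE Ks tail.
  move=> u v x y cu cv /ufil_or[uv|uv]; first by left; exact: ucv_uniq (ucv_eq uv cu) cv.
  have /choice[ab abP] n : exists ab : X * X,
      (exists a b, [/\ leaf a b, gap rho E a b (u n) & gap rho E a b (v n)]) ->
      [/\ leaf ab.1 ab.2, gap rho E ab.1 ab.2 (u n) & gap rho E ab.1 ab.2 (v n)].
    have [[a [b H]]|] := pselect (exists a b, [/\ leaf a b, gap rho E a b (u n) & gap rho E a b
        (v n)]).
      by exists (a, b).
    by exists (u n, u n).
  have [a ca] := ucv_ex X_compact (fun n => (ab n).1).
  have [b cb] := ucv_ex X_compact (fun n => (ab n).2).
  have lab : \forall n \near ufil, leaf (ab n).1 (ab n).2.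
    by apply: filterS uv => n /abP[].
  have gab := lim _ _ _ _ lab ca cb.
  have side w z : ucv w z -> (\forall n \near ufil, gap rho E (ab n).1 (ab n).2 (w n)) ->
      glue rho E z b.
    move=> cw /ufil_or[H|H]; first exact: lim H cw cb.
    by apply: trans gab; apply: glue_sym; exact: lim H ca cw.
  apply: (trans _ b); first by apply: side cu _; apply: filterS uv => n /abP[].
  by apply: glue_sym; apply: side cv _; apply: filterS uv => n /abP[].
- exact: (glue_fin Et Ef Em KE Ks Kfin tail).
Qed.

End GlueClosed.

(** * Existence of the gluing *)

Section Existence.
Context {G : groupType} {R : realType} {X : metricType R}.
Variable rho : homeo_action G X.
Hypothesis X_compact : compact [set: X].
Hypothesis ca : convergence_action rho.
Hypothesis ne : non_elementary rho.
Local Notation lox := (lox rho).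

Lemma lox_family n : exists (h : nat -> G) (Q : nat -> bool -> X),
  (forall i, (i < n)%N -> lox (h i) (Q i false) (Q i true)) /\
  forall i j f b c, (i < j < n)%N -> rho f (Q i b) <> Q j c.
Proof.
elim: n => [|n [h [Q [hl hQ]]]].
  have [h [M [P _]]] := lox_ex X_compact ca ne.
  by exists (fun=> h), (fun _ _ => M); split=> // i j f b c; rewrite ltn0 andbF.
pose s := [seq Q i true | i <- iota 0 n] ++ [seq Q i false | i <- iota 0 n].
have Qs i b : (i < n)%N -> Q i b \in s.
  move=> i_n; rewrite mem_cat; apply/orP.
  by case: b; [left|right]; apply/mapP; exists i; rewrite ?mem_iota.
have [|k [M [P [kl kMP]]]] := @lox_new _ _ _ _ X_compact ca ne s.
  move=> q; rewrite mem_cat => /orP[|] /mapP[i]; rewrite mem_iota add0n => /hl il ->.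
    by exists (h i), (Q i false).
  by exists (h i)^-1%g, (Q i true); exact: lox_inv.
exists (fun i => if i == n then k else h i),
  (fun i b => if i == n then if b then P else M else Q i b); split.
  move=> i; rewrite ltnS leq_eqVlt; case: eqP => //= _; exact: hl.
move=> i j f b c => /andP[ij]; rewrite ltnS leq_eqVlt => jn.
have i_n : (i < n)%N by case/orP: jn => [/eqP <-|/(ltn_trans ij)].
rewrite (ltn_eqF i_n); case/orP: jn => [/eqP ->|jn].
  by rewrite eqxx; case: (c); have [] := kMP _ f (Qs i b i_n).
by rewrite (ltn_eqF jn); apply: hQ; rewrite ij jn.
Qed.

Lemma gluing_exists : exists eqv, [/\ gluing rho eqv,
  exists x y, x <> y /\ eqv x y &
  exists x y z, [/\ ~ eqv x y, ~ eqv y z & ~ eqv x z]].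
Proof.
have [h [Q [hl hQ]]] := lox_family 4.
pose H (x : letter) := if x.2 then h x.1 else (h x.1)^-1%g.
pose P (x : letter) := Q x.1 x.2.
have HV x : H (neg x) = (H x)^-1%g by case: x => c [] //=; rewrite /H /= invgK.
have H_lox x : lox (H x) (P (neg x)) (P x).
  by case: x => c []; rewrite /H /P /=; [exact: hl|apply: (lox_inv X_compact); exact: hl].
have P_orbit f x y : rho f (P x) = P y -> x.1 = y.1.
  move=> E; apply: val_inj => /=; have [xy|yx|//] := ltngtP x.1 y.1.
    by case: (hQ x.1 y.1 f x.2 y.2) => //; rewrite xy /=.
  case: (hQ y.1 x.1 f^-1%g y.2 x.2); first by rewrite yx /=.
  by rewrite -/(P y) -E rhoK.
have P_inj : injective P.
  move=> x y E; have := P_orbit 1%g x y; rewrite hact1 => /(_ E) xy.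
  have := lox_neq (hl x.1 (ltn_ord _)); move: E xy; case: x y => [c b] [c' b'] /= + E.
  by rewrite -{}E /P /=; case: b b' => -[] //= ->.
have [r [z0 [r0 rP rz]]] := small_radius X_compact ca ne P_inj.
have [N0 N0P] := pow_exists X_compact H_lox r0.
have [N1 [N01 N1P]] := align_exists X_compact ca ne HV H_lox P_inj r0 rP rz N0P P_orbit.
have [m m0 mP] := commute_all X_compact ca ne H_lox P_inj.
(* Divisible by [m] for the commutations and at least [N1] for alignment and ping-pong. *)
pose N := (m * N1.+1)%N.
have NN1 : (N1 <= N)%N by rewrite /N; nia.
have NN : (N0 <= N)%N by exact: leq_trans NN1.
have N_comm k x y xy kx ky := mP k x y xy kx ky N (dvdn_mulr _ (dvdnn m)).
have N_align s t g := N1P N s t g NN1.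
pose E := E rho H P r z0 N; pose K := fixall rho P; pose sl := sl H N.
have Et c v : E true (scons c v) = rho (sl c) (E true v).
  exact: (E_true X_compact ca ne HV r0 rP rz N0P NN).
have Ef c v : E false (scons c v) = rho (sl c)^-1%g (E false v).
  exact: (E_false X_compact ca ne HV r0 rP rz N0P NN).
have Em g u v : rho g (E true v) <> E false u by apply: (E_mixed r0 P_orbit NN N_align).
have KE k b v : K k -> rho k (E b v) = E b v.
  exact: (fixall_E X_compact ca ne HV r0 rP rz N0P NN N_comm).
have Ks k c : K k -> (k * sl c = sl c * k)%g by exact: fixall_rw.
have oneq b c : (b < 4)%N -> (c < 4)%N -> b <> c -> P (inord b : 'I_4, true) <> P (inord c :
    'I_4, true).
  move=> b4 c4 bc /P_inj[] /(congr1 val); rewrite /= !inordK//.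
have Kfin (g : nat -> G) : (forall n, K (g n)) -> ~ unc g.
  move=> gK; apply: (fix3_not_unc X_compact ca (oneq 0%N 1%N isT isT _) (oneq 1%N 2%N isT isT _)
      (oneq 0%N 2%N isT isT _)) => //;
  by apply: filterS (ufil_ge 0) => n _; apply: gK.
have tail b g v v' : recurrent v -> rho g (E b v) = E b v' ->
  exists k j kappa, let sb c := if b then sl c else (sl c)^-1%g in
  [/\ (g * wd sb v k = wd sb v' j * kappa)%g, sdrop k v = sdrop j v' & K kappa].
  have WE w k : W H N b w k = wd (fun c => if b then sl c else (sl c)^-1%g) w k.
    elim: k w => [//|k IH] w; rewrite W_S IH /=; congr (_ * _)%g.
    by case: (b); [rewrite W_true1|rewrite W_false1].
  move=> rv /(E_tail X_compact ca ne H_lox r0 rP N0P P_orbit NN N_align N_comm rv).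
  by move=> [k [j [kap]]]; rewrite !WE => ?; exists k, j, kap.
have leaf_closed (u v : nat -> X) x y : (forall n, leaf rho E (u n) (v n)) ->
    ucv u x -> ucv v y -> x <> y -> leaf rho E x y.
  move=> uv cu cv xy.
  have /choice[p pP] n : exists p : line,
      [/\ tm_line (lu p) (lv p), em rho H P r z0 N p = u n & ep rho H P r z0 N p = v n].
    by have [f [a [b [Sab -> ->]]]] := uv n; exists (Line f a b).
  have := line_closed X_compact ca ne HV r0 rP rz N0P P_orbit NN N_align (S := tm_line) (p := p).
  move=> /(_ x y) [].
  - by move=> q; exact: tm_line_fwd.
  - by move=> q; exact: tm_line_bwd.
  - exact: tm_line_closed.
  - by move=> n; have [] := pP n.
  - by apply: ucv_eq cu; apply: filterS (ufil_ge 0) => n _; have [_ ->] := pP n.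
  - by apply: ucv_eq cv; apply: filterS (ufil_ge 0) => n _; have [_ _ ->] := pP n.
  - exact: xy.
  - by move=> [g a b] [Sab <- <-]; exists g, a, b.
exists (glue rho E); split.
- exact: (glue_gluing X_compact Et Ef Em KE Ks Kfin tail leaf_closed).
- exists (E false (tm_ray false)), (E true (tm_ray false)); split.
    by move=> /esym E0; apply: (@Em 1%g (tm_ray false) (tm_ray false)); rewrite hact1.
  apply: glue_leaf; exists 1%g, (tm_ray false), (tm_ray false); rewrite !hact1; split=> //.
  exact: tm_line_rays.
(* The ends [P x] have infinite stabilizers, so they are ends of no leaf and their classes are
   trivial. *)
- have nglue x y : P x <> P y -> ~ glue rho E (P x) (P y).
    move=> xy [//|[a [b [ab ax _]]]].
    have [z xz] : exists z, leaf rho E (P x) z \/ leaf rho E z (P x).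
      by case: ax; [exists b; left|exists a; right].
    apply: (end_stab Ks Kfin tail (g := fun n => (H x ^+ n)%g) xz).
      by move=> n; apply: rho_pow; exact: lox_att (H_lox x).
    by apply: inj_unc => i j; exact: (lox_pow_inj X_compact ca ne (H_lox x)).
  exists (P (inord 0, true)), (P (inord 1, true)), (P (inord 2, true)).
  by split; apply: nglue; apply: oneq.
Qed.
End Existence.

(** * Metric spaces from function families and quotients *)

Section SequentialCompactness.
Context {R : realType} {X : metricType R}.
Local Notation d := (@mdist R X).
Hypothesis lim_ex : forall u : nat -> X, exists l, ucv u l.

Lemma finite_net (e : R) : 0 < e -> exists s : seq X, forall x, exists2 y, y \in s & d y x < e.
Proof.
move=> e0; apply: contrapT => /forallNP ns.
have /choice[f fP] (s : seq X) : exists x, forall y, y \in s -> e <= d y x.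
  have /existsNP[x xP] := ns s; exists x => y ys; rewrite leNgt; apply/negP => yx.
  by apply: xP; exists y.
pose L := fix L i := if i is i'.+1 then f (L i') :: L i' else [::].
have inL i j : (i < j)%N -> f (L i) \in L j.
  elim: j => // j IH; rewrite ltnS leq_eqVlt => /orP[/eqP ->|/IH] /=.
    by rewrite inE eqxx.
  by rewrite inE => ->; rewrite orbT.
have [l /ucvP ul] := lim_ex (fun i => f (L i)).
have e2 : 0 < e / 2 by rewrite divr_gt0.
have [i li] := ufil_ex (ul _ e2).
have [j [lj ij]] := ufil_ex (filterI (ul _ e2) (ufil_ge i.+1)).
have := fP _ _ (inL i j ij); rewrite leNgt => /negP; apply.
by have := metric_triangle (f (L i)) l (f (L j)); rewrite (metric_sym _ l); lra.
Qed.

Lemma ultra_seq (F : set_system X) (s : seq X) (Q : X -> set X) : UltraFilter F ->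
  F [set x | exists2 y, y \in s & Q y x] -> exists y, F (Q y).
Proof.
move=> FU; elim: s => [|y s IH] Fs.
  by have [x [y]] := @filter_ex _ F _ _ Fs.
have [Fy|nFy] := in_ultra_setVsetC (Q y) FU; first by exists y.
apply: IH; apply: filterS2 Fs nFy => x [z]; rewrite inE => /orP[/eqP -> //|zs Qz _].
by exists z.
Qed.

(** Limits of sequences along one ultrafilter already give compactness: an arbitrary ultrafilter
    charges a ball of each radius of a finite net, and the centres have a limit. *)
Lemma lim_compact : compact [set: X].
Proof.
rewrite compact_ultra => F FU _.
have /choice[u uP] n : exists y, F [set x | d y x < n.+1%:R^-1].
  have n0 : (0 : R) < n.+1%:R^-1 by rewrite invr_gt0.
  have [s sP] := finite_net n0; apply: (ultra_seq (s := s)).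
  by apply: filterS filterT => x _; exact: sP.
have [l /ucvP ul] := lim_ex u; exists l; split=> //.
apply/fcvgrPdist_lt => e e0; have e2 : 0 < e / 2 by rewrite divr_gt0.
have [N [lN]] := ufil_ex (filterI (ul _ e2) (ufil_ge (Num.truncn (e / 2)^-1))).
move=> Ne; apply: filterS (uP N) => x ux.
rewrite (le_lt_trans (metric_triangle _ (u N) _))// [ltRHS]splitr ltrD//.
rewrite (lt_le_trans ux)// -[leRHS]invrK lef_pV2 ?posrE ?invr_gt0//.
by rewrite ltW// (lt_le_trans (truncnS_gt _))// ler_nat ltnS.
Qed.

End SequentialCompactness.

Section RealLimits.
Context {R : realType}.
Implicit Types (u v : nat -> R) (l : R).

Definition rcv u l := forall e : R, 0 < e -> \forall n \near ufil, `|l - u n| < e.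

Lemma rcv_cst l : rcv (fun=> l) l.
Proof. by move=> e e0; apply: filterS filterT => n _; rewrite subrr normr0. Qed.

Lemma rcv_eq u v l : (\forall n \near ufil, u n = v n) -> rcv u l -> rcv v l.
Proof. by move=> uv ul e /ul; apply: filterS2 uv => n ->. Qed.

Lemma rcv_ge u l a : (\forall n \near ufil, a <= u n) -> rcv u l -> a <= l.
Proof.
move=> au ul; apply/ler_addgt0Pl => e e0.
have [n [an]] := ufil_ex (filterI au (ul _ e0)).
by rewrite ltr_norml => /andP[+ _]; lra.
Qed.

Lemma rcv_le u l a : (\forall n \near ufil, u n <= a) -> rcv u l -> l <= a.
Proof.
move=> au ul; apply/ler_addgt0Pl => e e0.
have [n [an]] := ufil_ex (filterI au (ul _ e0)).
by rewrite ltr_norml => /andP[_ +]; lra.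
Qed.

Lemma rcv_uniq u l l' : rcv u l -> rcv u l' -> l = l'.
Proof.
move=> ul ul'; apply/eqP; rewrite -subr_eq0 -normr_eq0 eq_le normr_ge0 andbT.
apply/ler_addgt0Pl => e e0; have e2 : 0 < e / 2 by rewrite divr_gt0.
have [n [ln l'n]] := ufil_ex (filterI (ul _ e2) (ul' _ e2)).
have -> : l - l' = (l - u n) - (l' - u n) by lra.
by rewrite addr0 (le_trans (ler_normB _ _))// [leRHS]splitr lerD// ltW.
Qed.

Lemma rcv_ex u a b : (\forall n \near ufil, a <= u n <= b) -> exists l, rcv u l.
Proof.
move=> uab; have := @segment_compact R a b.
move=> /(_ _ (fmap_proper_filter u ultra_proper) uab)[l [_ ul]].
exists l => e e0; apply: contrapT => /ufil_not nu.
have /(_ [set x | ~ `|l - x| < e] (ball l e)) := ul.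
by case=> [||x [/= + ]] //; exact: nbhsx_ballx.
Qed.

End RealLimits.

Lemma cvg_rcv (R : realType) (X : metricType R) (f : X -> R) (u : nat -> X) l :
  {for l, continuous f} -> ucv u l -> rcv (f \o u) (f l).
Proof.
move=> fl [ul] e e0; have : nbhs (f l) (ball (f l) e) by exact: nbhsx_ballx.
by move=> /fl/ul fu; near=> n; near: n; exact: fu.
Unshelve. all: by end_near.
Qed.

Section FamilyMetric.
Context {R : realType} {T : Type}.
Variables (d0 : T -> T -> R) (phi : nat -> T -> R).
Hypothesis d0xx : forall x, d0 x x = 0.
Hypothesis d0_sym : forall x y, d0 x y = d0 y x.
Hypothesis d0_tri : forall x y z, d0 x z <= d0 x y + d0 y z.
Hypothesis phi01 : forall k x, 0 <= phi k x <= 1.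
Hypothesis sep : forall x y, d0 x y = 0 -> (forall k, phi k x = phi k y) -> x = y.

Let gap k x y : R := `|phi k x - phi k y| / k.+1%:R.
Let wd (x y : T) : R := sup (range (fun k => gap k x y)).

Let gap_ge0 k x y : 0 <= gap k x y.
Proof. by rewrite divr_ge0. Qed.

Let gap_le k x y : gap k x y <= k.+1%:R^-1.
Proof.
rewrite ler_pdivrMr ?mulVf// ler_norml.
by have /andP[? ?] := phi01 k x; have /andP[? ?] := phi01 k y; apply/andP; split; lra.
Qed.

Let gap_le_wd k x y : gap k x y <= wd x y.
Proof.
apply: ub_le_sup; last by exists k.
exists 1 => _ [j _ <-]; rewrite (le_trans (gap_le _ _ _))//.
by rewrite invf_le1// ler1n.
Qed.

Let wd_le x y e : (forall k, gap k x y <= e) -> wd x y <= e.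
Proof.
by move=> H; apply: ge_sup => [|_ [k _ <-]//]; exists (gap 0 x y); exists 0%N.
Qed.

Let d0_ge0 x y : 0 <= d0 x y.
Proof. by have := d0_tri x y x; rewrite d0xx (d0_sym y x); lra. Qed.

Let wd_ge0 x y : 0 <= wd x y.
Proof. exact: le_trans (gap_le_wd 0 x y). Qed.

Definition family_space : Type := T.
Let dT (x y : family_space) : R := d0 x y + wd x y.

Let dTxx x : dT x x = 0.
Proof.
apply/eqP; rewrite /dT d0xx add0r eq_le wd_ge0 andbT; apply: wd_le => k.
by rewrite /gap subrr normr0 mul0r.
Qed.

Let dT_pos x y : dT x y = 0 -> x = y.
Proof.
move=> H; have := d0_ge0 x y; have := wd_ge0 x y; rewrite /dT in H => w0 h0.
apply: sep => [|k]; first by apply/eqP; rewrite eq_le h0 andbT; lra.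
have := gap_le_wd k x y; have := gap_ge0 k x y => g0 gw.
have /eqP : gap k x y = 0 by apply/eqP; rewrite eq_le g0 andbT; lra.
by rewrite mulf_eq0 invr_eq0 pnatr_eq0 orbF normr_eq0 subr_eq0 => /eqP.
Qed.

Let dT_sym x y : dT x y = dT y x.
Proof.
have gE : (fun k => gap k x y) = (fun k => gap k y x).
  by apply/funext => k; rewrite /gap distrC.
by rewrite /dT d0_sym /wd gE.
Qed.

Let dT_tri y x z : dT x z <= dT x y + dT y z.
Proof.
rewrite /dT addrACA lerD//; apply: wd_le => k.
rewrite (@le_trans _ _ (gap k x y + gap k y z))//; last by rewrite lerD.
rewrite /gap -mulrDl ler_pM2r ?invr_gt0//.
by rewrite (le_trans _ (ler_normD _ _))// subrKA.
Qed.

HB.instance Definition _ := gen_eqMixin family_space.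
HB.instance Definition _ := gen_choiceMixin family_space.
HB.instance Definition _ := isMetric.Build R family_space dTxx dT_pos dT_sym dT_tri.

(** A supremum weighted by [k.+1%:R^-1] replaces a series: all but finitely many terms are uniformly
    small, so convergence means convergence for [d0] and for each [phi k]. *)
Lemma family_metric : exists (M : metricType R) (f : T -> M) (g : M -> T),
  [/\ cancel f g, cancel g f &
   forall u l, ucv (f \o u) (f l) <-> rcv (fun n => d0 l (u n)) 0 /\
     forall k, rcv (phi k \o u) (phi k l)].
Proof.
exists family_space, id, id; split=> // u l; split.
  move=> /ucvP ul; split=> [e e0|k e e0].
    apply: filterS (ul e e0) => n H; rewrite sub0r normrN ger0_norm//.
    by rewrite (le_lt_trans _ H)// lerDl.
  have e1 : 0 < e / k.+1%:R by rewrite divr_gt0.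
  apply: filterS (ul _ e1) => n H.
  have : gap k l (u n) < e / k.+1%:R.
    rewrite (le_lt_trans _ H)// (le_trans (gap_le_wd _ _ _))// /mdist/= /dT lerDr.
    exact: d0_ge0.
  by rewrite /gap ltr_pM2r ?invr_gt0.
move=> [ul phil]; apply/ucvP => e e0.
have e4 : 0 < e / 4 by rewrite divr_gt0.
pose N := Num.truncn (e / 4)^-1.
have near_phi : \forall n \near ufil, forall k, (k <= N)%N -> `|phi k l - phi k (u n)| < e / 4.
  elim: N => [|N IH].
    by apply: filterS (phil 0%N _ e4) => n ? k; rewrite leqn0 => /eqP ->.
  apply: filterS2 IH (phil N.+1 _ e4) => n IH H k.
  by rewrite leq_eqVlt => /orP[/eqP -> //|]; rewrite ltnS; exact: IH.
apply: filterS2 near_phi (ul _ e4) => n pn; rewrite sub0r normrN ger0_norm// => dn.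
have : wd l (u n) <= e / 4.
  apply: wd_le => k; have [kN|Nk] := leqP k N.
    rewrite ler_pdivrMr// (le_trans (ltW (pn k kN)))// ler_peMr ?(ltW e4)//.
    by rewrite ler1n.
  rewrite (le_trans (gap_le _ _ _))// -[leRHS]invrK lef_pV2 ?posrE ?invr_gt0//.
  rewrite (le_trans (ltW (truncnS_gt _)))// ler_nat -/N; lia.
by rewrite /mdist/= /dT; lra.
Qed.

End FamilyMetric.

Lemma inv_small (R : realType) (c e : R) : 0 < e -> \forall n \near ufil, c / n.+1%:R < e.
Proof.
move=> e0; apply: filterS (ufil_ge (Num.truncn (c / e))) => n nN.
rewrite ltr_pdivrMr// mulrC -ltr_pdivrMr//.
by rewrite (lt_le_trans (truncnS_gt _))// ler_nat ltnS.
Qed.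

Lemma ucv_dist (R : realType) (X : metricType R) (c : R) (u : nat -> X) l :
  (forall n, mdist l (u n) <= c / n.+1%:R) -> ucv u l.
Proof.
move=> H; apply/ucvP => e /(inv_small c); apply: filterS => n.
exact: le_lt_trans (H n).
Qed.

Lemma closed_ucv (R : realType) (X : metricType R) (A : set X) :
  (forall u l, ucv u l -> (forall n, A (u n)) -> A l) -> closed A.
Proof.
move=> HA l lA.
have /choice[u uP] n : exists x, A x /\ mdist l x < n.+1%:R^-1.
  have n0 : (0 : R) < n.+1%:R^-1 by rewrite invr_gt0.
  by have [x []] := lA _ (nbhsx_ballx l _ n0); rewrite ballEmdist => ? ?; exists x.
apply: (HA u) => [|n]; last exact: (uP n).1.
by apply: (ucv_dist (c := 1)) => n; rewrite mul1r ltW//; exact: (uP n).2.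
Qed.

Section SaturatedTopology.
Context {R : realType} {X : metricType R} (eqv : X -> X -> Prop).

(** The idle [let] makes the alias depend on [eqv], so that each relation has its own topology on
    the points of [X], the one pulled back from the quotient. *)
Definition saturated : Type := let _ := eqv in X.
Definition sat_open (A : set saturated) :=
  open (A : set X) /\ forall x y, eqv x y -> A x -> A y.

Let sat_openT : sat_open setT.
Proof. by split=> //; exact: openT. Qed.

Let sat_openI A B : sat_open A -> sat_open B -> sat_open (A `&` B).
Proof.
move=> [oA sA] [oB sB]; split; first exact: openI.
by move=> x y xy [Ax Bx]; split; [exact: sA xy Ax|exact: sB xy Bx].
Qed.

Let sat_open_bigU (I : Type) (f : I -> set saturated) :
  (forall i, sat_open (f i)) -> sat_open (\bigcup_i f i).
Proof.
move=> H; split; first by apply: bigcup_open => i _; exact: (H i).1.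
by move=> x y xy [i _ fx]; exists i => //; exact: (H i).2 xy fx.
Qed.

HB.instance Definition _ := Choice.on saturated.
HB.instance Definition _ :=
  isOpenTopological.Build saturated sat_openT sat_openI sat_open_bigU.

Lemma saturated_openE (A : set saturated) : open A = sat_open A.
Proof. by []. Qed.

End SaturatedTopology.

Section Quotient.
Context {R : realType} {X : metricType R}.
Hypothesis X_compact : compact [set: X].
Variable eqv : X -> X -> Prop.
Hypothesis eqv_refl : forall x, eqv x x.
Hypothesis eqv_sym : forall x y, eqv x y -> eqv y x.
Hypothesis eqv_trans : forall x y z, eqv x y -> eqv y z -> eqv x z.
Hypothesis eqv_closed : forall (u v : nat -> X) x y, ucv u x -> ucv v y ->
  (\forall n \near ufil, eqv (u n) (v n)) -> eqv x y.
Local Notation d := (@mdist R X).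
Local Notation sat := (saturated eqv).

Lemma saturated_closed (A : set X) : closed (A : set sat) <->
  closed A /\ forall x y, eqv x y -> A x -> A y.
Proof.
rewrite -openC saturated_openE /sat_open openC; split=> -[? H]; split=> // x y xy.
  by move=> Ax; apply: contrapT => nAy; exact: (H _ _ (eqv_sym xy) nAy).
by move=> nAx Ay; apply: nAx; exact: (H _ _ (eqv_sym xy) Ay).
Qed.

Lemma saturated_normal : normal_space sat.
Proof.
apply/(@normal_openP R) => A B /saturated_closed[cA sA] /saturated_closed[cB sB] AB.
(* The points whose whole class is close to [C]: a saturated set, open because the relation is
   closed and the space compact. *)
pose U (C : set X) n : set X := [set z | forall w, eqv z w ->
  exists2 a, C a & d w a < n.+1%:R^-1].
have oU C n : open (U C n : set sat).
  rewrite saturated_openE; split; last by move=> x y xy Ux w yw; apply: Ux; exact: eqv_trans yw.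
  rewrite -closedC; apply: closed_ucv => u l ul nU.
  have /choice[w wP] k : exists w, eqv (u k) w /\ forall a, C a -> n.+1%:R^-1 <= d w a.
    have /existsNP[w /not_implyP[uw H]] := nU k; exists w; split=> // a Ca.
    by rewrite leNgt; apply/negP => wa; apply: H; exists a.
  have [w0 ww0] := ucv_ex X_compact w; move=> /(_ w0)[].
    by apply: eqv_closed ul ww0 _; apply: filterS (ufil_ge 0) => k _; exact: (wP k).1.
  move=> a Ca; rewrite ltNge => /negP; apply.
  apply: (ucv_ge ww0 (ucv_cst a)); apply: filterS (ufil_ge 0) => k _.
  exact: (wP k).2.
have sU C n : (forall x y, eqv x y -> C x -> C y) -> C `<=` U C n.
  by move=> sC x Cx w xw; exists w; [exact: sC xw Cx|rewrite mdistxx invr_gt0].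
suff [n UU] : exists n, U A n `&` U B n = set0.
  by exists (U A n), (U B n); split=> //; [exact: sU|exact: sU].
apply: contrapT => /forallNP ne.
have /choice[z zP] n : exists z, U A n z /\ U B n z by apply/set0P/eqP; exact: ne.
have [l zl] := ucv_ex X_compact z.
have lim C : closed C -> (forall n, U C n (z n)) -> C l.
  move=> cC Uz; have /choice[a aP] n : exists a, C a /\ d (z n) a < n.+1%:R^-1.
    by have [a ? ?] := Uz n (z n) (eqv_refl _); exists a.
  apply: (ucv_closed (u := a) cC); first by apply: filterS (ufil_ge 0) => n _; exact: (aP n).1.
  apply/ucvP => e e0; have e2 : 0 < e / 2 by rewrite divr_gt0.
  move/ucvP: zl => /(_ _ e2) zl; apply: filterS2 zl (inv_small 1 e2) => n zl.
  have [_] := aP n; have := metric_triangle l (z n) (a n); rewrite mul1r.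
  by move: (n.+1%:R^-1) => t ? ? ?; lra.
have : (A `&` B) l.
  by split; apply: lim => // n; [exact: (zP n).1|exact: (zP n).2].
by rewrite AB.
Qed.

Definition invariant_fun (f : X -> R) := [/\ forall x, 0 <= f x <= 1,
  forall x y, eqv x y -> f x = f y & forall u l, ucv u l -> rcv (f \o u) (f l)].

Lemma invariant_separation x y : ~ eqv x y ->
  exists f, [/\ invariant_fun f, f x = 0 & f y = 1].
Proof.
move=> xy.
have cls z : closed (eqv z : set sat).
  apply/saturated_closed; split; last by move=> a b ab za; exact: eqv_trans ab.
  apply: closed_ucv => u l ul zu; apply: eqv_closed (ucv_cst z) ul _.
  by apply: filterS (ufil_ge 0) => n _.
have dis : (eqv x `&` eqv y : set sat) = set0.
  rewrite -subset0 => z [xz yz]; apply: xy; apply: eqv_trans xz _; exact: eqv_sym.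
have sep := (@normal_separatorP R sat).1 saturated_normal _ _ (cls x) (cls y) dis.
have [f [fc f01 f0 f1]] := (@uniform_separatorP sat R _ _).1 sep.
exists f; split; last 2 first.
- by apply: f0; exists x => //; exact: eqv_refl.
- by apply: f1; exists y => //; exact: eqv_refl.
split.
- move=> z; have : `[0, 1]%classic (f z) by apply: f01; exists z.
  by rewrite /= in_itv.
- move=> a b ab; apply: contrapT => fab.
  have oV : open (f @^-1` (~` [set f a]) : set sat).
    apply: open_comp; first by move=> z _; exact: fc.
    by rewrite openC; apply: accessible_closed_set1; exact/hausdorff_accessible/Rhausdorff.
  by have [_ /(_ b a (eqv_sym ab))] := oV; apply; [exact/nesym|].
- move=> u l ul; apply: cvg_rcv ul => B /fc; rewrite nbhsE => -[V [oV Vl] VB].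
  by apply: (@filterS X (nbhs (l : X)) _ V) => //; apply: open_nbhs_nbhs; split=> //; exact: oV.1.
Qed.

Lemma separation_nbhs f x y : invariant_fun f -> f x = 0 -> f y = 1 -> exists n,
  (forall z, d x z < 2 / n.+1%:R -> f z < 3^-1) /\
  (forall z, d y z < 2 / n.+1%:R -> 2 / 3 < f z).
Proof.
move=> [_ _ fc] fx fy; apply: contrapT => /forallNP H.
have {}H n : (exists z, d x z < 2 / n.+1%:R /\ 3^-1 <= f z) \/
    (exists z, d y z < 2 / n.+1%:R /\ f z <= 2 / 3).
  have /not_andP[/existsNP[z /not_implyP[xz /negP fz]]|/existsNP[z /not_implyP[yz /negP fz]]] :=
      H n.
    by left; exists z; rewrite leNgt.
  by right; exists z; rewrite leNgt.
have [N|N] := ufil_or (filterS (fun n _ => H n) (ufil_ge 0)).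
  have /choice[u uP] n : exists z, d x z <= 2 / n.+1%:R /\
      ((exists z, d x z < 2 / n.+1%:R /\ 3^-1 <= f z) -> 3^-1 <= f z).
    have [[z [xz fz]]|nz] := pselect (exists z, d x z < 2 / n.+1%:R /\ 3^-1 <= f z).
      by exists z; split=> //; exact: ltW.
    by exists x; rewrite mdistxx divr_ge0.
  have ux := ucv_dist (fun n => (uP n).1).
  have : 3^-1 <= f x by apply: rcv_ge (fc _ _ ux); apply: filterS N => n /(uP n).2.
  by rewrite fx; lra.
have /choice[u uP] n : exists z, d y z <= 2 / n.+1%:R /\
    ((exists z, d y z < 2 / n.+1%:R /\ f z <= 2 / 3) -> f z <= 2 / 3).
  have [[z [xz fz]]|nz] := pselect (exists z, d y z < 2 / n.+1%:R /\ f z <= 2 / 3).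
    by exists z; split=> //; exact: ltW.
  by exists y; rewrite mdistxx divr_ge0.
have uy := ucv_dist (fun n => (uP n).1).
have : f y <= 2 / 3 by apply: rcv_le (fc _ _ uy); apply: filterS N => n /(uP n).2.
by rewrite fy; lra.
Qed.

(** Countably many functions suffice: for each scale and each pair of net points, one function
    separating the two balls is kept if there is any, and the zero function otherwise. *)
Lemma invariant_family (x0 : X) : exists phi : nat -> X -> R,
  (forall k, invariant_fun (phi k)) /\
  forall x y, (forall k, phi k x = phi k y) -> eqv x y.
Proof.
have /choice[s sP] n : exists s : seq X, forall x, exists2 y, y \in s & d y x < n.+1%:R^-1.
  by apply: finite_net; [exact: ucv_ex|rewrite invr_gt0].
pose sepa (f : X -> R) (k : nat * (nat * nat)) :=
  (forall z, d (nth x0 (s k.1) k.2.1) z < k.1.+1%:R^-1 -> f z < 3^-1) /\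
  (forall z, d (nth x0 (s k.1) k.2.2) z < k.1.+1%:R^-1 -> 2 / 3 < f z).
have /choice[F FP] k : exists f, invariant_fun f /\
    ((exists f', invariant_fun f' /\ sepa f' k) -> sepa f k).
  have [[f [fi fs]]|nf] := pselect (exists f', invariant_fun f' /\ sepa f' k).
    by exists f.
  exists (fun=> 0); split=> //; split=> //; first by move=> z; rewrite lexx ler01.
  by move=> u l _; exact: rcv_cst.
exists (fun m => if unpickle m is Some k then F k else fun=> 0); split.
  move=> m; case: unpickle => [k|]; first exact: (FP k).1.
  split=> //; first by move=> z; rewrite lexx ler01.
  by move=> u l _; exact: rcv_cst.
move=> x y xy; apply: contrapT => nxy.
have [f [fi fx fy]] := invariant_separation nxy.
have [n [xn yn]] := separation_nbhs fi fx fy.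
have [a aS ax] := sP n x; have [b bS bY] := sP n y.
pose k := (n, (index a (s n), index b (s n))).
have : sepa (F k) k.
  apply: (FP k).2; exists f; split=> //.
  have tri p q z : d p q < n.+1%:R^-1 -> d p z < n.+1%:R^-1 -> d q z < 2 / n.+1%:R.
    have := metric_triangle q p z; rewrite (metric_sym q p) mulrDl mul1r.
    by move: (n.+1%:R^-1) => t; lra.
  by split=> z /=; rewrite nth_index// => az; [apply: xn|apply: yn]; apply: tri az.
have := xy (pickle k); rewrite pickleK => E0 [/= sa sb].
have := sa x; have := sb y; rewrite !nth_index// => /(_ bY) + /(_ ax).
by rewrite E0; lra.
Qed.

Theorem quotient_metric (x0 : X) : exists (Q : metricType R) (pi : X -> Q),
  [/\ forall q, exists x, pi x = q, forall x y, pi x = pi y <-> eqv x y &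
   forall u l, ucv u l -> ucv (pi \o u) (pi l)].
Proof.
have [phi [phi_inv phi_sep]] := invariant_family x0.
pose T := {A : set X | exists x, A = eqv x}.
have eqvE x y : eqv x y -> eqv x = eqv y.
  move=> xy; apply/funext => z; apply/propext; split; first exact: eqv_trans (eqv_sym xy).
  exact: eqv_trans xy.
pose rep (A : T) : X := sval (cid (proj2_sig A)).
have repE (A : T) : proj1_sig A = eqv (rep A) by rewrite /rep; case: cid.
pose psi k (A : T) := phi k (rep A).
have eq_T (A B : T) : proj1_sig A = proj1_sig B -> A = B by move=> ?; exact: eq_sig_hprop.
have [|||||M [f [g [fK gK ucvM]]]] := @family_metric R T (fun _ _ => 0) psi => //.
- by move=> k A; have [H _ _] := phi_inv k; exact: H.
- by move=> A B _ H; apply: eq_T; rewrite !repE; apply: eqvE; apply: phi_sep => k; exact: H.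
pose cls x : T := exist _ (eqv x) (ex_intro _ x erefl).
have repcls x : eqv x (rep (cls x)).
  have := repE (cls x); rewrite /= => E0.
  by have := eqv_refl (rep (cls x)); rewrite -E0.
have psiE k x : psi k (cls x) = phi k x.
  by have [_ H _] := phi_inv k; apply: H; exact: eqv_sym.
exists M, (f \o cls); split.
- move=> q; exists (rep (g q)); rewrite /= -[RHS]gK; congr f.
  by apply: eq_T; rewrite /= -repE.
- move=> x y; split=> [/(can_inj fK)/(congr1 (@proj1_sig _ _))/= E0|xy /=].
    by rewrite E0; exact: eqv_refl.
  by congr f; apply: eq_T; exact: eqvE.
- move=> u l ul; apply/(ucvM (cls \o u) (cls l)); split; first exact: rcv_cst.
  move=> k; rewrite psiE; apply: rcv_eq; last by have [_ _] := phi_inv k; apply; exact: ul.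
  by apply: filterS (ufil_ge 0) => n _; rewrite /= psiE.
Qed.

End Quotient.

(** * The pinched quotient *)

Section Factor.
Context {G : groupType} {R : realType} {X Y : metricType R}.
Variables (rho : homeo_action G X) (rhoY : homeo_action G Y) (f : X -> Y).
Hypothesis X_compact : compact [set: X].
Hypothesis X_min : minimal_nonelementary_convergence_action rho.
Hypothesis f_surj : forall y, exists x, f x = y.
Hypothesis f_ucv : forall u l, ucv u l -> ucv (f \o u) (f l).
Hypothesis f_rho : forall g x, f (rho g x) = rhoY g (f x).

Lemma factor_ucoll g a b : ucoll rho g a b -> ucoll rhoY g (f a) (f b).
Proof.
move=> gab y l yl lfa; have /choice[x xP] n := f_surj (y n).
have [m xm] := ucv_ex X_compact x.
have fm : f m = l.
  by apply: ucv_uniq (f_ucv xm) _; apply: ucv_eq yl; apply: filterS (ufil_ge 0) => n _ /=.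
have ma : m <> a by move=> ma; apply: lfa; rewrite -fm ma.
apply: ucv_eq (f_ucv (gab _ _ xm ma)); apply: filterS (ufil_ge 0) => n _ /=.
by rewrite f_rho xP.
Qed.

Lemma factor_minimal : (`I_3 #<= [set: Y])%card ->
  minimal_nonelementary_convergence_action rhoY.
Proof.
have [ca ne mi] := X_min; move=> Y3.
have Yc : compact [set: Y].
  apply: lim_compact => u; have /choice[v vP] n := f_surj (u n).
  have [l vl] := ucv_ex X_compact v; exists (f l).
  by apply: ucv_eq (f_ucv vl); apply: filterS (ufil_ge 0) => n _ /=.
have lim : limit_set rhoY = setT.
  apply/seteqP; split=> // y _; have [x <-] := f_surj y.
  have : limit_set rho x by rewrite mi.
  move=> /(limit_setP rho X_compact)[g [ug [a gax]]].
  by apply/(limit_setP rhoY Yc); exists g; split=> //; exists (f a); exact: factor_ucoll.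
split=> //; last by rewrite /non_elementary lim.
apply: convergence_actionI => // g ug; have [a [b gab]] := ucoll_ex X_compact ca ne ug.
by exists (f a), (f b); exact: factor_ucoll.
Qed.

End Factor.

Section QuotientAction.
Context {G : groupType} {R : realType} {X : metricType R}.
Variable rho : homeo_action G X.
Hypothesis X_compact : compact [set: X].
Hypothesis X_min : minimal_nonelementary_convergence_action rho.
Variable eqv : X -> X -> Prop.
Hypothesis X_eqv : gluing rho eqv.
Hypothesis eqv3 : exists x y z, [/\ ~ eqv x y, ~ eqv y z & ~ eqv x z].

Theorem quotient_action : exists (Q : metricType R) (rhoQ : homeo_action G Q) (pi : X -> Q),
  [/\ compact [set: Q], minimal_nonelementary_convergence_action rhoQ,
    forall q, exists x, pi x = q, forall x y, pi x = pi y <-> eqv x y &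
    (forall u l, ucv u l -> ucv (pi \o u) (pi l)) /\
    forall g x, pi (rho g x) = rhoQ g (pi x)].
Proof.
have [er es et erho ec _] := X_eqv; have [x0 [y0 [z0 [xy yz xz]]]] := eqv3.
have [Q [pi [pi_surj pi_eqv pi_ucv]]] := quotient_metric X_compact er es et ec x0.
have /choice[rep repP] := pi_surj.
pose a g q := pi (rho g (rep q)).
have aE g x : a g (pi x) = pi (rho g x).
  by apply/pi_eqv; apply: erho; apply/pi_eqv; rewrite repP.
have a1 q : a 1%g q = q by rewrite -[q in LHS]repP aE hact1 repP.
have aM g h q : a (g * h)%g q = a g (a h q).
  by rewrite -[q]repP !aE hactM.
have ac g : continuous (a g).
  apply: ucv_continuousP => u l ul; have [m um] := ucv_ex X_compact (rep \o u).
  have lm : pi m = l.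
    apply: ucv_uniq (pi_ucv _ _ um) _; apply: ucv_eq ul.
    by apply: filterS (ufil_ge 0) => n _ /=; rewrite repP.
  rewrite -lm aE; apply: ucv_eq (pi_ucv _ _ (ucv_rho rho g um)).
  by apply: filterS (ufil_ge 0) => n _.
pose rhoQ := HomeoAction a1 aM ac.
exists Q, rhoQ, pi; split=> //.
- apply: lim_compact => u; have [l ul] := ucv_ex X_compact (rep \o u); exists (pi l).
  by apply: ucv_eq (pi_ucv _ _ ul); apply: filterS (ufil_ge 0) => n _ /=.
- apply: (factor_minimal X_compact X_min pi_surj pi_ucv) => //.
  apply/card_le3P; exists (pi x0), (pi y0), (pi z0); split=> //.
  by split=> /pi_eqv.
- by split=> // g x; rewrite -aE.
Qed.

End QuotientAction.

Section Pinched.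
Context {G : groupType} {R : realType} {X Q : metricType R}.
Variables (rho : homeo_action G X) (rhoQ : homeo_action G Q) (pi : X -> Q).
Hypothesis X_compact : compact [set: X].
Hypothesis Q_compact : compact [set: Q].
Hypothesis X_min : minimal_nonelementary_convergence_action rho.
Hypothesis Q_min : minimal_nonelementary_convergence_action rhoQ.
Hypothesis pi_surj : forall q, exists x, pi x = q.
Hypothesis pi_ucv : forall u l, ucv u l -> ucv (pi \o u) (pi l).
Hypothesis pi_rho : forall g x, pi (rho g x) = rhoQ g (pi x).

(* One of the two preimages of the point avoids the repelling point. *)
Lemma pinched_cvg x y g a b : x <> y -> pi x = pi y -> unc g -> ucoll rhoQ g a b ->
  ucv (fun n => rhoQ (g n) (pi x)) b.
Proof.
move=> xy pxy ug gab; have [ca ne _] := X_min; have [caQ neQ _] := Q_min.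
have [a' [b' gab']] := ucoll_ex X_compact ca ne ug.
have gab2 := factor_ucoll X_compact pi_surj pi_ucv pi_rho gab'.
have [_ ->] := ucoll_uniq Q_compact caQ neQ gab gab2.
have key z : z <> a' -> pi z = pi x -> ucv (fun n => rhoQ (g n) (pi x)) (pi b').
  move=> za zx; apply: ucv_eq (pi_ucv (gab' _ _ (ucv_cst z) za)).
  by apply: filterS (ufil_ge 0) => n _ /=; rewrite pi_rho zx.
have [xa|xa] := pselect (x = a'); last exact: key xa _.
by apply: (key y) => // ya; apply: xy; rewrite xa ya.
Qed.

End Pinched.

(** * Slowly oscillating functions *)

Section SlowWave.
Context {R : realType}.

(** A triangle wave with one period on each dyadic block: it rises from 0 to 1 and comes back, so it
    never settles while its increments tend to 0. *)
Definition wave (n : nat) : R :=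
  let s := trunc_log 2 n in 2 * (minn (n - 2 ^ s) (2 ^ s.+1 - n))%:R / (2 ^ s)%:R.

Lemma wave_block s n : (2 ^ s <= n < 2 ^ s.+1)%N ->
  wave n = 2 * (minn (n - 2 ^ s) (2 ^ s.+1 - n))%:R / (2 ^ s)%:R.
Proof. by move=> sn; rewrite /wave (trunc_log_eq _ sn). Qed.

Lemma log_block n : (0 < n)%N -> (2 ^ trunc_log 2 n <= n < 2 ^ (trunc_log 2 n).+1)%N.
Proof. by move=> n0; apply: trunc_log_bounds. Qed.

Lemma wave01 n : 0 <= wave n <= 1.
Proof.
case: n => [|n]; first by rewrite /wave trunc_log0 expn0 min0n mulr0 mul0r lexx ler01.
have /andP[a b] := log_block (ltn0Sn n); rewrite /wave.
move: (trunc_log _ _) a b => s a b; rewrite divr_ge0 ?mulr_ge0//=.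
have p0 : (0 : R) < (2 ^ s)%:R by rewrite ltr0n expn_gt0.
rewrite ler_pdivrMr// mul1r -natrM ler_nat; rewrite expnS in b *; lia.
Qed.

Lemma wave_step s n : (2 ^ s <= n < 2 ^ s.+1)%N -> `|wave n.+1 - wave n| <= 2 / (2 ^ s)%:R.
Proof.
move=> sn; have p0 : (0 : R) < (2 ^ s)%:R by rewrite ltr0n expn_gt0.
rewrite (wave_block sn); have [sn1|] := ltnP n.+1 (2 ^ s.+1).
  rewrite (@wave_block s) ?sn1 ?andbT; last by case/andP: sn => /leqW.
  rewrite -mulrBl -mulrBr normrM normrM gtr0_norm// (gtr0_norm (x := _^-1)) ?invr_gt0//.
  rewrite ler_pM2r ?invr_gt0// -[leRHS]mulr1 ler_pM2l// ler_norml.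
  case/andP: sn => a b.
  have : (minn (n.+1 - 2 ^ s) (2 ^ s.+1 - n.+1) <= (minn (n - 2 ^ s) (2 ^ s.+1 - n)).+1)%N by lia.
  have : (minn (n - 2 ^ s) (2 ^ s.+1 - n) <= (minn (n.+1 - 2 ^ s) (2 ^ s.+1 - n.+1)).+1)%N by lia.
  by rewrite -!(ler_nat R) -!natr1 => ? ?; apply/andP; split; lra.
case/andP: sn => a b n1; have E : n.+1 = (2 ^ s.+1)%N by lia.
rewrite E (@wave_block s.+1); last by rewrite leqnn/= ltn_exp2l.
rewrite subnn min0n mulr0 mul0r sub0r normrN ger0_norm ?divr_ge0 ?mulr_ge0//.
rewrite ler_pM2r ?invr_gt0// -[leRHS]mulr1 ler_pM2l// -[1]/(1%:R) ler_nat; lia.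
Qed.

Lemma wave_slow (e : R) : 0 < e -> exists N, forall n, (N <= n)%N -> `|wave n.+1 - wave n| < e.
Proof.
move=> e0; pose S := Num.truncn (2 / e).
exists (2 ^ S)%N => n Sn; have n0 : (0 < n)%N by apply: leq_trans Sn; rewrite expn_gt0.
have b := log_block n0; apply: le_lt_trans (wave_step b) _.
have : (S <= trunc_log 2 n)%N by rewrite -(ltnS S) -(ltn_exp2l _ _ (isT : (1 < 2)%N)); lia.
move: (trunc_log _ _) => s Ss.
rewrite ltr_pdivrMr ?ltr0n ?expn_gt0// mulrC -ltr_pdivrMr//.
rewrite (lt_le_trans (truncnS_gt _))// ler_nat -/S.
by apply: leq_ltn_trans Ss _; exact: ltn_expl.
Qed.

Lemma wave0 j : wave (2 ^ j) = 0.
Proof.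
by rewrite (@wave_block j) ?leqnn/= ?ltn_exp2l// subnn min0n mulr0 mul0r.
Qed.

Lemma wave1 j : wave (3 * 2 ^ j) = 1.
Proof.
rewrite (@wave_block j.+1); last by rewrite !expnS; have := expn_gt0 2 j; lia.
have -> : minn (3 * 2 ^ j - 2 ^ j.+1) (2 ^ j.+2 - 3 * 2 ^ j) = (2 ^ j)%N.
  by rewrite !expnS; have := expn_gt0 2 j; lia.
by rewrite expnS natrM mulfV// mulf_neq0// pnatr_eq0 -lt0n expn_gt0.
Qed.

Variable r : nat -> R.
Hypothesis r0 : forall n, 0 < r n.
Hypothesis r2 : forall n, r n.+1 <= r n / 2.

Lemma radius_lt n : r n.+1 < r n.
Proof. by have := r2 n; have := r0 n; lra. Qed.

Lemma radius_le m n : (m <= n)%N -> r n <= r m.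
Proof.
elim: n => [|n IH]; first by rewrite leqn0 => /eqP ->.
rewrite leq_eqVlt => /orP[/eqP <-//|]; rewrite ltnS => /IH.
by apply: le_trans; rewrite ltW// radius_lt.
Qed.

Lemma radius_small (e : R) : 0 < e -> exists N, r N < e.
Proof.
move=> e0; have H n : r n * n.+1%:R <= r 0%N.
  elim: n => [|n IH]; first by rewrite mulr1.
  apply: le_trans IH; have := r2 n; have := r0 n => h0 h2.
  apply: le_trans (_ : r n / 2 * n.+2%:R <= _); first by rewrite ler_pM2r.
  rewrite -mulrA ler_pM2l// mulrC ler_pdivrMr//.
  by rewrite -natrM ler_nat; lia.
exists (Num.truncn (r 0%N / e)).
have := truncnS_gt (r 0%N / e); have := H (Num.truncn (r 0%N / e)).
move: (Num.truncn _) => n Hn; rewrite ltr_pdivrMr// => lt.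
have n0 : (0 : R) < n.+1%:R by [].
by rewrite -(ltr_pM2r n0) (le_lt_trans Hn)// mulrC.
Qed.

Definition clamp n t : R := Num.min 1 (Num.max 0 ((r n - t) / (r n - r n.+1))).

Lemma clamp_ge n t : r n <= t -> clamp n t = 0.
Proof.
move=> nt; have rn := radius_lt n; rewrite /clamp max_l ?min_r ?ler01//.
by rewrite pmulr_lle0 ?subr_le0// invr_gt0 subr_gt0.
Qed.

Lemma clamp_le n t : t <= r n.+1 -> clamp n t = 1.
Proof.
move=> nt; have rn := radius_lt n; rewrite /clamp min_l// le_max; apply/orP; right.
by rewrite ler_pdivlMr ?subr_gt0// mul1r lerB.
Qed.

Lemma clamp01 n t : 0 <= clamp n t <= 1.
Proof. by rewrite /clamp le_min ler01 le_max lexx /= ge_min lexx. Qed.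

Lemma clamp_lip n t t' : `|clamp n t - clamp n t'| <= `|t - t'| / (r n - r n.+1).
Proof.
have rn := radius_lt n; have q0 : 0 < (r n - r n.+1)^-1 by rewrite invr_gt0 subr_gt0.
have -> : `|t - t'| / (r n - r n.+1) = `|(r n - t) / (r n - r n.+1) - (r n - t') / (r n - r n.+1)|.
  by rewrite -mulrBl normrM (gtr0_norm q0); congr (_ * _); rewrite distrC; congr `|_|; lra.
rewrite /clamp; move: (_ / _) (_ / _) => a b.
clear rn q0; wlog ab : a b / a <= b => [H|].
  have [/H//|/ltW/H] := leP a b; by rewrite distrC (distrC b a).
rewrite ?(distrC a b) (ger0_norm (x := b - a)) ?subr_ge0//.
have val (x : R) : [\/ x <= 0 /\ Num.min 1 (Num.max 0 x) = 0, 0 <= x <= 1 /\ Num.min 1 (Num.max 0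
    x) = x |
    1 <= x /\ Num.min 1 (Num.max 0 x) = 1].
  have [x0|x0] := leP x 0; first by apply: Or31; split=> //; rewrite min_r// ler01.
  have [x1|x1] := leP x 1; first by apply: Or32; rewrite (ltW x0).
  by apply: Or33; rewrite (ltW x1).
rewrite ler_norml.
case: (val a) => -[? ->]; case: (val b) => -[? ->]; apply/andP; split; lra.
Qed.

(** A telescoping sum of increments of the wave, each switched on between the radii [r n] and
    [r n.+1]; below [r N] it equals [wave N]. *)
Definition profileN N t : R := \sum_(n < N) (wave n.+1 - wave n) * clamp n t.

Lemma profileN_stable N M t : r N <= t -> (N <= M)%N -> profileN M t = profileN N t.
Proof.
move=> Nt; elim: M => [|M IH]; first by rewrite leqn0 => /eqP ->.
rewrite leq_eqVlt => /orP[/eqP -> //|]; rewrite ltnS => NM.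
rewrite /profileN big_ord_recr /= -/(profileN M t) IH// clamp_ge ?mulr0 ?addr0//.
exact: le_trans (radius_le NM) Nt.
Qed.

Lemma wave00 : wave 0 = 0.
Proof. by rewrite /wave trunc_log0 expn0 min0n mulr0 mul0r. Qed.

Lemma profileN_wave N t : t <= r N -> profileN N t = wave N.
Proof.
elim: N => [|N IH] tN; first by rewrite /profileN big_ord0 wave00.
rewrite /profileN big_ord_recr /= -/(profileN N t) IH ?clamp_le//; last first.
  by rewrite (le_trans tN)// ltW// radius_lt.
by rewrite mulr1 addrC subrK.
Qed.

Lemma profileN_lip N : exists K : R, forall t t', `|profileN N t - profileN N t'| <= K * `|t - t'|.
Proof.
elim: N => [|N [K IH]].
  by exists 0 => t t'; rewrite /profileN !big_ord0 subrr normr0 mul0r.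
exists (K + `|wave N.+1 - wave N| / (r N - r N.+1)) => t t'.
rewrite /profileN !big_ord_recr /= -!/(profileN N _) opprD addrACA -mulrBr.
rewrite (le_trans (ler_normD _ _))// [leRHS]mulrDl lerD// normrM -mulrA ler_wpM2l//.
by rewrite mulrC clamp_lip.
Qed.

Definition profile_index (t : R) : nat :=
  if pselect (exists N, r N <= t) is left E then sval (cid E) else 0%N.

Definition profile (t : R) : R := profileN (profile_index t) t.

Lemma profileE N t : r N <= t -> profile t = profileN N t.
Proof.
move=> Nt; rewrite /profile /profile_index; case: pselect => [E|]; last by case; exists N.
case: cid => M /= Mt; have [NM|/ltnW MN] := leqP N M; first exact: profileN_stable.
by apply/esym; exact: profileN_stable.
Qed.

Lemma level_ex t : 0 < t -> t <= r 0%N -> exists n, r n.+1 < t <= r n.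
Proof.
move=> /radius_small/ex_min_prop[n [nt nmin]] t0; case: n nt nmin => [|n] nt nmin.
  by move: nt; rewrite ltNge t0.
by exists n; rewrite nt leNgt; apply/negP => /nmin; rewrite ltnn.
Qed.

Lemma profile_level n t : r n.+1 < t <= r n ->
  profile t = wave n + (wave n.+1 - wave n) * clamp n t.
Proof.
case/andP=> /ltW nt tn; rewrite (profileE nt) /profileN big_ord_recr /=.
by rewrite -/(profileN n t) profileN_wave.
Qed.

Lemma profile_near n t : r n.+1 < t <= r n -> `|profile t - wave n| <= `|wave n.+1 - wave n|.
Proof.
have /andP[c0 c1] := clamp01 n t.
move=> /profile_level ->; rewrite addrC addKr normrM (ger0_norm c0).
by rewrite ler_piMr.
Qed.

Lemma profile01 t : 0 < t -> 0 <= profile t <= 1.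
Proof.
move=> t0; have [tr|/ltW rt] := leP t (r 0%N); last first.
  by rewrite (profileE rt) /profileN big_ord0 lexx ler01.
have [n /profile_level ->] := level_ex t0 tr.
have /andP[c0 c1] := clamp01 n t; have /andP[a0 a1] := wave01 n.
have /andP[b0 b1] := wave01 n.+1.
have -> : wave n + (wave n.+1 - wave n) * clamp n t =
   wave n * (1 - clamp n t) + wave n.+1 * clamp n t by lra.
apply/andP; split; first by rewrite addr_ge0// mulr_ge0// subr_ge0.
have : wave n * (1 - clamp n t) <= 1 - clamp n t by rewrite ler_piMl// subr_ge0.
have : wave n.+1 * clamp n t <= clamp n t by rewrite ler_piMl.
by lra.
Qed.

Lemma profile_rcv u l : 0 < l -> rcv u l -> rcv (fun n => profile (u n)) (profile l).
Proof.
move=> l0 ul e e0; have l2 : 0 < l / 2 by rewrite divr_gt0.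
have [N Nl] := radius_small l2; have [K KP] := profileN_lip N.
have K0 : 0 < `|K| + 1 by rewrite ltr_wpDl.
have eK : 0 < e / (`|K| + 1) by rewrite divr_gt0.
apply: filterS2 (ul _ l2) (ul _ eK) => n un; rewrite ltr_pdivlMr// => unK.
have ln : r N <= u n by move: un; rewrite ltr_norml => /andP[_]; lra.
rewrite (@profileE N (u n))// (@profileE N l); last by lra.
rewrite (le_lt_trans (KP _ _))// (le_lt_trans _ unK)// mulrC ler_wpM2l//.
by rewrite (le_trans (ler_norm K))// lerDl.
Qed.

(** The two distances to the point are separated by a full shell. When they are not, their levels
    differ by at most one, and [profile] takes close values there. *)
Definition far t t' := exists m, t <= r m.+1 /\ r m <= t'.

Lemma profile_slow (t t' : nat -> R) : rcv t 0 -> rcv t' 0 ->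
  (\forall n \near ufil, 0 < t n) -> (\forall n \near ufil, 0 < t' n) ->
  (\forall n \near ufil, ~ far (t n) (t' n) /\ ~ far (t' n) (t n)) ->
  rcv (fun n => profile (t n) - profile (t' n)) 0.
Proof.
move=> tl tl' tp tp' tf e e0; have e4 : 0 < e / 4 by rewrite divr_gt0.
have [N NP] := wave_slow e4.
have lev u : rcv u 0 -> (\forall n \near ufil, 0 < u n) ->
    \forall k \near ufil, exists n, r n.+1 < u k <= r n /\ (N <= n)%N.
  move=> ul up; apply: filterS2 up (ul _ (r0 N.+1)) => k uk.
  rewrite sub0r normrN gtr0_norm// => ur.
  have [n nP] := level_ex uk (le_trans (ltW ur) (radius_le (leq0n _))).
  exists n; split=> //; rewrite leqNgt; apply/negP => /leqW nN.
  by case/andP: nP => [+ _]; rewrite ltNge (le_trans (ltW ur))// radius_le.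
apply: filterS3 tf (lev _ tl tp) (lev _ tl' tp') => k [f1 f2] [n [nP Nn]] [m [mP Nm]].
have np := le_lt_trans (profile_near nP) (NP _ Nn).
have mp := le_lt_trans (profile_near mP) (NP _ Nm).
have nm : (n <= m.+1)%N.
  rewrite leqNgt; apply/negP => mn; apply: f1; exists m.+1.
  by case/andP: nP => [_ tn]; case/andP: mP => [/ltW ? _]; rewrite (le_trans tn)// radius_le.
have mn : (m <= n.+1)%N.
  rewrite leqNgt; apply/negP => nm'; apply: f2; exists n.+1.
  by case/andP: mP => [_ tn]; case/andP: nP => [/ltW ? _]; rewrite (le_trans tn)// radius_le.
have ww : `|wave n - wave m| < e / 4.
  have [->|nm'] := eqVneq n m; first by rewrite subrr normr0.
  have [E|E] : (n = m.+1 \/ m = n.+1)%N by lia.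
    by rewrite E NP.
  by rewrite E distrC NP.
move: np mp ww; rewrite sub0r normrN !ltr_norml => /andP[? ?] /andP[? ?] /andP[? ?].
by apply/andP; split; lra.
Qed.

End SlowWave.

(** * A slow function near a rigid point *)

Section SlowFunction.
Context {G : groupType} {R : realType} {X : metricType R}.
Variable rho : homeo_action G X.
Hypothesis X_compact : compact [set: X].
Hypothesis ca : convergence_action rho.
Hypothesis ne : non_elementary rho.
Local Notation d := (@mdist R X).
Variable p : X.
Hypothesis p_cvg : forall g a b, unc g -> ucoll rho g a b -> ucv (fun n => rho (g n) p) b.
Hypothesis p_stab : forall g, unc g -> ~ \forall n \near ufil, rho (g n) p = p.

Lemma p_ucoll g : unc g -> exists a b, [/\ ucoll rho g a b, ucv (fun n => rho (g n) p) b &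
  ucv (fun n => rho (g n)^-1%g p) a].
Proof.
move=> ug; have [a [b gab]] := ucoll_ex X_compact ca ne ug; exists a, b; split=> //.
  exact: p_cvg gab.
apply: (p_cvg (g := fun n => (g n)^-1%g)) (ucollV X_compact gab).
exact: unc_inj (@invg_inj G) ug.
Qed.

Lemma p_nfix g h : unc g -> \forall n \near ufil, rho (g n) p <> rho h p.
Proof.
move=> ug; apply: ufil_not => gp.
have uh : unc (fun n => h^-1 * g n)%g by exact: unc_inj (mulgI h^-1)%g ug.
by apply: (p_stab uh); apply: filterS gp => n gn; rewrite hactM gn rhoK.
Qed.

Lemma ucv_rhoV g (u : nat -> X) l : ucv (fun n => rho g (u n)) (rho g l) -> ucv u l.
Proof.
move=> /(ucv_rho rho g^-1%g); rewrite rhoK; apply: ucv_eq.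
by apply: filterS (ufil_ge 0) => n _; rewrite rhoK.
Qed.

Lemma ucv_inv (u : nat -> X) l : (forall n, d l (u n) <= n.+1%:R^-1) -> ucv u l.
Proof. by move=> H; apply: (ucv_dist (c := 1)) => n; rewrite mul1r. Qed.

Lemma ucv_inv_near (u : nat -> X) l : (\forall n \near ufil, d l (u n) <= n.+1%:R^-1) -> ucv u l.
Proof.
move=> H; apply/ucvP => e /(inv_small 1); apply: filterS2 H => n un.
by rewrite mul1r; exact: le_lt_trans.
Qed.

(** If [g] ran through unboundedly many elements, a point away from [g^-1 p] would be attracted to
    the limit of [g p], against the second distance bound. So only one [g] matters along the
    ultrafilter, and for it each of the four ways of approaching [p] contradicts a distance bound or
    the fact that [g] moves [p]. *)
Lemma soft_radius (e : R) : 0 < e -> exists2 t : R, 0 < t & forall g x, rho g p <> p ->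
  e <= d x (rho g^-1%g p) -> e <= d (rho g x) (rho g p) ->
  [/\ t < d p x, t < d p (rho g^-1%g p), t < d p (rho g x) & t < d p (rho g p)].
Proof.
move=> e0; apply: contrapT => /forall2NP H.
have /choice[gx gxP] n : exists gx : G * X, [/\ rho gx.1 p <> p,
    e <= d gx.2 (rho gx.1^-1%g p), e <= d (rho gx.1 gx.2) (rho gx.1 p) &
    [\/ d p gx.2 <= n.+1%:R^-1, d p (rho gx.1^-1%g p) <= n.+1%:R^-1,
      d p (rho gx.1 gx.2) <= n.+1%:R^-1 | d p (rho gx.1 p) <= n.+1%:R^-1]].
  have n0 : (0 : R) < n.+1%:R^-1 by rewrite invr_gt0.
  apply: contrapT => nE; have [//|] := H n.+1%:R^-1; apply.
  move=> g x gp xg ggx; split; rewrite ltNge; apply/negP => c; apply: nE;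
    exists (g, x); split=> //=.
  - exact: Or41.
  - exact: Or42.
  - exact: Or43.
  - exact: Or44.
pose g n := (gx n).1; pose x n := (gx n).2.
have [gp xg ggx near4] : [/\ forall n, rho (g n) p <> p,
    forall n, e <= d (x n) (rho (g n)^-1%g p), forall n, e <= d (rho (g n) (x n)) (rho (g n) p) &
    forall n, [\/ d p (x n) <= n.+1%:R^-1, d p (rho (g n)^-1%g p) <= n.+1%:R^-1,
      d p (rho (g n) (x n)) <= n.+1%:R^-1 | d p (rho (g n) p) <= n.+1%:R^-1]].
  by split=> n; have [] := gxP n.
have far_neq (u v : nat -> X) (l : X) : (forall n, e <= d (u n) (v n)) ->
    ucv u l -> ucv v l -> False.
  move=> uv ul vl; have : e <= d l l.
    by apply: (ucv_ge ul vl); apply: filterS (ufil_ge 0) => n _; exact: uv.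
  by rewrite mdistxx => /(lt_le_trans e0); rewrite ltxx.
have [ug|/not_unc[t gt]] := pselect (unc g).
  have [a [b [gab gb ga]]] := p_ucoll ug; have [l xl] := ucv_ex X_compact x.
  apply: (far_neq _ _ b ggx) => //; apply: (gab _ _ xl) => la.
  by apply: (far_neq _ _ a xg) => //; rewrite -la.
have tp : rho t p <> p by have [n <-] := ufil_ex gt; exact: gp.
have tVp : rho t^-1%g p <> p by move=> E; apply: tp; rewrite -[in LHS]E rhoVK.
have xg' : \forall n \near ufil, e <= d (x n) (rho t^-1%g p).
  by apply: filterS gt => n <-; exact: xg.
have ggx' : \forall n \near ufil, e <= d (rho t (x n)) (rho t p).
  by apply: filterS gt => n <-; exact: ggx.
have cst q : q <> p -> (\forall n \near ufil, d p q <= n.+1%:R^-1) -> False.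
  by move=> qp /ucv_inv_near/(ucv_uniq (ucv_cst q)).
have : \forall n \near ufil, (d p (x n) <= n.+1%:R^-1 \/ d p (rho t^-1%g p) <= n.+1%:R^-1) \/
   (d p (rho t (x n)) <= n.+1%:R^-1 \/ d p (rho t p) <= n.+1%:R^-1).
  by apply: filterS gt => n <-; case: (near4 n) => ?; [left; left|left; right|right; left|right;
      right].
move=> /ufil_or[] /ufil_or[].
- move=> /ucv_inv_near xp; have := ucv_ge (ucv_rho rho t xp) (ucv_cst (rho t p)) ggx'.
  by rewrite mdistxx => /(lt_le_trans e0); rewrite ltxx.
- exact: cst.
- move=> /ucv_inv_near xp.
  have xt : ucv x (rho t^-1%g p) by apply: (ucv_rhoV (g := t)); rewrite rhoVK.
  by have := ucv_ge xt (ucv_cst (rho t^-1%g p)) xg'; rewrite mdistxx => /(lt_le_trans e0);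
      rewrite ltxx.
- exact: cst.
Qed.

(** The stabilizer of [p] meets no unbounded sequence, so its elements are equicontinuous at [p]. *)
Lemma stab_radius (e : R) : 0 < e -> exists2 t : R, 0 < t & forall k x, rho k p = p ->
  d p x <= t -> d p (rho k x) < e.
Proof.
move=> e0; apply: contrapT => /forall2NP H.
have /choice[gx gxP] n : exists gx : G * X, [/\ rho gx.1 p = p,
    d p gx.2 <= n.+1%:R^-1 & e <= d p (rho gx.1 gx.2)].
  have n0 : (0 : R) < n.+1%:R^-1 by rewrite invr_gt0.
  apply: contrapT => nE; have [//|] := H n.+1%:R^-1; apply.
  move=> g x gp xp; rewrite ltNge; apply/negP => c; apply: nE.
  by exists (g, x).
have /not_unc[t gt] : ~ unc (fun n => (gx n).1).
  by move=> /p_stab; apply; apply: filterS (ufil_ge 0) => n _; have [] := gxP n.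
have xp : ucv (fun n => (gx n).2) p by apply: ucv_inv => n; have [] := gxP n.
have tp : rho t p = p by have [n <-] := ufil_ex gt; have [] := gxP n.
have : e <= d p (rho t p).
  by apply: (ucv_ge (ucv_cst p) (ucv_rho rho t xp)); apply: filterS gt => n <-; have [] := gxP n.
by rewrite tp mdistxx => /(lt_le_trans e0); rewrite ltxx.
Qed.

Variable y : nat -> X.
Hypothesis yp : ucv y p.
Hypothesis y_neq : forall n, y n <> p.

(** Each radius is chosen after the previous one, small enough for the two preceding lemmas and for
    a late term of [y] to fall in the shell between them; this makes [F] oscillate along [y]. *)
Lemma radii_ex : exists r : nat -> R, [/\ forall n, 0 < r n, forall n, r n.+1 <= r n / 2,
  forall m g x, rho g p <> p -> r m / 2 <= d x (rho g^-1%g p) ->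
    r m / 2 <= d (rho g x) (rho g p) ->
    [/\ r m.+1 < d p x, r m.+1 < d p (rho g^-1%g p), r m.+1 < d p (rho g x) &
       r m.+1 < d p (rho g p)],
  forall m k x, rho k p = p -> d p x <= r m.+1 -> d p (rho k x) < r m &
  forall n, exists2 k, (n <= k)%N & r n.+1 < d p (y k) <= r n].
Proof.
pose step n (t t' : R) := [/\ 0 < t', t' <= t / 2,
  forall g x, rho g p <> p -> t / 2 <= d x (rho g^-1%g p) -> t / 2 <= d (rho g x) (rho g p) ->
    [/\ t' < d p x, t' < d p (rho g^-1%g p), t' < d p (rho g x) & t' < d p (rho g p)],
  forall k x, rho k p = p -> d p x <= t' -> d p (rho k x) < t &
  exists2 k, (n <= k)%N & t' < d p (y k) <= t].
have /choice[f fP] (nt : nat * R) : exists t', 0 < nt.2 -> step nt.1 nt.2 t'.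
  case: nt => n t; have [t0|] := pselect (0 < t); last by exists 0.
  have t2 : 0 < t / 2 by rewrite divr_gt0.
  have [a a0 aP] := soft_radius t2; have [b b0 bP] := stab_radius t0.
  have [k [kt nk]] := ufil_ex (filterI (proj1 (ucvP _ _) yp _ t0) (ufil_ge n)).
  have y0 : 0 < d p (y k) by apply: mdist_gt0P; exact/nesym.
  have m0 : 0 < Num.min (t / 2) (Num.min a (Num.min b (d p (y k) / 2))).
    by rewrite !lt_min t2 a0 b0 divr_gt0.
  exists (Num.min (t / 2) (Num.min a (Num.min b (d p (y k) / 2)))) => _; split=> //=.
  - by rewrite ge_min lexx.
  - move=> g x gp xg ggx; have [h1 h2 h3 h4] := aP g x gp xg ggx.
    by split; rewrite !gt_min ?h1 ?h2 ?h3 ?h4 ?orbT.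
  - move=> h x hp; rewrite !le_min => /and4P[_ _ xb _]; exact: bP.
  - exists k => //; rewrite ltW// andbT !gt_min; apply/orP; right; apply/orP; right.
    by apply/orP; right; lra.
pose r := fix r n : R := if n is n'.+1 then f (n', r n') else 1.
have r0 n : 0 < r n.
  by elim: n => [|n IH] //=; have [] := fP (n, r n) IH.
by exists r; split=> // n; have [] := fP (n, r n) (r0 n).
Qed.

(** The third condition makes the limit values of [F] at [p] insensitive to the stabilizer. In the
    fourth, images of points that are not repelled acquire the same value of [F] as the image of
    [p]. The fifth treats a sequence that both repels from [p] and attracts to it: [F] cannot vary
    visibly both at the source and at the target. *)
Definition slow_function (F : X -> R) := [/\
  forall x, x <> p -> 0 <= F x <= 1,
  forall u l, l <> p -> ucv u l -> rcv (F \o u) (F l),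
  forall k u, rho k p = p -> ucv u p -> (\forall n \near ufil, u n <> p) ->
    rcv (fun n => F (rho k (u n)) - F (u n)) 0,
  forall g u a l, unc g -> ucv (fun n => rho (g n) p) p -> ucv (fun n => rho (g n)^-1%g p) a ->
    ucv u l -> l <> a -> rcv (fun n => F (rho (g n) (u n)) - F (rho (g n) p)) 0 &
  forall g u, unc g -> ucv (fun n => rho (g n) p) p -> ucv (fun n => rho (g n)^-1%g p) p ->
    ucv u p -> ucv (fun n => rho (g n) (u n)) p -> (\forall n \near ufil, u n <> p) ->
    (\forall n \near ufil, rho (g n) (u n) <> p) ->
    rcv (fun n => F (u n) - F (rho (g n)^-1%g p)) 0 \/
    rcv (fun n => F (rho (g n) (u n)) - F (rho (g n) p)) 0].

Lemma slow_function_ex : exists F, slow_function F /\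
  exists a b : nat -> nat, [/\ unb a, unb b, ucv (y \o a) p,
    rcv (fun n => F (y (a n))) 0 & rcv (fun n => F (y (b n))) 1].
Proof.
have [r [r0 r2 rs rk ry]] := radii_ex.
pose F x := profile r (d p x).
have dp0 x : x <> p -> 0 < d p x by move=> xp; apply: mdist_gt0P; exact/nesym.
have dcv u l : ucv u l -> rcv (fun n => d p (u n)) (d p l).
  move=> /ucvP ul e e0; apply: filterS (ul e e0) => n un; rewrite ltr_norml.
  have := metric_triangle p (u n) l; have := metric_triangle p l (u n).
  by rewrite (metric_sym (u n) l) => ? ?; apply/andP; split; lra.
have dcv0 u : ucv u p -> rcv (fun n => d p (u n)) 0 by move=> /dcv; rewrite mdistxx.
have slow u v : ucv u p -> ucv v p -> (\forall n \near ufil, u n <> p) ->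
    (\forall n \near ufil, v n <> p) ->
    (\forall n \near ufil, ~ far r (d p (u n)) (d p (v n)) /\ ~ far r (d p (v n)) (d p (u n))) ->
    rcv (fun n => F (u n) - F (v n)) 0.
  move=> up vp u_p v_p nf; apply: profile_slow => //; [exact: dcv0|exact: dcv0| |].
    by apply: filterS u_p => n; exact: dp0.
  by apply: filterS v_p => n; exact: dp0.
have gapd m a b : d p a <= r m.+1 -> r m <= d p b -> r m / 2 <= d a b /\ r m / 2 <= d b a.
  move=> pa pb; rewrite (metric_sym b a); have := metric_triangle p a b.
  by have := r2 m; lra.
have farP a b : ~ (~ far r (d p a) (d p b) /\ ~ far r (d p b) (d p a)) ->
    exists m, r m / 2 <= d a b /\ (d p a <= r m.+1 \/ d p b <= r m.+1) /\
      (r m <= d p a \/ r m <= d p b).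
  move=> /not_andP[/contrapT[m [pa pb]]|/contrapT[m [pb pa]]]; exists m.
    by have [? _] := gapd _ _ _ pa pb; split=> //; split; [left|right].
  by have [_ ?] := gapd _ _ _ pb pa; split=> //; split; [right|left].
have gfix g : unc g -> \forall n \near ufil, rho (g n) p <> p.
  by move=> ug; apply: filterS (p_nfix 1%g ug) => n; rewrite hact1.
have wP n x : r n.+1 < d p x <= r n -> `|F x - wave n| <= `|wave n.+1 - wave n| :> R.
  exact: profile_near.
have /choice[k kP] n : exists k, (n <= k)%N /\ r n.+1 < d p (y k) <= r n.
  by have [k ? ?] := ry n; exists k.
have wcv (m : nat -> nat) c : unb m -> (forall n, wave (m n) = c :> R) ->
    rcv (fun n => F (y (k (m n)))) c.
  move=> um mc e e0; have [N NP] := wave_slow e0.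
  apply: filterS (um N) => n /NP H; rewrite distrC -(mc n).
  exact: le_lt_trans (wP _ _ (kP _).2) H.
have ubk m : unb m -> unb (fun n => k (m n)).
  by move=> um N; apply: filterS (um N) => n /leq_trans; apply; exact: (kP _).1.
exists F; split; last first.
  (* The levels where the wave takes the values 0 and 1. *)
  exists (fun n => k (2 ^ n)%N), (fun n => k (3 * 2 ^ n)%N); split.
  - apply: ubk => N; apply: filterS (ufil_ge N) => n Nn.
    by rewrite (leq_trans Nn)// ltnW// ltn_expl.
  - apply: ubk => N; apply: filterS (ufil_ge N) => n Nn.
    by rewrite (leq_trans Nn)// (leq_trans (ltnW (ltn_expl n (isT : (1 < 2)%N))))//; lia.
  - apply/ucvP => e /(radius_small r0 r2)[N rN].
    apply: filterS (ufil_ge N) => n Nn; have /andP[_ kn] := (kP (2 ^ n)%N).2.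
    apply: le_lt_trans rN; apply: le_trans kn _; apply: (radius_le r0 r2).
    by rewrite (leq_trans Nn)// ltnW// ltn_expl.
  - apply: (wcv (fun n => 2 ^ n)%N) => [N|n]; last exact: wave0.
    by apply: filterS (ufil_ge N) => n Nn; rewrite (leq_trans Nn)// ltnW// ltn_expl.
  - apply: (wcv (fun n => 3 * 2 ^ n)%N) => [N|n]; last exact: wave1.
    apply: filterS (ufil_ge N) => n Nn.
    by rewrite (leq_trans Nn)// (leq_trans (ltnW (ltn_expl n (isT : (1 < 2)%N))))//; lia.
split.
- by move=> x /dp0; exact: profile01.
- by move=> u l /dp0 l0 /dcv; exact: profile_rcv.
- move=> h u hp up u_p.
  have hu : ucv (fun n => rho h (u n)) p by rewrite -hp; exact: ucv_rho.
  apply: slow => //.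
    by apply: filterS u_p => n un E; apply: un; apply: (rho_inj (rho := rho) (g := h)); rewrite E
        hp.
  apply: filterS (ufil_ge 0) => n _; split=> -[m [m1 m2]].
    have hVp : rho h^-1%g p = p by rewrite -[in LHS]hp rhoK.
    by have := rk m _ _ hVp m1; rewrite rhoK ltNge m2.
  by have := rk m _ _ hp m1; rewrite ltNge m2.
- move=> g u a l ug gp ga ul la.
  have [a' [b [gab gb ga']]] := p_ucoll ug.
  have Ea := ucv_uniq ga ga'; have Eb := ucv_uniq gp gb; subst a' b.
  have gu := gab _ _ ul la.
  have gnp := gfix _ ug.
  have gun : \forall n \near ufil, rho (g n) (u n) <> p.
    apply: ufil_not => gup; apply: la; apply: ucv_uniq ul _; apply: ucv_eq ga.
    by apply: filterS gup => n <-; rewrite rhoK.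
  have la2 : 0 < d l a / 2 by rewrite divr_gt0// mdist_gt0P.
  have uga : \forall n \near ufil, d l a / 2 <= d (u n) (rho (g n)^-1%g p).
    have /ufil_not : ~ \forall n \near ufil, ~ d l a / 2 <= d (u n) (rho (g n)^-1%g p).
      move=> H; have : d l a <= d l a / 2.
        by apply: (ucv_le ul ga); apply: filterS H => n /negP; rewrite -ltNge => /ltW.
      by lra.
    by apply: filterS => n /contrapT.
  (* If the images were separated by a shell, both pairs would be at distance at least [r m / 2],
     and the choice of [r m.+1] would put both images outside the inner ball of that shell. *)
  apply: slow => //; apply: contrapT => /ufil_not nf.
  have [n [[nfn ugn] [[dgu dgp] gpn]]] := ufil_ex (filterI (filterI nf uga)
    (filterI (filterI (dcv0 _ gu _ la2) (dcv0 _ gp _ la2)) gnp)).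
  have [m [mm [mle mge]]] := farP _ _ nfn.
  have rm : r m / 2 <= d l a / 2.
    move: dgu dgp; rewrite !sub0r !normrN !ger0_norm ?mdist_ge0// => ? ?.
    by have := r0 m; case: mge; lra.
  have [_ _ h3 h4] := rs m _ _ gpn (le_trans rm ugn) mm.
  by case: mle => h; [move: h3|move: h4]; rewrite ltNge h.
- move=> g u ug gp gVp up gup u_p gu_p.
  have gnp := gfix _ ug.
  have gVnp : \forall n \near ufil, rho (g n)^-1%g p <> p.
    by apply: filterS gnp => n H E; apply: H; rewrite -[in LHS]E rhoVK.
  have [nf1|nf1] := ufil_dec (fun n => ~ far r (d p (u n)) (d p (rho (g n)^-1%g p)) /\
     ~ far r (d p (rho (g n)^-1%g p)) (d p (u n))).
    by left; exact: slow.
  have [nf2|nf2] := ufil_dec (fun n => ~ far r (d p (rho (g n) (u n))) (d p (rho (g n) p)) /\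
     ~ far r (d p (rho (g n) p)) (d p (rho (g n) (u n)))).
    by right; exact: slow.
  (* If source and target pairs were both separated by shells, the deeper of the two shells would
     contradict the choice of the next radius. *)
  have [n [[n1 n2] gpn]] := ufil_ex (filterI (filterI nf1 nf2) gnp).
  have [m1 [mm1 [mle1 _]]] := farP _ _ n1; have [m2 [mm2 [mle2 _]]] := farP _ _ n2.
  have rle i j : (i <= j)%N -> r j / 2 <= r i / 2.
    by move=> ij; have := radius_le r0 r2 ij; lra.
  have [h1 h2 h3 h4] := rs (maxn m1 m2) _ _ gpn (le_trans (rle _ _ (leq_maxl _ _)) mm1)
    (le_trans (rle _ _ (leq_maxr _ _)) mm2).
  have [m12|/ltnW m21] := leqP m1 m2.
    move: h3 h4; rewrite (maxn_idPr m12) => h3 h4.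
    by case: mle2 => h; [move: h3|move: h4]; rewrite ltNge h.
  move: h1 h2; rewrite (maxn_idPl m21) => h1 h2.
  by case: mle1 => h; [move: h1|move: h2]; rewrite ltNge h.
Qed.

End SlowFunction.

(** * Blowing up an orbit *)

Section BlowUpSpace.
Context {G : groupType} {R : realType} {X : metricType R}.
Variable rho : homeo_action G X.
Hypothesis G_countable : countable [set: G].
Variables (p : X) (F : X -> R).
Hypothesis F_slow : slow_function rho p F.

Definition limit_value s := exists u : nat -> X,
  [/\ ucv u p, \forall n \near ufil, u n <> p & rcv (F \o u) s].

Lemma limit_value01 s : limit_value s -> 0 <= s <= 1.
Proof.
have [F01 _ _ _ _] := F_slow; move=> [u [_ up us]]; apply/andP; split.
  by apply: rcv_ge us; apply: filterS up => n /F01 /andP[].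
by apply: rcv_le us; apply: filterS up => n /F01 /andP[].
Qed.

Lemma blow_up_space : exists (Y : metricType R) (q : Y -> X) (v : G -> Y -> R),
  [/\ forall u l, ucv u l <-> ucv (q \o u) (q l) /\ forall h, rcv (v h \o u) (v h l),
   forall h y, q y <> rho h p -> v h y = F (rho h^-1%g (q y)),
   forall h k y, q y = rho h p -> q y = rho k p -> v h y = v k y,
   forall x, (forall g, x <> rho g p) -> exists y, q y = x &
   (forall h s, limit_value s -> exists y, q y = rho h p /\ v h y = s) /\
   forall h y, q y = rho h p -> limit_value (v h y)].
Proof.
have [F01 _ _ _ _] := F_slow.
have [c c_inj] : exists c : G -> nat, injective c.
  have /countable_injP[c cP] := G_countable; exists c => x y; apply: cP; exact/mem_set.
pose T := {xs : X * R | ((exists g, xs.1 = rho g p) -> limit_value xs.2) /\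
   ((forall g, xs.1 <> rho g p) -> xs.2 = 0)}.
pose Fh h (t : T) := if pselect ((sval t).1 = rho h p) is left _ then (sval t).2
  else F (rho h^-1%g (sval t).1).
have Fh01 h t : 0 <= Fh h t <= 1.
  rewrite /Fh; case: pselect => [E|E].
    by apply: limit_value01; apply: (proj1 (svalP t)); exists h.
  by apply: F01 => /(congr1 (rho h)); rewrite rhoVK.
pose phi k (t : T) := if pselect (exists h, c h = k) is left E then Fh (sval (cid E)) t else 0.
have phiE h t : phi (c h) t = Fh h t.
  rewrite /phi; case: pselect => [E|]; last by case; exists h.
  by case: cid => k /= /c_inj ->.
have [|||||Y [f [g [fK gK ucvY]]]] :=
    @family_metric R T (fun s t => mdist (sval s).1 (sval t).1) phi.
- by move=> t; rewrite mdistxx.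
- by move=> s t; rewrite metric_sym.
- by move=> s t w; exact: metric_triangle.
- move=> k t; rewrite /phi; case: pselect => [E|_]; first exact: Fh01.
  by rewrite lexx ler01.
- move=> [[x s] xsP] [[x' s'] xsP'] /= /mdist_positivity; rewrite /= => E H; subst x'.
  suff E : s = s' by subst s'; congr exist; exact: Prop_irrelevance.
  have [[h xh]|nx] := pselect (exists g, x = rho g p).
    by have := H (c h); rewrite !phiE /Fh /=; case: pselect.
  have [_ /= ->] := xsP; last by move=> h xh; apply: nx; exists h.
  by have [_ /= ->] := xsP'; last by move=> h xh; apply: nx; exists h.
exists Y, (fun y => (sval (g y)).1), (fun h y => Fh h (g y)); split.
- move=> u l; have -> : ucv u l <-> ucv (f \o (g \o u)) (f (g l)).
    by rewrite gK (_ : f \o (g \o u) = u)//; apply/funext => n /=; rewrite gK.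
  rewrite ucvY; split=> -[dl pl]; split.
  + apply/ucvP => e /dl; apply: filterS => n; rewrite /= sub0r normrN ger0_norm//.
    exact: mdist_ge0.
  + move=> h; rewrite -phiE; apply: rcv_eq (pl (c h)).
    by apply: filterS (ufil_ge 0) => n _ /=; rewrite phiE.
  + move=> e e0; have /ucvP/(_ e e0) := dl; apply: filterS => n /=.
    by rewrite sub0r normrN ger0_norm// mdist_ge0.
  + move=> k; rewrite /phi; case: pselect => [E|_]; last exact: rcv_cst.
    exact: pl.
- by move=> h y; rewrite /Fh; case: pselect.
- move=> h k y yh yk; rewrite /Fh; case: pselect => // _; by case: pselect.
- move=> x nx; have xP : ((exists g, x = rho g p) -> limit_value (0 : R)) /\
     ((forall g, x <> rho g p) -> (0 : R) = 0).
    by split=> // -[h /nx].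
  by exists (f (exist _ (x, 0) xP)); rewrite fK.
- split=> [h s sL|h y yh].
    have xP : ((exists g, rho h p = rho g p) -> limit_value s) /\
       ((forall g, rho h p <> rho g p) -> s = 0).
      by split=> // /(_ h).
    exists (f (exist _ (rho h p, s) xP)); rewrite fK; split=> //.
    by rewrite /Fh; case: pselect.
  rewrite /Fh; case: pselect => // _.
  by apply: (proj1 (svalP (g y))); exists h.
Qed.

End BlowUpSpace.

Lemma rcv_trans (R : realType) (u v : nat -> R) l :
  rcv (fun n => u n - v n) 0 -> rcv v l -> rcv u l.
Proof.
move=> uv vl e e0; have e2 : 0 < e / 2 by rewrite divr_gt0.
apply: filterS2 (uv _ e2) (vl _ e2) => n; rewrite sub0r normrN !ltr_norml.
by move=> /andP[? ?] /andP[? ?]; apply/andP; split; lra.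
Qed.

Lemma rcv_subC (R : realType) (u v : nat -> R) :
  rcv (fun n => u n - v n) 0 -> rcv (fun n => v n - u n) 0.
Proof. by move=> uv e /uv; apply: filterS => n; rewrite !sub0r !normrN distrC. Qed.

Lemma rcv_sub_trans (R : realType) (u v w : nat -> R) :
  rcv (fun n => u n - v n) 0 -> rcv (fun n => v n - w n) 0 -> rcv (fun n => u n - w n) 0.
Proof.
move=> uv vw; apply: rcv_trans (vw); apply: rcv_eq uv.
by apply: filterS (ufil_ge 0) => n _; lra.
Qed.

Section BlowUpAction.
Context {G : groupType} {R : realType} {X Y : metricType R}.
Variable rho : homeo_action G X.
Hypothesis X_compact : compact [set: X].
Hypothesis X_min : minimal_nonelementary_convergence_action rho.
Variables (p : X) (F : X -> R).
Hypothesis p_cvg : forall g a b, unc g -> ucoll rho g a b -> ucv (fun n => rho (g n) p) b.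
Hypothesis p_stab : forall g, unc g -> ~ \forall n \near ufil, rho (g n) p = p.
Hypothesis F_slow : slow_function rho p F.
Variables (q : Y -> X) (v : G -> Y -> R).
Local Notation limit_value := (limit_value p F).
Hypothesis ucvY : forall u l, ucv u l <->
  ucv (q \o u) (q l) /\ forall h, rcv (v h \o u) (v h l).
Hypothesis v_off : forall h y, q y <> rho h p -> v h y = F (rho h^-1%g (q y)).
Hypothesis v_on : forall h k y, q y = rho h p -> q y = rho k p -> v h y = v k y.
Hypothesis q_off : forall x, (forall g, x <> rho g p) -> exists y, q y = x.
Hypothesis q_on : forall h s, limit_value s -> exists y, q y = rho h p /\ v h y = s.
Hypothesis v_limit : forall h y, q y = rho h p -> limit_value (v h y).
Hypothesis limit_ex : exists s, limit_value s.

Lemma q_surj x : exists y, q y = x.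
Proof.
have [[h ->]|nx] := pselect (exists h, x = rho h p); last first.
  by apply: q_off => h xh; apply: nx; exists h.
by have [s /(q_on h)[y [? _]]] := limit_ex; exists y.
Qed.

Lemma q_ucv u l : ucv u l -> ucv (q \o u) (q l).
Proof. by move=> /ucvY[]. Qed.

Lemma v_ucv h u l : ucv u l -> rcv (v h \o u) (v h l).
Proof. by move=> /ucvY[_]. Qed.

Lemma Y_eq y z : q y = q z -> (forall h, v h y = v h z) -> y = z.
Proof.
move=> qyz vyz; have : ucv (fun=> y) z.
  apply/ucvY; split=> [|h] /=; first by rewrite -qyz; exact: ucv_cst.
  by rewrite -vyz; exact: rcv_cst.
exact: ucv_uniq (ucv_cst y).
Qed.

Lemma Y_eq_on h y z : q y = rho h p -> q z = q y -> v h y = v h z -> y = z.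
Proof.
move=> yh zy vh; apply: Y_eq => // k; have [yk|yk] := pselect (q y = rho k p).
  by rewrite (v_on yk yh) vh; apply: v_on; rewrite zy.
by rewrite !v_off ?zy.
Qed.

Lemma Y_eq_off y z : (forall h, q y <> rho h p) -> q y = q z -> y = z.
Proof. by move=> yn yz; apply: Y_eq => // h; rewrite !v_off -?yz. Qed.

Lemma rhoV_neq h x : x <> rho h p -> rho h^-1%g x <> p.
Proof. by move=> xh /(congr1 (rho h)); rewrite rhoVK. Qed.

Lemma rhoV_ucv h u : ucv u (rho h p) -> ucv (fun n => rho h^-1%g (u n)) p.
Proof. by move=> /(ucv_rho rho h^-1%g); rewrite rhoK. Qed.

Lemma v_cvg_off h u y : q y <> rho h p -> ucv (q \o u) (q y) -> rcv (v h \o u) (v h y).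
Proof.
have [_ Fc _ _ _] := F_slow; move=> yh uy.
have un := ucv_neq uy yh.
rewrite (v_off yh); apply: rcv_eq (Fc _ _ (rhoV_neq yh) (ucv_rho rho h^-1%g uy)).
by apply: filterS un => n /= un; rewrite v_off.
Qed.

Lemma Y_cvg_off u y : (forall h, q y <> rho h p) -> ucv (q \o u) (q y) -> ucv u y.
Proof. by move=> yn uy; apply/ucvY; split=> // h; exact: v_cvg_off. Qed.

(** Over an orbit point one coordinate controls all the others, because the elements carrying [p]
    there differ by the stabilizer, under which [F] is asymptotically invariant. *)
Lemma Y_cvg_on h u y : q y = rho h p -> ucv (q \o u) (q y) -> rcv (v h \o u) (v h y) ->
  ucv u y.
Proof.
have [_ _ Fs _ _] := F_slow; move=> yh uy vh; apply/ucvY; split=> // k.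
have [yk|yk] := pselect (q y = rho k p); last exact: v_cvg_off.
rewrite (v_on yk yh).
have [un|un] := ufil_dec (fun n => q (u n) = rho h p).
  by apply: rcv_eq vh; apply: filterS un => n un /=; apply: v_on; rewrite un -?yh.
apply: rcv_trans vh; have kh : rho (k^-1 * h)%g p = p by rewrite hactM -yh yk rhoK.
have wp : ucv (fun n => rho h^-1%g (q (u n))) p by apply: rhoV_ucv; rewrite -yh.
have wn : \forall n \near ufil, rho h^-1%g (q (u n)) <> p.
  by apply: filterS un => n; exact: rhoV_neq.
apply: rcv_eq (Fs _ _ kh wp wn); apply: filterS un => n un /=.
rewrite !v_off//; last by rewrite -yk yh.
by rewrite hactM rhoVK.
Qed.

Lemma limit_value_lim s (u : nat -> R) : rcv u s -> (forall n, limit_value (u n)) -> limit_value s.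
Proof.
move=> us uL; have /choice[x xP] n : exists x, [/\ mdist p x <= 1 / n.+1%:R, x <> p &
    `|F x - u n| < n.+1%:R^-1].
  have n0 : (0 : R) < n.+1%:R^-1 by rewrite invr_gt0.
  have [w [wp wn wu]] := uL n; have /ucvP/(_ _ n0) wp' := wp.
  have [k [[d1 d2] d3]] := ufil_ex (filterI (filterI wp' wn) (wu _ n0)).
  by exists (w k); split=> //; [rewrite mul1r ltW|rewrite distrC].
exists x; split.
- by apply: (ucv_dist (c := 1)) => n; have [] := xP n.
- by apply: filterS (ufil_ge 0) => n _; have [] := xP n.
- apply: rcv_trans us => e e0; apply: filterS (inv_small 1 e0) => n.
  by rewrite mul1r sub0r normrN => ne; have [_ _ /lt_trans] := xP n; exact.
Qed.

Lemma Y_compact : compact [set: Y].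
Proof.
apply: lim_compact => u; have [x ux] := ucv_ex X_compact (q \o u).
have [[h xh]|nx] := pselect (exists h, x = rho h p); last first.
  have nx' h : x <> rho h p by move=> xh; apply: nx; exists h.
  by have [y yx] := q_off nx'; exists y; apply: Y_cvg_off; rewrite yx.
have v01 h' y : 0 <= v h' y <= 1.
  have [E|E] := pselect (q y = rho h' p); first exact: (limit_value01 F_slow (v_limit E)).
  by rewrite v_off//; have [F01 _ _ _ _] := F_slow; apply: F01; exact: rhoV_neq.
have [s us] := @rcv_ex R (v h \o u) 0 1 (filterS (fun n _ => v01 h (u n)) (ufil_ge 0)).
suff sL : limit_value s.
  have [y [yh vy]] := q_on h sL; exists y; apply: (Y_cvg_on yh); last by rewrite vy.
  by rewrite yh -xh.
have [un|un] := ufil_dec (fun n => q (u n) = rho h p).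
  have [N uN] := ufil_ex un.
  pose m n := if pselect (q (u n) = rho h p) is left _ then n else N.
  apply: (limit_value_lim (u := v h \o (u \o m))).
    by apply: rcv_eq us; apply: filterS un => n un /=; rewrite /m; case: pselect.
  by move=> n; apply: v_limit; rewrite /= /m; case: pselect.
exists (fun n => rho h^-1%g (q (u n))); split.
- by apply: rhoV_ucv; rewrite -xh.
- by apply: filterS un => n; exact: rhoV_neq.
- by apply: rcv_eq us; apply: filterS un => n un /=; rewrite v_off.
Qed.

Lemma lift_ex g y : exists z, q z = rho g (q y) /\ forall h, v h z = v (g^-1 * h)%g y.
Proof.
have off h z : q z = rho g (q y) -> q y <> rho (g^-1 * h)%g p -> v h z = v (g^-1 * h)%g y.
  move=> zy yh; rewrite !v_off ?zy//; first by rewrite invgM invgK hactM.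
  by move=> E; apply: yh; rewrite hactM -E rhoK.
have [[k yk]|ny] := pselect (exists k, q y = rho k p).
  have [z [zk vz]] := q_on (g * k)%g (v_limit yk).
  have zy : q z = rho g (q y) by rewrite zk hactM yk.
  exists z; split=> // h; have [yh|] := pselect (q y = rho (g^-1 * h)%g p); last exact: off.
  have zh : q z = rho h p by rewrite zy yh -hactM mulVKg.
  by rewrite (v_on zh zk) vz; apply: v_on.
have ny' h : q y <> rho h p by move=> yh; apply: ny; exists h.
have [|z zy] := q_off (x := rho g (q y)).
  by move=> h E; apply: (ny' (g^-1 * h)%g); rewrite hactM -E rhoK.
by exists z; split=> // h; apply: off.
Qed.

Section Dynamics.
Variable rhoY : homeo_action G Y.
Hypothesis q_rho : forall g y, q (rhoY g y) = rho g (q y).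

Let ca : convergence_action rho. Proof. by have [] := X_min. Qed.
Let ne : non_elementary rho. Proof. by have [] := X_min. Qed.
Let F_var := let: And5 _ _ _ H _ := F_slow in H.
Let F_crs := let: And5 _ _ _ _ H := F_slow in H.

Lemma F_contract g al be h k z l : unc g -> ucoll rho g al be -> be = rho h p ->
  ucv z l -> l <> al ->
  rcv (fun n => F (rho h^-1%g (rho (g n) (z n))) - F (rho h^-1%g (rho (g n) (rho k p)))) 0.
Proof.
move=> ug gab beh zl la; pose g' n := (h^-1 * g n * k)%g.
have ug' : unc g'.
  have inj : injective (fun t => h^-1 * t * k)%g by move=> a b /mulIg/mulgI.
  exact: (unc_inj inj ug).
have gab' : ucoll rho g' (rho k^-1%g al) p.
  by have := ucollM h^-1%g k gab; rewrite beh rhoK.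
have [a [b [gab2 gp ga]]] := p_ucoll X_compact ca ne p_cvg ug'.
have [Ea Eb] := ucoll_uniq X_compact ca ne gab2 gab'; subst a b.
have := F_var ug' gp ga (ucv_rho rho k^-1%g zl) (fun E => la (rho_inj E)).
apply: rcv_eq; apply: filterS (ufil_ge 0) => n _.
by rewrite /g' /= !hactM rhoVK.
Qed.

Lemma F_orbit g al be h k : unc g -> ucoll rho g al be -> be = rho h p ->
  rcv (fun n => F (rho h^-1%g (rho (g n) (rho k p))) - F (rho h^-1%g (rho (g n) p))) 0.
Proof.
move=> ug gab beh; have [z [zal _]] := avoid2 X_compact ca ne al al.
have H m := F_contract m ug gab beh (ucv_cst z) zal.
apply: rcv_sub_trans (rcv_subC (H k)) _; have := H 1%g.
by apply: rcv_eq; apply: filterS (ufil_ge 0) => n _; rewrite hact1.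
Qed.

Lemma limit_nfix g be h : unc g -> \forall n \near ufil, rho (g n) (rho be p) <> rho h p.
Proof.
move=> ug; have ug' : unc (fun n => g n * be)%g by exact: unc_inj (mulIg be) ug.
by apply: filterS (p_nfix p_stab h ug') => n; rewrite hactM.
Qed.

(** The attracting point lies over [be], with coordinates the limits of [F] along the translates of
    [p]; the repelling point is defined in the same way from the inverses. Points not over [al] are
    handled by contraction. The delicate points lie over [al], in the same fibre as [a] but with
    another coordinate. *)
Lemma blow_up_ucoll g : unc g -> exists a b, ucoll rhoY g a b /\
  ucoll rho g (q a) (q b) /\ forall h, rcv (fun n => F (rho h^-1%g (rho (g n) p))) (v h b).
Proof.
move=> ug; have [al [be [gab gp ga]]] := p_ucoll X_compact ca ne p_cvg ug.
have ugV : unc (fun n => (g n)^-1%g) by exact: unc_inj (@invg_inj G) ug.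
have lift (w : nat -> X) l : ucv w l -> (forall h, \forall n \near ufil, w n <> rho h p) ->
    exists c, q c = l /\ forall h, rcv (fun n => F (rho h^-1%g (w n))) (v h c).
  move=> wl wn; have /choice[u uw] n := q_surj (w n).
  have [c uc] := ucv_ex Y_compact u; exists c; split.
    apply: ucv_uniq (q_ucv uc) _; apply: ucv_eq wl.
    by apply: filterS (ufil_ge 0) => n _ /=.
  move=> h; apply: rcv_eq (v_ucv h uc); apply: filterS (wn h) => n wn' /=.
  by rewrite v_off uw.
have [b [qb vb]] := lift _ _ gp (fun h => p_nfix p_stab h ug).
have [a [qa va]] := lift _ _ ga (fun h => p_nfix p_stab h ugV).
exists a, b; rewrite qa qb; split=> // x l xl la.
have wl := q_ucv xl.
have qg : q \o (fun n => rhoY (g n) (x n)) = (fun n => rho (g n) (q (x n))).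
  by apply/funext => n /=; rewrite q_rho.
(* It suffices to control the images in [X], and the values of [F] at one point of the fibre. *)
have fin : ucv (fun n => rho (g n) (q (x n))) be ->
    (forall h, be = rho h p -> rcv (fun n => v h (rhoY (g n) (x n)) -
       F (rho h^-1%g (rho (g n) p))) 0) -> ucv (fun n => rhoY (g n) (x n)) b.
  move=> gb vgb; have [[h beh]|nb] := pselect (exists h, be = rho h p).
    apply: (Y_cvg_on (h := h)); rewrite ?qb ?qg//.
    exact: rcv_trans (vgb h beh) (vb h).
  apply: Y_cvg_off; rewrite ?qg ?qb//.
  by move=> h bh; apply: nb; exists h.
have [lal|lal] := pselect (q l = al); last first.
  have gb := gab _ _ wl lal; apply: fin => // h beh.
  have := F_contract 1%g ug gab beh wl lal.
  have gn : \forall n \near ufil, rho (g n) (q (x n)) <> rho h p.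
    apply: ufil_not => gnh; apply: lal.
    have := p_cvg (unc_inj (mulIg h) ugV) (ucollMr h (ucollV X_compact gab)).
    apply: ucv_uniq; apply: ucv_eq wl; apply: filterS gnh => n gnh /=.
    by rewrite hactM -gnh rhoK.
  apply: rcv_eq; apply: filterS gn => n gn; rewrite hact1.
  by rewrite v_off q_rho.
have [[k alk]|na] := pselect (exists k, al = rho k p); last first.
  case: la; apply: Y_eq_off; last by rewrite qa.
  by move=> h lh; apply: na; exists h; rewrite -lal.
have vla : v k l <> v k a.
  by move=> E; apply: la; apply: (Y_eq_on (h := k)) => //; rewrite ?qa ?lal.
pose g' n := (g n * k)%g.
have ug' : unc g' by exact: unc_inj (mulIg k) ug.
have gab' : ucoll rho g' p be by have := ucollMr k gab; rewrite alk rhoK.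
have [a' [b' [gab2 gp' ga']]] := p_ucoll X_compact ca ne p_cvg ug'.
have [Ea Eb] := ucoll_uniq X_compact ca ne gab2 gab'; subst a' b'.
have xk : rcv (v k \o x) (v k l) by exact: v_ucv.
have [xn|xn] := ufil_dec (fun n => q (x n) = rho k p).
  have gE : \forall n \near ufil, rho (g n) (q (x n)) = rho (g' n) p.
    by apply: filterS xn => n ->; rewrite hactM.
  apply: fin; first by apply: ucv_eq gp'; apply: filterS gE => n ->.
  move=> h beh; apply: rcv_eq (F_orbit k ug gab beh).
  apply: filterS2 xn (limit_nfix k h ug) => n xn gn.
  by rewrite v_off q_rho xn.
pose u n := rho k^-1%g (q (x n)).
have up : ucv u p by apply: rhoV_ucv; rewrite -alk -lal.
have un : \forall n \near ufil, u n <> p by apply: filterS xn => n; exact: rhoV_neq.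
have Fu : rcv (fun n => F (u n)) (v k l).
  by apply: rcv_eq xk; apply: filterS xn => n xn /=; rewrite v_off.
have gu n : rho (g' n) (u n) = rho (g n) (q (x n)) by rewrite hactM rhoVK.
have gV n : rho (g' n)^-1%g p = rho k^-1%g (rho (g n)^-1%g p) by rewrite invgM hactM.
(* Since [l] and [a] have different coordinates in the fibre, [F] does vary at the source. This
   excludes an image limit other than [be], by contraction for the inverses, and leaves the second
   alternative of the crossing condition. *)
have nFu : ~ rcv (fun n => F (u n) - F (rho (g' n)^-1%g p)) 0.
  move=> H; apply: vla; apply: rcv_uniq Fu _; apply: rcv_trans H _.
  by apply: rcv_eq (va k); apply: filterS (ufil_ge 0) => n _; rewrite gV.
have [c gc] := ucv_ex X_compact (fun n => rho (g' n) (u n)).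
have cb : c = be.
  apply: contrapT => cbe; apply: nFu.
  have ugV' : unc (fun n => (g' n)^-1%g) by exact: unc_inj (@invg_inj G) ug'.
  have gp2 : ucv (fun n => rho (g' n)^-1^-1%g p) be.
    by apply: ucv_eq gp'; apply: filterS (ufil_ge 0) => n _; rewrite invgK.
  apply: rcv_eq (F_var ugV' ga' gp2 gc cbe).
  by apply: filterS (ufil_ge 0) => n _; rewrite rhoK.
subst c; apply: fin; first by apply: ucv_eq gc; apply: filterS (ufil_ge 0) => n _; exact: gu.
move=> h beh; pose f n := (h^-1 * g' n)%g.
have uf : unc f by exact: unc_inj (mulgI h^-1)%g ug'.
have fV n : rho (f n)^-1%g p = rho k^-1%g (rho (g n)^-1%g (rho h p)).
  by rewrite !invgM invgK !hactM.
have orb : rcv (fun n => F (rho (f n)^-1%g p) - F (rho (g' n)^-1%g p)) 0.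
  apply: rcv_eq (F_orbit h ugV (ucollV X_compact gab) alk).
  by apply: filterS (ufil_ge 0) => n _; rewrite fV gV.
have fu n : rho (f n) (u n) = rho h^-1%g (rho (g n) (q (x n))) by rewrite hactM gu.
have fp : ucv (fun n => rho (f n) p) p.
  by have := ucv_rho rho h^-1%g gp'; rewrite beh rhoK; apply: ucv_eq;
    apply: filterS (ufil_ge 0) => n _; rewrite -hactM.
have fVp : ucv (fun n => rho (f n)^-1%g p) p.
  have gh := p_cvg (unc_inj (mulIg h) ugV) (ucollMr h (ucollV X_compact gab)).
  have := ucv_rho rho k^-1%g gh; rewrite alk rhoK; apply: ucv_eq.
  by apply: filterS (ufil_ge 0) => n _; rewrite fV /= hactM.
have fup : ucv (fun n => rho (f n) (u n)) p.
  have := ucv_rho rho h^-1%g gc; rewrite beh rhoK; apply: ucv_eq.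
  by apply: filterS (ufil_ge 0) => n _; rewrite fu gu.
have gn : \forall n \near ufil, rho (g n) (q (x n)) <> rho h p.
  apply: ufil_not => gnh; apply: nFu; apply: rcv_eq orb; apply: filterS gnh => n gnh.
  by rewrite fV -gnh rhoK.
have fun' : \forall n \near ufil, rho (f n) (u n) <> p.
  by apply: filterS gn => n; rewrite fu; exact: rhoV_neq.
have [H|H] := F_crs uf fp fVp up fup un fun'.
  by case: nFu; exact: rcv_sub_trans H orb.
apply: rcv_sub_trans (F_orbit k ug gab beh).
apply: rcv_eq H; apply: filterS gn => n gn; rewrite fu v_off ?q_rho//.
by rewrite !hactM.
Qed.

End Dynamics.
End BlowUpAction.

Section BlowUpExists.
Context {G : groupType} {R : realType} {X : metricType R}.
Variable rho : homeo_action G X.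
Hypothesis X_compact : compact [set: X].
Hypothesis X_min : minimal_nonelementary_convergence_action rho.
Hypothesis G_countable : countable [set: G].
Variables (p : X) (y : nat -> X).
Hypothesis p_cvg : forall g a b, unc g -> ucoll rho g a b -> ucv (fun n => rho (g n) p) b.
Hypothesis p_stab : forall g, unc g -> ~ \forall n \near ufil, rho (g n) p = p.
Hypothesis yp : ucv y p.
Hypothesis y_neq : forall n, y n <> p.

Lemma orbit_dense (F : X -> R) x (e : R) : (forall u l, l <> p -> ucv u l -> rcv (F \o u) (F l)) ->
  x <> p -> 0 < e -> exists g, [/\ mdist x (rho g p) < e, rho g p <> p & `|F x - F (rho g p)| < e].
Proof.
move=> Fc xp e0; have [_ _ mi] := X_min; have : limit_set rho x by rewrite mi.
move=> /(limit_setP rho X_compact)[g [ug [a gax]]]; have gx := p_cvg ug gax.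
have /ucvP/(_ e e0) g1 := gx.
have [n [[? ?] ?]] := ufil_ex (filterI (filterI g1 (ucv_neq gx xp)) (Fc _ _ xp gx e e0)).
by exists (g n).
Qed.

Theorem blow_up_exists : exists (Y : metricType R) (rhoY : homeo_action G Y) (q : Y -> X)
    (w : Y -> R) (a b : nat -> nat),
  [/\ compact [set: Y] /\ minimal_nonelementary_convergence_action rhoY,
   (forall x, exists z, q z = x) /\ (forall u l, ucv u l -> ucv (q \o u) (q l)) /\
     (forall g z, q (rhoY g z) = rho g (q z)),
   forall z z', (forall g, q z <> rho g p) -> q z = q z' -> z = z',
   (forall u l, ucv u l -> rcv (w \o u) (w l)) /\ unb a /\ unb b &
   forall u : nat -> Y, ((forall n, q (u n) = y (a n)) -> rcv (w \o u) 0) /\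
     ((forall n, q (u n) = y (b n)) -> rcv (w \o u) 1)].
Proof.
have [ca ne mi] := X_min.
have [F [F_slow [a [b [ua ub yap Fa Fb]]]]] := slow_function_ex X_compact ca ne p_cvg p_stab yp
    y_neq.
have [Y [q [v [ucvY v_off v_on q_off [q_on v_limit]]]]] := blow_up_space G_countable F_slow.
have [F01 Fc _ _ _] := F_slow.
have limit_ex : exists s, limit_value p F s.
  by exists 0, (y \o a); split=> //; apply: filterS (ufil_ge 0) => n _; exact: y_neq.
have Yc := Y_compact X_compact F_slow ucvY v_off v_on q_off q_on v_limit.
have /choice[act actP] (gz : G * Y) := lift_ex v_off v_on q_off q_on v_limit gz.1 gz.2.
pose A g z := act (g, z).
have qA g z : q (A g z) = rho g (q z) by have [] := actP (g, z).
have vA g z h : v h (A g z) = v (g^-1 * h)%g z by have [_ ->] := actP (g, z).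
have Yeq := Y_eq ucvY.
have A1 z : A 1%g z = z.
  by apply: Yeq => [|h]; rewrite ?qA ?hact1 ?vA ?invg1 ?mul1g.
have AM g h z : A (g * h)%g z = A g (A h z).
  by apply: Yeq => [|k]; rewrite ?qA ?hactM ?vA ?invgM ?mulgA.
have Ac g : continuous (A g).
  apply: ucv_continuousP => u l /ucvY[ul vl]; apply/ucvY; split=> [|h].
    rewrite qA; apply: ucv_eq (ucv_rho rho g ul).
    by apply: filterS (ufil_ge 0) => n _ /=; rewrite qA.
  rewrite vA; apply: rcv_eq (vl (g^-1 * h)%g).
  by apply: filterS (ufil_ge 0) => n _ /=; rewrite vA.
pose rhoY := HomeoAction A1 AM Ac.
have coll g : unc g -> exists a b, ucoll rhoY g a b /\ ucoll rho g (q a) (q b) /\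
    forall h, rcv (fun n => F (rho h^-1%g (rho (g n) p))) (v h b).
  move=> ug; apply: (blow_up_ucoll X_compact X_min p_cvg p_stab F_slow ucvY v_off v_on q_off q_on
    v_limit limit_ex (rhoY := rhoY) qA) => //.
have qs := q_surj q_off q_on limit_ex.
have Y3 : (`I_3 #<= [set: Y])%card.
  have [/card_le3P[x1 [x2 [x3 [_ _ _ [x12 x23 x13]]]]] _] := ca.
  have [z1 E1] := qs x1; have [z2 E2] := qs x2; have [z3 E3] := qs x3.
  apply/card_le3P; exists z1, z2, z3; split=> //; rewrite -E1 -E2 -E3 in x12 x23 x13.
  by split=> E; [apply: x12|apply: x23|apply: x13]; rewrite E.
have lim z : limit_set rhoY z.
  apply/(limit_setP rhoY Yc).
  have [[h zh]|nz] := pselect (exists h, q z = rho h p); last first.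
    have nz' h : q z <> rho h p by move=> zh; apply: nz; exists h.
    have : limit_set rho (q z) by rewrite mi.
    move=> /(limit_setP rho X_compact)[g [ug [al gal]]].
    have [a' [b' [gY [gX _]]]] := coll g ug.
    have [_ qb] := ucoll_uniq X_compact ca ne gal gX.
    exists g; split=> //; exists a'.
    by rewrite (Y_eq_off ucvY v_off nz' qb).
  have [u [up un us]] := v_limit h z zh.
  (* Minimality over the orbit: replacing the [u n] that define the coordinate of [z] by orbit
     points with nearly the same value of [F] gives group elements whose attracting point is [z] up
     to translation. *)
  have /choice[g gP] n : exists g, u n <> p -> [/\ mdist (u n) (rho g p) < n.+1%:R^-1,
      rho g p <> p & `|F (u n) - F (rho g p)| < n.+1%:R^-1].
    have [->|unp] := pselect (u n = p); first by exists 1%g.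
    have n0 : (0 : R) < n.+1%:R^-1 by rewrite invr_gt0.
    by have [g ?] := orbit_dense Fc unp n0; exists g.
  have gp : ucv (fun n => rho (g n) p) p.
    apply/ucvP => e e0; have e2 : 0 < e / 2 by rewrite divr_gt0.
    have /ucvP/(_ _ e2) up' := up.
    apply: filterS3 un up' (inv_small 1 e2) => n /gP[d1 _ _]; rewrite mul1r.
    have := metric_triangle p (u n) (rho (g n) p).
    by move: (n.+1%:R^-1) d1 => t; lra.
  have gnp : \forall n \near ufil, rho (g n) p <> p by apply: filterS un => n /gP[].
  have gs : rcv (fun n => F (rho (g n) p)) (v h z).
    apply: rcv_trans us => e e0; apply: filterS2 un (inv_small 1 e0) => n /gP[_ _ d3].
    by rewrite mul1r sub0r normrN distrC; exact: lt_trans.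
  have ug : unc g.
    apply: contrapT => /not_unc[t gt].
    have tp : rho t p = p.
      apply: ucv_uniq gp; apply: ucv_eq (ucv_cst (rho t p)).
      by apply: filterS gt => n ->.
    by have [n [gn +]] := ufil_ex (filterI gt gnp); apply; rewrite gn.
  have [a' [b' [gY [gX vb]]]] := coll g ug.
  have qb : q b' = p by exact: ucv_uniq (p_cvg ug gX) gp.
  have vb1 : v 1%g b' = v h z.
    apply: rcv_uniq (vb 1%g) _; apply: rcv_eq gs.
    by apply: filterS (ufil_ge 0) => n _; rewrite invg1 hact1.
  exists (fun n => h * g n)%g; split; first exact: unc_inj (mulgI h) ug.
  exists a'; have <- : rhoY h b' = z.
    apply: (Y_eq_on ucvY v_off v_on (h := h)); rewrite /= ?qA ?qb//.
    by rewrite vA mulVg.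
  exact: ucollMl.
exists Y, rhoY, q, (v 1%g), a, b; split.
- split=> //; split; last by apply/seteqP; split=> // z _; exact: lim.
    apply: convergence_actionI => // g ug.
    by have [a' [b' [? _]]] := coll g ug; exists a', b'.
  rewrite /non_elementary (_ : limit_set rhoY = setT)//.
  by apply/seteqP; split=> // z _; exact: lim.
- by split=> //; split=> // u l; exact: q_ucv.
- by move=> z z' zn zz; exact: (Y_eq_off ucvY v_off zn zz).
- by split=> // u l /ucvY[].
- have v1 (u : nat -> Y) (c : nat -> nat) s : (forall n, q (u n) = y (c n)) ->
      rcv (fun n => F (y (c n))) s -> rcv (v 1%g \o u) s.
    move=> qu; apply: rcv_eq; apply: filterS (ufil_ge 0) => n _ /=.
    have un : q (u n) <> rho 1%g p by rewrite hact1 qu; exact: y_neq.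
    by rewrite (v_off _ _ un) invg1 hact1 qu.
  by move=> u; split=> qu; [exact: v1 qu Fa|exact: v1 qu Fb].
Qed.

End BlowUpExists.

(** * Peripheral structures and equivariant maps *)

Lemma infinite_unc (T : choiceType) (A : set T) : infinite_set A ->
  exists h : nat -> T, unc h /\ forall n, A (h n).
Proof.
move=> Ainf; have /choice[f fP] (s : seq T) : exists x, A x /\ x \notin s.
  apply: contrapT => /forallNP H; apply: Ainf; apply: (@sub_finite_set _ _ [set` s]).
    by move=> x Ax /=; apply: contrapT => /negP xs; apply: (H x).
  exact: finite_seq.
pose L := fix L i := if i is i'.+1 then f (L i') :: L i' else [::].
have inL i j : (i < j)%N -> f (L i) \in L j.
  elim: j => // j IH; rewrite ltnS leq_eqVlt => /orP[/eqP ->|/IH] /=.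
    by rewrite inE eqxx.
  by rewrite inE => ->; rewrite orbT.
exists (fun i => f (L i)); split=> [|n]; last exact: (fP _).1.
apply: inj_unc => i j E; have [ij|ji|//] := ltngtP i j.
  by have := (fP (L j)).2; rewrite -E inL.
by have := (fP (L i)).2; rewrite E inL.
Qed.

Section Peripheral.
Context {G : groupType} {R : realType} {A B : metricType R}.
Variables (rhoA : homeo_action G A) (rhoB : homeo_action G B) (f : A -> B).
Hypothesis f_surj : forall b, exists a, f a = b.
Hypothesis f_rho : forall g x, f (rhoA g x) = rhoB g (f x).
Hypothesis f_single : forall (h : nat -> G) x x', unc h ->
  (forall n, rhoB (h n) (f x) = f x) -> f x = f x' -> x = x'.

(** The map is injective over points with infinite stabilizers. This lifts every fixed point of an
    element of infinite order or of an infinite group, which is all that the peripheral structure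
    depends on. *)
Lemma lift_fixed (h : nat -> G) x : unc h -> (forall n, rhoB (h n) (f x) = f x) ->
  forall g, rhoB g (f x) = f x -> rhoA g x = x.
Proof. by move=> uh hx g gx; apply/esym; apply: (f_single uh hx); rewrite f_rho gx. Qed.

Lemma fixed_points_card g : infinite_order g ->
  (fixed_points rhoA g #= fixed_points rhoB g)%card.
Proof.
move=> g_inf; pose h n := (g ^+ n)%g.
have uh : unc h.
  apply: inj_unc; have key i j : (i < j)%N -> (g ^+ i)%g = (g ^+ j)%g -> False.
    move=> ij E; have ji : (0 < j - i)%N by rewrite subn_gt0.
    apply: (g_inf _ ji); apply: (mulgI (g ^+ i)%g).
    by rewrite -expgnDr subnKC ?mulg1 ?E// ltnW.
  move=> i j E; have [ij|ji|//] := ltngtP i j; first by case: (key _ _ ij E).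
  by case: (key _ _ ji (esym E)).
have hfix x : rhoB g (f x) = f x -> forall n, rhoB (h n) (f x) = f x by move=> gx n; exact: rho_pow.
have -> : fixed_points rhoB g = f @` fixed_points rhoA g.
  apply/seteqP; split=> [b|_ [a ga <-]]; last by rewrite /fixed_points /= -f_rho ga.
  have [a <-] := f_surj b => gb; exists a => //; exact: (lift_fixed uh (hfix _ gb)).
apply: card_esym; apply: inj_card_eq => x x' /set_mem xg _.
by apply: (f_single uh); apply: hfix; rewrite -f_rho xg.
Qed.

Lemma loxodromic_factor g : loxodromic rhoA g <-> loxodromic rhoB g.
Proof.
split=> -[g_inf g2]; split=> //; have c := fixed_points_card g_inf.
  exact: card_eq_trans (card_esym c) g2.
exact: card_eq_trans c g2.
Qed.

Lemma parabolic_factor P : parabolic_subgroup rhoA P <-> parabolic_subgroup rhoB P.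
Proof.
split=> -[Ps Pinf [x Px] Pl]; split=> //.
- by exists (f x) => g /Px gx; rewrite -f_rho gx.
- by move=> g /Pl ng /loxodromic_factor.
- have [h [uh hP]] := infinite_unc Pinf; have [a ax] := f_surj x; subst x.
  by exists a => g /Px gx; apply: (lift_fixed uh) gx => n; apply: Px.
- by move=> g /Pl ng /loxodromic_factor.
Qed.

Lemma peripheral_factor : peripheral_structure rhoA = peripheral_structure rhoB.
Proof.
apply/seteqP; split=> P [/parabolic_factor Pp Pmax]; split=> // Q /parabolic_factor;
  exact: Pmax.
Qed.

End Peripheral.

Section EquivariantMaps.
Context {G : groupType} {R : realType} {Z X : metricType R}.
Variables (rhoZ : homeo_action G Z) (rho : homeo_action G X).
Hypothesis Z_compact : compact [set: Z].
Hypothesis X_compact : compact [set: X].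
Hypothesis Z_min : minimal_nonelementary_convergence_action rhoZ.
Hypothesis X_min : minimal_nonelementary_convergence_action rho.

Definition equivariant_map (f : Z -> X) :=
  (forall u l, ucv u l -> ucv (f \o u) (f l)) /\ forall g z, f (rhoZ g z) = rho g (f z).

(** Otherwise the image would have at most two points, [a] and [f c], and would be invariant. *)
Lemma equivariant_avoid f c a : equivariant_map f -> exists z, z <> c /\ f z <> a.
Proof.
move=> [_ f_rho]; have [caZ neZ _] := Z_min; have [ca ne _] := X_min.
apply: contrapT => /forallNP H.
have fE z : z <> c -> f z = a.
  by move=> zc; apply: contrapT => fza; apply: (H z).
have [z [zc _]] := avoid2 Z_compact caZ neZ c c.
have img w : f w = a \/ f w = f c.
  by have [->|/fE] := pselect (w = c); [right|left].
have [fca|fca] := pselect (f c = a).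
  have [g ga] := no_global_fix X_compact ca ne a; apply: ga.
  by rewrite -[in LHS](fE z zc) -f_rho; case: (img (rhoZ g z)) => ->.
apply: (no_orbit2 X_compact ne (p := a) (q := f c)); first exact/nesym.
move=> g; have -> : rho g a = f (rhoZ g z) by rewrite f_rho fE.
by rewrite -f_rho; split; exact: img.
Qed.

(** A point avoiding both repelling points is attracted upstairs and downstairs at once. As all
    points are attracting points, this yields both uniqueness and surjectivity of equivariant
    maps. *)
Lemma equivariant_lim f g c z a b : equivariant_map f -> ucoll rhoZ g c z -> ucoll rho g a b ->
  f z = b.
Proof.
move=> fe gc ga; have [w [wc fwa]] := equivariant_avoid c a fe.
have := fe.1 _ _ (gc _ _ (ucv_cst w) wc).
have := ga _ _ (ucv_cst (f w)) fwa => H1 H2.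
apply: ucv_uniq H2 _; apply: ucv_eq H1; apply: filterS (ufil_ge 0) => n _ /=.
by rewrite fe.2.
Qed.

Lemma equivariant_uniq f f' : equivariant_map f -> equivariant_map f' -> f = f'.
Proof.
move=> fe fe'; have [_ _ mi] := Z_min; have [ca ne _] := X_min; apply/funext => z.
have : limit_set rhoZ z by rewrite mi.
move=> /(limit_setP rhoZ Z_compact)[g [ug [c gc]]].
have [a [b gab]] := ucoll_ex X_compact ca ne ug.
by rewrite (equivariant_lim fe gc gab) (equivariant_lim fe' gc gab).
Qed.

Lemma equivariant_surj f x : equivariant_map f -> exists z, f z = x.
Proof.
move=> fe; have [caZ neZ _] := Z_min; have [_ _ mi] := X_min.
have : limit_set rho x by rewrite mi.
move=> /(limit_setP rho X_compact)[g [ug [a gax]]].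
have [c [z gcz]] := ucoll_ex Z_compact caZ neZ ug.
by exists z; exact: equivariant_lim gcz gax.
Qed.

(* The limit of [g_n] on [Z] lies over [b], so a preimage of a conical point other than the
   repelling point would have to be carried to it. *)
Lemma conical_fibre f x z z' : equivariant_map f -> conical_limit_point rho x ->
  f z = x -> f z' = x -> z = z'.
Proof.
move=> fe [g [a [b [ab gxa gxb]]]]; have [caZ neZ _] := Z_min; have [ca ne _] := X_min.
have gxa' := cvg_ucv gxa; have gxb' y : y <> x -> ucv (fun n => rho (g n) y) b.
  by move=> /gxb/cvg_ucv.
have [y [yx _]] := avoid2 X_compact ca ne x x.
have [y' [y'x y'y _]] := avoid3 X_compact ca ne x y x.
have ug : unc g.
  apply: contrapT => /not_unc[t gt]; apply: y'y; apply: (rho_inj (rho := rho) (g := t)).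
  have tb w : w <> x -> rho t w = b.
    move=> /gxb'; apply: ucv_uniq; apply: ucv_eq (ucv_cst _).
    by apply: filterS gt => n ->.
  by rewrite !tb.
have [al [be gal]] := ucoll_ex X_compact ca ne ug.
have be_b : be = b.
  have [yal|yal] := pselect (y = al).
    by apply: ucv_uniq (gal _ _ (ucv_cst y') _) (gxb' _ y'x); rewrite -yal.
  exact: ucv_uniq (gal _ _ (ucv_cst y) yal) (gxb' _ yx).
have [c [w gcw]] := ucoll_ex Z_compact caZ neZ ug.
have fw := equivariant_lim fe gcw gal.
have key t : f t = x -> t = c.
  move=> ft; apply: contrapT => tc; apply: ab; rewrite -be_b -fw.
  apply: ucv_uniq gxa' _; apply: ucv_eq (fe.1 _ _ (gcw _ _ (ucv_cst t) tc)).
  by apply: filterS (ufil_ge 0) => n _ /=; rewrite fe.2 ft.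
by move=> /key -> /key ->.
Qed.

End EquivariantMaps.

Section PinchedPoint.
Context {G : groupType} {R : realType} {X Q : metricType R}.
Variables (rho : homeo_action G X) (rhoQ : homeo_action G Q) (pi : X -> Q).
Variable eqv : X -> X -> Prop.
Hypothesis X_compact : compact [set: X].
Hypothesis X_min : minimal_nonelementary_convergence_action rho.
Hypothesis Q_compact : compact [set: Q].
Hypothesis Q_min : minimal_nonelementary_convergence_action rhoQ.
Hypothesis X_eqv : gluing rho eqv.
Hypothesis pi_surj : forall q, exists x, pi x = q.
Hypothesis pi_eqv : forall x y, pi x = pi y <-> eqv x y.
Hypothesis pi_ucv : forall u l, ucv u l -> ucv (pi \o u) (pi l).
Hypothesis pi_rho : forall g x, pi (rho g x) = rhoQ g (pi x).

Lemma quotient_single (h : nat -> G) x x' : unc h -> (forall n, rhoQ (h n) (pi x) = pi x) ->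
  pi x = pi x' -> x = x'.
Proof.
move=> uh hx /pi_eqv xx'; apply: contrapT => nxx'.
by apply: (eqv_fin X_eqv nxx' xx' uh) => n; apply/pi_eqv; rewrite pi_rho hx.
Qed.

Variables x1 x2 : X.
Hypothesis x12 : x1 <> x2.
Hypothesis pi12 : pi x1 = pi x2.

Lemma pinched_stab g : unc g -> ~ \forall n \near ufil, rhoQ (g n) (pi x1) = pi x1.
Proof.
move=> ug gx; have [N gN] := ufil_ex gx.
pose h n := if pselect (rhoQ (g n) (pi x1) = pi x1) is left _ then g n else g N.
apply: x12; apply: (quotient_single (h := h)) => //.
  by move=> t; apply: filterS2 gx (ug t) => n gn; rewrite /h; case: pselect.
by move=> n; rewrite /h; case: pselect.
Qed.

(** Of two points with different images in [Q], one is not carried to [pi x1] by [g n] along the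
    ultrafilter, and it is still attracted to [x1]. *)
Lemma approach : exists xi : nat -> X, forall n,
  mdist x1 (xi n) <= n.+1%:R^-1 /\ pi (xi n) <> pi x1.
Proof.
have [caQ neQ _] := Q_min; have [_ _ mi] := X_min.
have : limit_set rho x1 by rewrite mi.
move=> /(limit_setP rho X_compact)[g [ug [a gax]]].
have [q [qa _]] := avoid2 Q_compact caQ neQ (pi a) (pi a).
have [q' [q'a q'q _]] := avoid3 Q_compact caQ neQ (pi a) q (pi a).
have [z [za zn]] : exists z, z <> a /\ \forall n \near ufil, pi (rho (g n) z) <> pi x1.
  have [z Ez] := pi_surj q; have [z' Ez'] := pi_surj q'; subst q q'.
  have [H|H] := ufil_dec (fun n => pi (rho (g n) z) = pi x1); last first.
    by exists z; split=> // E; apply: qa; rewrite E.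
  exists z'; split; first by move=> E; apply: q'a; rewrite E.
  apply: filterS H => n; rewrite !pi_rho => gz gz'; apply: q'q.
  by apply: (rho_inj (rho := rhoQ) (g := g n)); rewrite gz gz'.
have /ucvP gz := gax _ _ (ucv_cst z) za.
have /choice[xi xiP] n : exists x, mdist x1 x <= n.+1%:R^-1 /\ pi x <> pi x1.
  have n0 : (0 : R) < n.+1%:R^-1 by rewrite invr_gt0.
  have [m [/ltW ? ?]] := ufil_ex (filterI (gz _ n0) zn).
  by exists (rho (g m) z).
by exists xi.
Qed.

End PinchedPoint.

Theorem corollary1p3 (R : realType) (G : groupType)
    (G_countable : countable [set: G])
    (X : metricType R) (X_compact : compact [set: X])
    (rhoX : homeo_action G X) (X_gf : geometrically_finite rhoX) :
  exists (Y : metricType R) (rhoY : homeo_action G Y),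
    [/\ compact [set: Y],
        minimal_nonelementary_convergence_action rhoY,
        peripheral_structure rhoX = peripheral_structure rhoY,
        ~ (exists (Z : metricType R) (rhoZ : homeo_action G Z),
             [/\ compact [set: Z],
                 minimal_nonelementary_convergence_action rhoZ,
                 blow_up rhoZ rhoX & blow_up rhoZ rhoY])
      & ~ blow_down rhoY rhoX].
Proof.
have [X_min X_pts] := X_gf; have [ca ne _] := X_min.
have [eqv [X_eqv [x1 [x2 [x12 e12]]] eqv3]] := gluing_exists X_compact ca ne.
have [Q [rhoQ [pi [Q_compact Q_min pi_surj pi_eqv [pi_ucv pi_rho]]]]] :=
  quotient_action X_compact X_min X_eqv eqv3.
have pi12 : pi x1 = pi x2 by apply/pi_eqv.
have single := quotient_single X_eqv pi_eqv pi_rho.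
have p_stab := pinched_stab X_eqv pi_eqv pi_rho x12 pi12.
have p_cvg g a b := @pinched_cvg _ _ _ _ _ _ _ X_compact Q_compact X_min Q_min pi_surj pi_ucv
  pi_rho x1 x2 g a b x12 pi12.
have [xi xiP] := approach X_compact X_min Q_compact Q_min pi_surj pi_rho x1.
have xi_cvg m : unb m -> ucv (xi \o m) x1.
  move=> um; apply/ucvP => e e0.
  apply: filterS (um (Num.truncn e^-1)) => n mn /=; have [d1 _] := xiP (m n).
  apply: le_lt_trans d1 _; rewrite -[ltRHS]invrK ltf_pV2 ?posrE ?invr_gt0//.
  by rewrite (lt_le_trans (truncnS_gt _))// ler_nat ltnS.
have yp : ucv (pi \o xi) (pi x1) by apply: pi_ucv; exact: (xi_cvg id unb_id).
have y_neq n : (pi \o xi) n <> pi x1 by exact: (xiP n).2.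
have [Y [rhoY [q [w [a [b [[Y_compact Y_min] [q_surj [q_ucv q_rho]] q_off
  [w_ucv [ua ub]] w_osc]]]]]]] :=
  blow_up_exists Q_compact Q_min G_countable p_cvg p_stab yp y_neq.
have no_common : ~ (exists (Z : metricType R) (rhoZ : homeo_action G Z),
    [/\ compact [set: Z], minimal_nonelementary_convergence_action rhoZ,
        blow_up rhoZ rhoX & blow_up rhoZ rhoY]).
  move=> [Z [rhoZ [Z_compact Z_min [f fc f_rho] [e ec e_rho]]]].
  have fe : equivariant_map rhoZ rhoX f by split=> // u l; exact: ucv_continuous.
  (* The two blow-ups are not assumed compatible; uniqueness of equivariant maps to [Q] makes the
     square commute. *)
  have ee : pi \o f = q \o e.
    apply: (equivariant_uniq Z_compact Q_compact Z_min Q_min).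
      split=> [u l ul|g z] /=; last by rewrite f_rho pi_rho.
      by apply: pi_ucv; exact: ucv_continuous.
    split=> [u l ul|g z] /=; last by rewrite e_rho q_rho.
    by apply: q_ucv; exact: ucv_continuous.
  (* A parabolic point has an infinite stabilizer, so [x1] could not be glued to another point. *)
  have conical : conical_limit_point rhoX x1.
    have [//|[[P [_ Pinf _ _] Px] _]] := X_pts x1; exfalso.
    have [h [uh hP]] := infinite_unc Pinf; apply: x12; apply: (single h) => // n.
    by rewrite -pi_rho Px.
  have lift m : unb m -> exists u z, [/\ ucv u z, f z = x1 & forall n, q (e (u n)) = pi (xi (m n))].
    move=> um; have /choice[u fu] n : exists z, f z = xi (m n).
      exact: (equivariant_surj Z_compact X_compact Z_min X_min _ fe).
    have [z uz] := ucv_ex Z_compact u; exists u, z; split=> //.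
      apply: ucv_uniq (fe.1 _ _ uz) _; apply: ucv_eq (xi_cvg m um).
      by apply: filterS (ufil_ge 0) => n _ /=.
    by move=> n; rewrite -(fu n); have := congr1 (fun k => k (u n)) ee.
  have [u [z [uz fz qu]]] := lift a ua; have [u' [z' [uz' fz' qu']]] := lift b ub.
  have zz := conical_fibre Z_compact X_compact Z_min X_min fe conical fz fz'; subst z'.
  (* Both lifted sequences tend to the same point [z], where continuity forces [w (e z)] to be both
     0 and 1. *)
  have w0 := rcv_uniq ((w_osc (e \o u)).1 qu) (w_ucv _ _ (ucv_continuous ec uz)).
  have w1 := rcv_uniq ((w_osc (e \o u')).2 qu') (w_ucv _ _ (ucv_continuous ec uz')).
  by have := oner_neq0 R; rewrite w1 -w0 eqxx.
exists Y, rhoY; split=> //.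
- rewrite (peripheral_factor pi_surj pi_rho single).
  apply/esym; apply: (peripheral_factor q_surj q_rho) => h z z' uh hz.
  apply: q_off => g qz; apply: (pinched_stab X_eqv pi_eqv pi_rho x12 pi12 (g := fun n => (g^-1 *
      h n * g)%g)).
    have inj : injective (fun t => g^-1 * t * g)%g by move=> s t /mulIg/mulgI.
    exact: (unc_inj inj uh).
  apply: filterS (ufil_ge 0) => n _; have := hz n; rewrite qz => E.
  by rewrite !hactM E rhoK.
- move=> XY; apply: no_common; exists X, rhoX; split=> //.
  by exists id => // x; exact: cvg_id.
Qed.
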